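(* Let $m\ge 2$, let $U\subset P(m)$ be a maximal order ideal with $d_{\max}(U)\ge 2$, and let $t\ge 0$ be an integer. Then the following conditions are equivalent: (a) $\Delta_t(U)$ is a ball; (b) $\Delta_t(U)$ is a pseudomanifold; (c) $t\ge d_{\max}(U)$. More precisely, if $0\le t<d_{\max}(U)$, then $\Delta_t(U)$ has a ridge of degree $m+1$, which is the maximum possible degree of a ridge of $\Delta_t(U)$.
   Context: Notation. $\mathbb{K}$ is a field, $P(m)=\mathbb{K}[x_1,\ldots,x_m]$; $[n]=\{1,\ldots,n\}$ and $[a,b]=\{c\in\mathbb{N} : a\le c\le b\}$ (empty if $a>b$). Maximal order ideals. A maximal order ideal of $P(m)$ is a set $U$ consisting, for some integer $d\ge 1$, of all monomials of $P(m)$ of degree at most $d$; then $d_{\max}(U)=d$ is the maximal degree of a monomial in $U$. Squeezed complexes. Put $d=d_{\max}(U)$ and let $t\ge 0$ be an integer. For $u=x_{i_1}\cdots x_{i_s}\in U$ with $i_1\le\cdots\le i_s$ set $$F_t(u)=\bigcup_{\ell=1}^s\{i_\ell+2(\ell-1),\,i_\ell+2\ell-1\}\cup[m+2s+1,\,m+t+d]\quad\text{if } s\le t,$$ $$F_t(u)=\bigcup_{\ell=1}^t\{i_\ell+2(\ell-1),\,i_\ell+2\ell-1\}\cup\bigcup_{\ell=t+1}^s\{i_\ell+\ell+t-1\}\cup[m+t+s+1,\,m+t+d]\quad\text{if } s\ge t.$$ Each $F_t(u)$ is a $(d+t)$-subset of $[m+t+d]$. $\Delta_t(U)$ is the pure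 $(d+t-1)$-dimensional simplicial complex on vertex set $[m+t+d]$ whose facets are the sets $F_t(u)$, $u\in U$. Combinatorial notions. A ridge of a pure simplicial complex $\Delta$ is a face of dimension $\dim\Delta-1$; its degree is the number of facets of $\Delta$ containing it. A pure $(e-1)$-dimensional complex is strongly connected if for any two facets $F,G$ there are facets $F=F_0,F_1,\ldots,F_k=G$ with $|F_i\cap F_{i+1}|=e-1$ for all $0\le i\le k-1$. A pure simplicial complex is a pseudomanifold if it is strongly connected and every ridge lies in at most two facets. A pure $(e-1)$-dimensional complex is a ball if its geometric realization is homeomorphic to the $(e-1)$-dimensional ball. *)

(* Defs.v *)
(* MathComp / MathComp-Analysis; the notations of mpoly clash with those of
   MathComp-Analysis, hence the qualified names [mpoly.xxx]. *)
From HB Require Import structures.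
From mathcomp Require Import all_boot all_order all_algebra.
From mathcomp Require Import all_classical all_reals all_analysis.
From mathcomp Require mpoly.

Set Implicit Arguments.
Unset Strict Implicit.
Unset Printing Implicit Defensive.

Import Order.TTheory GRing.Theory Num.Theory.
Import numFieldNormedType.Exports.

Local Open Scope nat_scope.

Section Complexes.
Variable V : finType.
Implicit Types (X S : {set {set V}}) (A F G : {set V}).

(* A simplicial complex on V is given by its set of faces. *)
Definition generated_complex S : {set {set V}} :=
  [set A : {set V} | [exists F in S, A \subset F]].

Definition facets X : {set {set V}} := [set F : {set V} | maxset (mem X) F].

(* The dimension of X is (rank X) - 1. *)
Definition rank X : nat := \max_(A in X) #|A|.

Definition pure X : Prop := forall F, F \in facets X -> #|F| = rank X.

(* A face A has dimension #|A| - 1, so that dim A = dim X - 1 reads: *)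
Definition ridge X A : Prop := A \in X /\ #|A|.+1 = rank X.

Definition ridge_degree X A : nat := #|[set F : {set V} in facets X | A \subset F]|.

Definition strongly_connected X : Prop :=
  forall F G, F \in facets X -> G \in facets X ->
  exists s : seq {set V},
    [/\ {subset s <= facets X},
        path (fun A B : {set V} => #|A :&: B|.+1 == rank X) F s
      & last F s = G].

Definition pseudomanifold X : Prop :=
  [/\ pure X, strongly_connected X
    & forall A, ridge X A -> ridge_degree X A <= 2].

End Complexes.

Section Topology.
Local Open Scope classical_set_scope.
Local Open Scope ring_scope.

(* Homeomorphism of A and B, endowed with their subspace topologies. *)
Definition homeomorphic (S T : topologicalType) (A : set S) (B : set T) : Prop :=
  exists (f : S -> T) (g : T -> S),
    [/\ {within A, continuous f}, {within B, continuous g},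
        forall x, A x -> B (f x) /\ g (f x) = x
      & forall y, B y -> A (g y) /\ f (g y) = y].

(* Barycentric coordinates: the vertex i is sent to the i-th basis vector. *)
Definition realization (R : realType) (n : nat) (X : {set {set 'I_n}}) :
    set 'rV[R]_n :=
  [set x : 'rV[R]_n | [/\ forall i, 0 <= x ord0 i, \sum_i x ord0 i = 1
             & [set i : 'I_n | x ord0 i != 0]%SET \in X]].

(* The norm of 'rV[R]_k in the library is the sup norm; its topology is the
   Euclidean one. *)
Definition unit_ball (R : realType) (k : nat) : set 'rV[R]_k :=
  [set y : 'rV[R]_k | \sum_i y ord0 i ^+ 2 <= 1].

Definition is_simplicial_ball (R : realType) (n : nat) (X : {set {set 'I_n}}) : Prop :=
  pure X /\ homeomorphic (@realization R n X) (@unit_ball R (rank X).-1).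

End Topology.

Section OrderIdeals.
Local Open Scope classical_set_scope.
Variables (K : fieldType) (m : nat).

(* The monomial of K[x_1, ..., x_m] with exponent vector u; the variable x_i is
   the one of index i - 1 in 'I_m. *)
Definition monomial (u : mpoly.multinom m) : mpoly.mpoly m K :=
  mpoly.mpolyX K u.

Definition maximal_order_ideal (U : set (mpoly.mpoly m K)) : Prop :=
  exists2 d : nat, 1 <= d &
    U = [set p | exists u, p = monomial u /\ mpoly.mdeg u <= d].

(* The junk value 0 is used only when the degrees in U have no maximum. *)
Definition dmax (U : set (mpoly.mpoly m K)) : nat :=
  xget 0 [set d | (exists u, U (monomial u) /\ mpoly.mdeg u = d) /\
                  (forall u, U (monomial u) -> mpoly.mdeg u <= d)].

End OrderIdeals.

Arguments monomial K {m} u.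

Section Squeezed.
Variable m : nat.
Implicit Type u : mpoly.multinom m.

(* The sequence i_1 <= ... <= i_s such that u = x_{i_1} ... x_{i_s}, with
   1 <= i_l <= m. *)
Definition indices u : seq nat :=
  flatten [seq nseq (mpoly.fun_of_multinom u i) i.+1 | i <- enum 'I_m].

(* i_l, for l = 1, ..., s *)
Definition index_at u (l : nat) : nat := nth 0 (indices u) l.-1.

(* The set F_t(u), as a list of elements of [m+t+d] = {1, ..., m+t+d};
   [index_iota a b.+1] lists the interval [a, b]. *)
Definition squeezed_labels (t d : nat) u : seq nat :=
  let s := mpoly.mdeg u in
  if s <= t then
    flatten [seq [:: index_at u l + 2 * (l - 1); index_at u l + 2 * l - 1]
            | l <- index_iota 1 s.+1]
    ++ index_iota (m + 2 * s + 1) (m + t + d).+1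
  else
    flatten [seq [:: index_at u l + 2 * (l - 1); index_at u l + 2 * l - 1]
            | l <- index_iota 1 t.+1]
    ++ [seq index_at u l + l + t - 1 | l <- index_iota t.+1 s.+1]
    ++ index_iota (m + t + s + 1) (m + t + d).+1.

(* The ordinal v stands for the vertex v + 1 of [m+t+d]. *)
Definition squeezed_facet (t d : nat) u : {set 'I_(m + t + d)} :=
  [set v : 'I_(m + t + d) | v.+1 \in squeezed_labels t d u].

Definition squeezed_complex (K : fieldType) (U : set (mpoly.mpoly m K))
    (t : nat) : {set {set 'I_(m + t + dmax U)}} :=
  generated_complex
    [set F | `[< exists u, U (monomial K u) /\ F = squeezed_facet t (dmax U) u >]].

End Squeezed.

(* Main.v *)
Require Import Defs.
From HB Require Import structures.
From mathcomp Require Import all_boot all_order all_algebra.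
From mathcomp Require Import all_classical all_reals all_analysis.
From mathcomp Require mpoly.
From mathcomp Require Import zify ring lra.
Local Open Scope nat_scope.

(** A facet F_t(u) is encoded by a weakly increasing sequence q with values in
[0, m]: the indices of the factors of u, lowered by one and padded with m.
Counting vertices and positions from zero, the vertex of F_t(u) in position k
is q (level k) + k, where level k is k / 2 for the first 2t positions and
k - t afterwards ([squeezed_facetE]).  All such sequences that are equal to m
from the index d on occur, so that the complex depends only on m, t and d; its
facets have d + t vertices, among the m + t + d available ones, and a ridge is
therefore contained in at most m + 1 facets.

Suppose t < d.  The last factor of a monomial of degree d contributes a single
vertex, and the initial segment of d + t - 1 vertices becomes a facet whichever
vertex is added to it: it is a ridge of degree m + 1, at least 3
([initial_ridge_degree]).  Hence the complex is no pseudomanifold.  It is no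
ball either: two of these facets form a disc around the barycenter of the
ridge; an embedding of the complex into the Euclidean space of dimension
d + t - 1 would map it onto a neighbourhood of the image of the barycenter, by
invariance of domain, and this leaves no room for the points of a third facet
([three_sheets_not_embeddable]).  Invariance of domain is deduced, following
Kulpa, from the existence of zeros of inward pointing fields on a simplex, a
form of Brouwer's theorem ([inward_field_zero]), which rests on a parity
argument for finite sets with several linear orders ([scarf]).

Suppose d <= t.  A facet consists of d disjoint pairs of consecutive vertices
among the first m + 2d, and of the t - d remaining vertices, which are cone
points.  Put the first m + 2d vertices at the integers of the moment curve.
Gale's evenness condition says that these facets triangulate the cyclic polytope
of dimension 2d - 1, being the lower facets of the one of dimension 2d.
Explicitly, the linear map that records the moments of order less than 2d and
the coordinates at the cone points is injective on the realization
([moment_mx_inj]), because the product of the X - i over the vertices i of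
a facet is nonnegative at every node; and it has the same image on the realization as on
the whole simplex ([moment_mx_onto]), because a point with the smallest moment
of order 2d in its fibre cannot have d + 1 pairwise non-adjacent vertices in its
support.  So the realization is homeomorphic to a compact convex body, that
is to a ball.  Gale's evenness condition also bounds the degree of a ridge by 2,
and lowering the terms of q one at a time connects any facet to the first one. *)

Set Implicit Arguments.
Unset Strict Implicit.
Unset Printing Implicit Defensive.
Import Order.TTheory GRing.Theory Num.Theory.
Import numFieldNormedType.Exports.

(** * Scarf's parity lemma *)

Section Scarf.
Import mathcomp.boot.fintype mathcomp.boot.finset.
Variables (E I : finType) (r : I -> E -> nat).
Hypothesis r_inj : forall k, injective (r k).
Implicit Types (S T : {set E}) (x y : E) (i j k l : I).

(** Plays the part of the simplices of a triangulation, with linear orders in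
place of barycentric coordinates: nothing exceeds the minima of S in all the
orders at once. *)
Definition dominant S := [forall x, exists k, [forall y in S, r k x <= r k y]].

Lemma dominantP S :
  reflect (forall x, exists k, forall y, y \in S -> r k x <= r k y) (dominant S).
Proof.
apply: (iffP forallP) => H x.
  by have /existsP[k /forall_inP Hk] := H x; exists k.
by have [k Hk] := H x; apply/existsP; exists k; apply/forall_inP.
Qed.

Lemma dominantS S T : S \subset T -> dominant T -> dominant S.
Proof.
move=> /subsetP sST /dominantP H; apply/dominantP => x.
by have [k Hk] := H x; exists k => y /sST; apply: Hk.
Qed.

Lemma dominant_minima S : S != set0 ->
  exists mu : I -> E, [/\ forall k, mu k \in S,
    forall k y, y \in S -> r k (mu k) <= r k y &
    forall k y, y \in S -> (forall z, z \in S -> r k y <= r k z) -> y = mu k].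
Proof.
move=> /set0Pn[x0 x0S].
exists (fun k => [arg min_(x < x0 in S) r k x]); split=> k.
- by case: arg_minnP.
- by case: arg_minnP => // x _ + y => /(_ y).
- move=> y yS Hy; case: arg_minnP => // x xS Hx.
  by apply: (r_inj (k := k)); apply/eqP; rewrite eqn_leq Hy //= Hx.
Qed.

Section Door.
Variables (S : {set E}) (mu : I -> E).
Hypotheses (domS : dominant S) (cardS : #|S|.+1 = #|I|).
Hypothesis muS : forall k, mu k \in S.
Hypothesis mu_min : forall k y, y \in S -> r k (mu k) <= r k y.
Hypothesis mu_uniq : forall k y, y \in S ->
  (forall z, z \in S -> r k y <= r k z) -> y = mu k.

(** The elements that can be added to S without disturbing its minima, except
possibly the one for the order k. *)
Definition above k : {set E} := [set x | [forall l, (l != k) ==> (r l (mu l) < r l x)]].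

Lemma aboveP k x : reflect (forall l, l != k -> r l (mu l) < r l x) (x \in above k).
Proof.
rewrite inE; apply: (iffP forallP) => H l; first by move=> Hl; have := H l; rewrite Hl.
by apply/implyP; apply: H.
Qed.

Variables (i j : I).
Hypotheses (neq_ij : i != j) (mu_ij : mu i = mu j).

Lemma mu_onto : mu @: setT = S.
Proof.
apply/setP => y; apply/imsetP/idP => [[k _ ->] //|yS].
have [k Hk] := dominantP _ domS y; exists k => //; exact: mu_uniq.
Qed.

Lemma mu_onto_but_i : mu @: [set~ i] = S.
Proof.
rewrite -mu_onto; apply/eqP; rewrite eqEsubset imsetS ?subsetT //=.
apply/subsetP => _ /imsetP[k _ ->]; have [->|ki] := eqVneq k i.
  by rewrite mu_ij; apply: imset_f; rewrite !inE eq_sym.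
by apply: imset_f; rewrite !inE.
Qed.

Lemma mu_inj_but_i : {in [set~ i] &, injective mu}.
Proof.
by apply/imset_injP; rewrite mu_onto_but_i cardsC1 -cardS.
Qed.

Lemma above_notin x : x \in above i -> x \notin S.
Proof.
move/aboveP => Hx; apply/negP; rewrite -mu_onto_but_i => /imsetP[l].
by rewrite !inE => li xl; have := Hx l li; rewrite xl ltnn.
Qed.

(** An element that was dominated through the order i only lies in [above i],
hence below the new minimum x; the other minima have not moved. *)
Lemma top_dominant x : x \in above i -> (forall y, y \in above i -> r i y <= r i x) ->
  dominant (x |: S).
Proof.
move=> xA xtop; apply/dominantP => z; have [zA|/aboveP zA] := boolP (z \in above i).
  exists i => y; rewrite !inE => /orP[/eqP->|yS]; first exact: xtop.
  have [k Hk] := dominantP _ domS z.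
  have [ki|ki] := eqVneq k i; first by rewrite -ki; apply: Hk.
  by have := aboveP _ _ zA k ki; rewrite ltnNge Hk.
have [l li zl] : exists2 l, l != i & r l z <= r l (mu l).
  have /existsP[l /andP[li zl]] : [exists l, (l != i) && (r l z <= r l (mu l))].
    apply: contra_notT zA => /existsPn H l li.
    by have := H l; rewrite li -ltnNge.
  by exists l.
exists l => y; rewrite !inE => /orP[/eqP->|yS].
  by apply: (leq_trans zl); apply: ltnW; apply: (aboveP _ _ xA).
by apply: (leq_trans zl); apply: mu_min.
Qed.

(** Converse of [top_dominant]: the new element takes over the minimum of the
order i alone, and the other minima still exhaust S, so that x exceeds each of
them; dominance of the candidates makes x the largest one. *)
Lemma dominant_add_top x k : x \notin S -> dominant (x |: S) ->
  (forall y, y \in x |: S -> r k x <= r k y) -> k = i ->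
  x \in above i /\ (forall y, y \in above i -> r i y <= r i x).
Proof.
move=> xS domx kmin ki; subst k.
have low l y : y \in S -> (forall z, z \in x |: S -> r l y <= r l z) -> l != i.
  move=> yS Hl; apply/negP => /eqP li; subst l.
  have : x = y.
    apply: (r_inj (k := i)); apply/eqP; rewrite eqn_leq kmin ?inE ?yS ?orbT //=.
    by rewrite Hl // !inE eqxx.
  by move=> exy; rewrite exy yS in xS.
have xA : x \in above i.
  apply/aboveP => l li.
  have [l' Hl'] := dominantP _ domx (mu l).
  have l'i := low _ _ (muS l) Hl'.
  have : mu l = mu l'.
    by apply: mu_uniq => // z zS; apply: Hl'; rewrite !inE zS orbT.
  move/mu_inj_but_i; rewrite !inE => /(_ li l'i) ll'; subst l'.
  rewrite ltn_neqAle Hl' ?inE ?eqxx // andbT.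
  by apply: contraNneq xS => /r_inj <-.
split=> // y /aboveP yA.
have [l Hl] := dominantP _ domx y.
have [li|li] := eqVneq l i; first by subst l; apply: Hl; rewrite !inE eqxx.
have := yA l li; rewrite ltnNge Hl // !inE muS orbT //.
Qed.

(** If another order were taken over, the remaining ones would still count the
value mu i = mu j twice, and could not reach all of S. *)
Lemma new_min_colour x k : x \notin S -> dominant (x |: S) ->
  (forall y, y \in x |: S -> r k x <= r k y) -> (k == i) || (k == j).
Proof.
move=> xS domx kmin.
apply: contraT; rewrite negb_or => /andP[ki kj].
have sub : S \subset mu @: ([set~ k] :\ i).
  apply/subsetP => y yS; have [l Hl] := dominantP _ domx y.
  have lk : l != k.
    apply/negP => /eqP lk; subst l.
    have exy : x = y.
      apply: (r_inj (k := k)); apply/eqP; rewrite eqn_leq kmin ?inE ?yS ?orbT //=.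
      by rewrite Hl // !inE eqxx.
    by rewrite exy yS in xS.
  have -> : y = mu l by apply: mu_uniq => // z zS; apply: Hl; rewrite !inE zS orbT.
  have [->|li] := eqVneq l i.
    by rewrite mu_ij; apply: imset_f; rewrite !inE eq_sym neq_ij eq_sym kj.
  by apply: imset_f; rewrite !inE li lk.
have := leq_trans (subset_leq_card sub) (leq_imset_card _ _).
have := cardsD1 i [set~ k]; rewrite !inE eq_sym ki cardsC1 => H.
by move: cardS H; clear; lia.
Qed.

End Door.

(** A codimension one simplex lies in exactly two simplices: S has one more
minimum than it has elements, so a single value is repeated, for two orders i
and j, and each of them yields one element to add. The last hypothesis, which
provides the candidates, is what fails on the boundary. *)
Lemma door_two_rooms S : S != set0 -> dominant S -> #|S|.+1 = #|I| ->
  (forall k, exists x, forall l y, l != k -> y \in S ->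
     (forall z, z \in S -> r l y <= r l z) -> r l y < r l x) ->
  #|[set x | (x \notin S) && dominant (x |: S)]| = 2.
Proof.
move=> S0 domS cardS slack.
have [mu [muS mumin muuniq]] := dominant_minima S0.
have /injectivePn[i [j ij muij]] : ~~ injectiveb mu.
  apply/negP => /injectiveP inj; have := card_imset setT inj.
  rewrite (mu_onto domS muS muuniq) cardsT; lia.
have abne k : exists2 t, t \in above mu k & forall y, y \in above mu k -> r k y <= r k t.
  have [x Hx] := slack k.
  have xA : x \in above mu k.
    by apply/aboveP => l lk; apply: Hx => // z zS; apply: mumin.
  by case: (arg_maxnP (r k) xA) => t tA tm; exists t => // y; apply: tm.
have [ti tiA tim] := abne i.
have [tj tjA tjm] := abne j.
have ji : j != i by rewrite eq_sym.
have -> : [set x | (x \notin S) && dominant (x |: S)] = [set ti; tj].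
  apply/setP => x; rewrite !inE; apply/andP/orP => [[xS domx]|[/eqP->|/eqP->]].
  - have [k kmin] := dominantP _ domx x.
    have /orP[/eqP ki|/eqP kj] := new_min_colour cardS muuniq ij muij xS domx kmin.
      left; have [xA xm] := dominant_add_top domS cardS muS muuniq ij muij xS domx kmin ki.
      by apply/eqP; apply: (r_inj (k := i)); apply/eqP; rewrite eqn_leq tim ?xm.
    right; have [xA xm] := dominant_add_top domS cardS muS muuniq ji (esym muij) xS domx kmin kj.
    by apply/eqP; apply: (r_inj (k := j)); apply/eqP; rewrite eqn_leq tjm ?xm.
  - split; first exact: (above_notin domS muS muuniq ij muij).
    exact: (top_dominant domS muS mumin tiA tim).
  - split; first exact: (above_notin domS muS muuniq ji (esym muij)).
    exact: (top_dominant domS muS mumin tjA tjm).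
rewrite cards2; case: eqVneq => // tij.
have [k Hk] := dominantP _ domS ti.
have [ki|ki] := eqVneq k i.
  subst k; have := aboveP _ _ _ tjA i ij.
  by rewrite -tij ltnNge Hk.
by have := aboveP _ _ _ tiA k ki; rewrite ltnNge Hk.
Qed.

Variables (c : E -> I) (i0 : I).

Definition ridge_count T := #|[set x in T | c @: (T :\ x) == [set~ i0]]|.

(** If removing x leaves all the colours but i0, then x has the colour of
exactly one other element, and removing that one works as well. *)
Lemma ridge_count_even T : #|T| = #|I| -> c @: T != setT -> ~~ odd (ridge_count T).
Proof.
move=> cT nT; rewrite /ridge_count.
have [->|[x]] := set_0Vmem [set x in T | c @: (T :\ x) == [set~ i0]].
  by rewrite cards0.
rewrite inE => /andP[xT /eqP cx].
have cardx : #|T :\ x|.+1 = #|I| by rewrite -cT (cardsD1 x T) xT.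
have injx : {in T :\ x &, injective c}.
  by apply/imset_injP; rewrite cx cardsC1 -cardx.
have cxT : c @: T = c x |: [set~ i0] by rewrite -cx -imsetU1 setD1K.
have cxi0 : c x != i0.
  apply: contraNneq nT => cxi; rewrite cxT cxi; apply/eqP/setP => y.
  by rewrite !inE orbN.
have : c x \in c @: (T :\ x) by rewrite cx !inE.
case/imsetP => x' x'T cxx'.
have /andP[x'x x'T'] : (x' != x) && (x' \in T) by move: x'T; rewrite !inE.
suff -> : [set x in T | c @: (T :\ x) == [set~ i0]] = [set x; x'].
  by rewrite cards2 eq_sym x'x.
apply/setP => y; rewrite !inE; apply/andP/orP => [[yT /eqP cy]|].
  have [->|yx] := eqVneq y x; [by left|right]; apply: contraT => yx'.
  have : c y \in c @: (T :\ y).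
    rewrite cy -cx; apply: imset_f; by rewrite !inE yx yT.
  case/imsetP => z; rewrite !inE => /andP[zy zT] cyz.
  have [zx|zx] := eqVneq z x.
    have : y = x' by apply: injx; rewrite ?inE ?yx ?yT ?x'x ?x'T' // -cxx' cyz zx.
    by move/eqP; rewrite (negbTE yx').
  have : y = z by apply: injx; rewrite ?inE ?yx ?yT ?zx ?zT.
  by move/eqP; rewrite eq_sym (negbTE zy).
case=> /eqP->; first by rewrite xT cx eqxx.
split=> //; rewrite -cx; apply/eqP/setP => z; apply/imsetP/imsetP => -[w].
  rewrite !inE => /andP[wx' wT] ->; have [->|wx] := eqVneq w x.
    by exists x'; rewrite // !inE x'x x'T'.
  by exists w; rewrite // !inE wx wT.
rewrite !inE => /andP[wx wT] ->; have [->|wx'] := eqVneq w x'.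
  by exists x; rewrite // !inE eq_sym x'x xT.
by exists w; rewrite // !inE wx' wT.
Qed.

(** Sperner's lemma: count modulo 2 the pairs of a dominant set with #|I| - 1
elements carrying all the colours but i0 and of a dominant set with #|I|
elements containing it. The elements [s k] stand for the faces of the large
simplex: the set of all of them but [s i0] is the only one that can be
completed in a single way. *)
Theorem scarf (s : I -> E) (t0 : E) :
  (forall k, c (s k) = k) ->
  (forall k, s k != t0) ->
  (forall k x, r k (s k) <= r k x) ->
  (forall k l x, l != k -> x \notin codom s -> r l x < r l (s k)) ->
  exists S, [/\ #|S| = #|I|, dominant S, c @: S = setT &
    exists x, (x \in S) && (x \notin codom s)].
Proof.
move=> cs st0 smin smax.
have s_inj : injective s by move=> a b /(congr1 c); rewrite !cs.
have t0s : t0 \notin codom s by apply/codomP => -[k]; apply/eqP; rewrite eq_sym.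
pose rooms := [set T : {set E} | (#|T| == #|I|) && dominant T].
pose doors := [set S : {set E} | [&& #|S|.+1 == #|I|, dominant S & c @: S == [set~ i0]]].
case: (boolP [exists T in rooms, c @: T == setT]) => [/exists_inP[T]|].
  rewrite inE => /andP[/eqP cT dT] /eqP cT'; exists T; split=> //.
  apply/existsP; apply: contraT => /existsPn H.
  have Ts : T = [set s k | k in I].
    apply/eqP; rewrite eqEcard cT (card_imset _ s_inj) leqnn andbT.
    apply/subsetP => x xT; have := H x; rewrite xT negbK => /codomP[k ->].
    exact: imset_f.
  have [k Hk] := dominantP _ dT t0.
  have := Hk (s k); rewrite Ts imset_f // leqNgt ltn_neqAle smin andbT.
  by move=> /(_ isT); rewrite negbK => /eqP/r_inj sk; have := st0 k; rewrite sk eqxx.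
move/exists_inPn => Hno.
pose S0 := [set s k | k in [set~ i0]].
have cS0 : c @: S0 = [set~ i0].
  rewrite -imset_comp (eq_imset _ (g := id)) ?imset_id // => k /=; exact: cs.
have cardS0 : #|S0|.+1 = #|I|.
  rewrite (card_imset _ s_inj) cardsC1; have : 0 < #|I| by apply/card_gt0P; exists i0.
  by case: #|I|.
have domS0top : exists2 t, t \notin codom s & forall x, x \notin codom s -> r i0 x <= r i0 t.
  have t0P : t0 \in [pred x | x \notin codom s] by [].
  by case: (arg_maxnP (r i0) t0P) => t tP tm; exists t => // x; apply: tm.
have [tt ttP ttm] := domS0top.
have dom_top x : x \notin codom s -> dominant (x |: S0) = (x == tt).
  move=> xs; apply/idP/eqP => [/dominantP H|->].
    apply: (r_inj (k := i0)); apply/eqP; rewrite eqn_leq ttm //=.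
    have [k Hk] := H tt; have [ki|ki] := eqVneq k i0.
      by rewrite -ki; apply: Hk; rewrite !inE eqxx.
    have : s k \in S0 by apply: imset_f; rewrite !inE.
    move=> skS; have := Hk (s k); rewrite !inE skS orbT leqNgt ltn_neqAle smin andbT.
    by move=> /(_ isT); rewrite negbK => /eqP/r_inj sk; rewrite -sk codom_f in ttP.
  apply/dominantP => z; have [/codomP[k ->]|zs] := boolP (z \in codom s).
    by exists k => y _.
  exists i0 => y; rewrite !inE => /orP[/eqP->|/imsetP[k]]; first exact: ttm.
  rewrite !inE => ki0 ->; apply: ltnW; apply: smax => //; by rewrite eq_sym.
have domS0 : dominant S0.
  by apply: (@dominantS _ (tt |: S0)); rewrite ?subsetU1 // ?dom_top.
have S0door : S0 \in doors by rewrite inE cardS0 eqxx domS0 cS0 eqxx.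
pose N := \sum_(S in doors) \sum_(T in rooms) (S \subset T : nat).
(* Without a set carrying all the colours, every dominant set with #|I|
   elements would be counted an even number of times. *)
have evenN : ~~ odd N.
  rewrite /N exchange_big /=; elim/big_ind: _ => //.
    by move=> a b; rewrite oddD => /negbTE-> /negbTE->.
  move=> T Troom.
  have -> : \sum_(S in doors) (S \subset T : nat) = ridge_count T.
    rewrite -big_mkcondr /= sum1_card /ridge_count.
    have injD : {in [set x in T | c @: (T :\ x) == [set~ i0]] &,
        injective (fun x => T :\ x)}.
      move=> x y; rewrite !inE => /andP[xT _] /andP[yT _] exy.
      have : x \notin T :\ y by rewrite -exy !inE eqxx.
      by rewrite !inE xT andbT negbK => /eqP.
    rewrite -(card_in_imset injD); apply: eq_card => S; rewrite unfold_in.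
    move: Troom; rewrite inE => /andP[/eqP cardT domT].
    apply/andP/imsetP => [[]|[x]].
      rewrite inE => /and3P[/eqP cS dS cSi] sST.
      have : #|T :\: S| == 1.
        by rewrite cardsD (setIidPr sST) cardT -cS subSnn.
      case/cards1P => x Tx; have : x \in T :\: S by rewrite Tx set11.
      rewrite inE => /andP[xS xT].
      have ST : S = T :\ x.
        apply/setP => y; rewrite -Tx !inE.
          by case: (boolP (y \in S)) => [/(subsetP sST)->|_] //=; case: (y \in T).
      by exists x; rewrite // !inE xT -ST.
    rewrite inE => /andP[xT cx] ->; split; last exact: subsetDl.
    rewrite inE cx andbT; apply/andP; split.
      by rewrite -cardT (cardsD1 x T) xT.
    exact: (dominantS (subsetDl _ _) domT).
  apply: ridge_count_even; last exact: Hno.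
  by move: Troom; rewrite inE => /andP[/eqP].
have up S : S \in doors -> \sum_(T in rooms) (S \subset T : nat) =
    #|[set x | (x \notin S) && dominant (x |: S)]|.
  rewrite inE => /and3P[/eqP cS dS _]; rewrite -big_mkcondr /= sum1_card.
  have injD : {in [set x | (x \notin S) && dominant (x |: S)] &, injective (fun x => x |: S)}.
    move=> x y; rewrite !inE => /andP[xS _] /andP[yS _] exy.
    have : x \in y |: S by rewrite -exy !inE eqxx.
    by rewrite !inE (negbTE xS) orbF => /eqP.
  rewrite -(card_in_imset injD); apply: eq_card => T; rewrite unfold_in.
  apply/andP/imsetP => [[]|[x]].
    rewrite inE => /andP[/eqP cT dT] sST.
    have : #|T :\: S| == 1 by rewrite cardsD (setIidPr sST) cT -cS subSnn.
    case/cards1P => x Tx; have : x \in T :\: S by rewrite Tx set11.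
    rewrite inE => /andP[xS xT].
    have TS : T = x |: S by rewrite -(setID T S) (setIidPr sST) Tx setUC.
    by exists x; rewrite // !inE xS -TS.
  rewrite inE => /andP[xS dx] ->; split; last exact: subsetU1.
  by rewrite inE cardsU1 xS dx add1n cS eqxx.
have : N = \sum_(S in doors :\ S0) \sum_(T in rooms) (S \subset T : nat)
           + \sum_(T in rooms) (S0 \subset T : nat).
  rewrite /N (bigD1 S0) //= addnC; congr (_ + _).
  by apply: eq_bigl => S; rewrite !inE andbC.
rewrite up // => NE.
have one : #|[set x | (x \notin S0) && dominant (x |: S0)]| = 1.
  suff -> : [set x | (x \notin S0) && dominant (x |: S0)] = [set tt] by rewrite cards1.
  apply/setP => x; rewrite !inE; apply/andP/eqP => [[xS dx]|->].
    have [/codomP[k xk]|xs] := boolP (x \in codom s); last first.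
      by apply/eqP; rewrite -dom_top.
    have ki : k = i0.
      by apply/eqP; apply: contraNT xS => ki; rewrite xk; apply: imset_f; rewrite !inE.
    have [l Hl] := dominantP _ dx t0.
    have : s l \in x |: S0.
      rewrite !inE xk ki; have [->|li] := eqVneq l i0; first by rewrite eqxx.
      by rewrite imset_f ?orbT // !inE.
    move/Hl; rewrite leqNgt ltn_neqAle smin andbT negbK => /eqP/r_inj sl.
    by have := st0 l; rewrite sl eqxx.
  split; last by rewrite dom_top.
  by apply: contra ttP => /imsetP[k _ ->]; apply: codom_f.
rewrite one addn1 in NE.
exfalso; move: evenN; rewrite NE oddS negbK; apply/negP.
elim/big_ind: _ => //.
  by move=> a b; rewrite oddD => /negbTE-> /negbTE->.
move=> S; rewrite !inE => /andP[SS0 Sdoor].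
rewrite up ?inE // door_two_rooms //.
- apply/negP => /eqP S_0; move: Sdoor; rewrite S_0 imset0 cards0 => /and3P[/eqP cI _ /eqP ce].
  have cS0' : #|S0| == 0 by rewrite -eqSS cardS0 -cI.
  by move: SS0; rewrite S_0 eq_sym -cards_eq0 cS0'.
- by case/and3P: Sdoor.
- by case/and3P: Sdoor => /eqP.
case/and3P: Sdoor => /eqP cS dS /eqP cSi k.
exists (s k) => l y lk yS ymin.
have [/codomP[k' yk']|ys] := boolP (y \in codom s); last exact: smax.
(* a slack vertex can be a minimum only for its own order *)
have [x xS xs] : exists2 x, x \in S & x \notin codom s.
  apply/exists_inP; apply: contraT => /exists_inPn H.
  move/eqP: SS0; case; apply/eqP; rewrite eqEcard -ltnS cS cardS0 leqnn andbT.
  apply/subsetP => x xS; have := H x xS; rewrite negbK => /codomP[k1 xk].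
  rewrite xk; apply: imset_f; rewrite -cSi -(cs k1) -xk; exact: imset_f.
have k'l : k' = l.
  apply/eqP; apply: contraT => k'l; have := ymin x xS; rewrite yk' leqNgt smax //.
  by rewrite eq_sym.
rewrite yk' k'l ltn_neqAle smin andbT.
by apply: contraNneq lk => /r_inj/s_inj ->.
Qed.
End Scarf.

Section Grid.
Import mathcomp.boot.fintype mathcomp.boot.finset.
Variables (I : finType) (i0 : I) (N : nat).
Implicit Types x y : {ffun I -> 'I_N.+1}.

Definition on_grid x := \sum_i x i == N.

Lemma on_grid_ge (b : I -> nat) : \sum_i b i <= N ->
  exists2 x, on_grid x & forall i, b i <= x i.
Proof.
move=> bN.
pose f i := if i == i0 then b i + (N - \sum_i b i) else b i.
have sf : \sum_i f i = N.
  have sb : \sum_(i | i != i0) f i = \sum_(i | i != i0) b i.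
    by apply: eq_bigr => i /negbTE ii0; rewrite /f ii0.
  rewrite (bigD1 i0) //= sb /f eqxx -addnA addnCA.
  have -> : b i0 + \sum_(i | i != i0) b i = \sum_i b i by rewrite [RHS](bigD1 i0).
  exact: subnK.
have fN i : f i < N.+1 by rewrite ltnS -sf (bigD1 i) //= leq_addr.
exists [ffun i => Ordinal (fN i)].
  by apply/eqP; rewrite -[RHS]sf; apply: eq_bigr => i _; rewrite ffunE.
by move=> i; rewrite ffunE /= /f; case: eqP => // _; apply: leq_addr.
Qed.

Variable c : {ffun I -> 'I_N.+1} -> I.

Let T := {x : {ffun I -> 'I_N.+1} | on_grid x}.
Let E := (T + I)%type.
Let big := N.+1 * #|{: T}| + 1.

(** Grid points are compared by their k-th coordinate, ties being broken by an
enumeration; the slack elements come after them, except the one of k itself,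
which comes first. *)
Definition grid_rank (k : I) (e : E) : nat :=
  match e with
  | inl x => val x k * #|{: T}| + enum_rank x + 1
  | inr j => if j == k then 0 else big + enum_rank j
  end.

Lemma grid_rank_lt k (x : T) : grid_rank k (inl x) < big.
Proof.
rewrite /grid_rank /big; have : enum_rank x < #|{: T}| by exact: ltn_ord.
have := ltn_ord (val x k).
move: (nat_of_ord (val x k)) (nat_of_ord (enum_rank x)) => a b.
rewrite ltnS => aN; have : a * #|{: T}| <= N * #|{: T}| by rewrite leq_mul2r aN orbT.
move: #|{: T}| => p. rewrite mulSn. lia.
Qed.

Lemma grid_rank_inj k : injective (grid_rank k).
Proof.
have lt := grid_rank_lt.
have neq (x : T) (j : I) : grid_rank k (inl x) <> grid_rank k (inr j).
  have := lt k x; rewrite /=; case: eqP => _; lia.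
case=> [x|i] [y|j]; [|by move=> /neq|by move/esym/neq|].
  rewrite /= => /eqP; rewrite eqn_add2r => /eqP H.
  congr inl; apply: enum_rank_inj; apply: ord_inj.
  have Tpos : 0 < #|{: T}| by apply/card_gt0P; exists x.
  have := congr1 (modn^~ #|{: T}|) H.
  by rewrite !modnMDl !modn_small ?ltn_ord.
rewrite /=; case: eqP => [->|_]; case: eqP => [->|_] //; rewrite /big; try lia.
by move/eqP; rewrite eqn_add2l => /eqP/ord_inj/enum_rank_inj->.
Qed.

Lemma grid_rank_le k (x y : T) :
  grid_rank k (inl x) <= grid_rank k (inl y) -> val x k <= val y k.
Proof.
rewrite /=; have : enum_rank x < #|{: T}| by exact: ltn_ord.
have : enum_rank y < #|{: T}| by exact: ltn_ord.
move: (nat_of_ord (val x k)) (nat_of_ord (val y k)) => a b.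
move: (nat_of_ord (enum_rank x)) (nat_of_ord (enum_rank y)) => e f; move: #|{: T}| => p.
move=> fp ep H; rewrite leqNgt; apply/negP => ba.
have : b.+1 * p <= a * p by rewrite leq_mul2r ba orbT.
by rewrite mulSn; move: H; lia.
Qed.

(** In the set provided by [scarf], the coordinatewise minima of the grid
points add up to almost N, since otherwise some grid point would exceed all of
them. As the coordinates of each point add up to N, the points are within #|I|
of one another, and the coordinates along which only the slack element is
present are less than #|I|. *)
Lemma grid_kkm : exists2 y0, on_grid y0 &
  forall k, (exists y, [/\ on_grid y, c y = k &
      forall i, y i < y0 i + #|I| /\ y0 i < y i + #|I|]) \/ y0 k < #|I|.
Proof.
have [t0 t0g _] : exists2 x, on_grid x & forall i, 0 <= x i.
  by apply: (on_grid_ge (b := fun=> 0)); rewrite big1.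
pose cE (e : E) := match e with inl x => c (val x) | inr j => j end.
have [||||S [cardS domS cS [e0 /andP[e0S e0s]]]] :=
  @scarf E I grid_rank grid_rank_inj cE i0 (@inr T I) (inl (Sub t0 t0g)).
- by [].
- by [].
- by move=> k x /=; rewrite eqxx.
- move=> k l [x|j] lk; last by rewrite codom_f.
  move=> _; apply: (leq_trans (grid_rank_lt l x)).
  by rewrite /= eq_sym (negbTE lk) leq_addr.
case: e0 e0S e0s => [y0|j]; last by rewrite codom_f.
move=> y0S _.
have /fin_all_exists[a Ha] k : exists ak, [/\ forall y : T, inl y \in S -> ak <= val y k,
    inr k \in S -> ak = 0 & inr k \notin S -> exists2 y : T, inl y \in S & ak = val y k].
  have [kS|kS] := boolP (inr k \in S); first by exists 0; split.
  have y0P : y0 \in [pred y : T | inl y \in S] by [].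
  case: (arg_minnP (fun y : T => val y k) y0P) => y yP ym.
  exists (val y k); split; [by move=> z zS; apply: ym|by []|].
  by exists y.
have aN : N < \sum_k a k + #|I|.
  rewrite ltnNge; apply/negP => H.
  pose b k := if inr k \in S then 0 else (a k).+1.
  have bN : \sum_k b k <= N.
    apply: leq_trans H; rewrite -sum1_card -big_split /=.
    by apply: leq_sum => k _; rewrite /b; case: ifP; rewrite ?addn1.
  have [x xg bx] := on_grid_ge bN.
  have [k Hk] := dominantP _ _ domS (inl (Sub x xg)).
  have kS : inr k \notin S.
    by apply/negP => kS; have := Hk _ kS; rewrite /= eqxx addn1.
  have [_ _ /(_ kS)[y yS ak]] := Ha k.
  have := grid_rank_le (Hk _ yS); rewrite SubK -ak; have := bx k; rewrite /b (negbTE kS); lia.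
have close (y y' : T) i : inl y \in S -> inl y' \in S -> val y i < val y' i + #|I|.
  move=> yS y'S; have [lo' _ _] := Ha i; have := lo' _ y'S.
  have : \sum_k val y k = N by apply/eqP; exact: (valP y).
  rewrite [X in X = _](bigD1 i) //=; move: aN; rewrite [X in X + _](bigD1 i) //=.
  have : \sum_(k | k != i) a k <= \sum_(k | k != i) val y k.
    by apply: leq_sum => k _; have [lo _ _] := Ha k; apply: lo.
  move=> /= h1 h2 h3 h4; move: h1 h2 h3 h4.
  move: (\sum_(k | _) _) (\sum_(k | _) _) => p1 p2; lia.
exists (val y0); first exact: (valP y0).
move=> k; have : k \in cE @: S by rewrite cS.
case/imsetP => -[y|j] eS /= ->.
  by left; exists (val y); split; [exact: (valP y)| |split; apply: close].
right; have [_ /(_ eS) ak0 _] := Ha j.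
have : \sum_k val y0 k = N by apply/eqP; exact: (valP y0).
rewrite [X in X = _](bigD1 j) //=; move: aN; rewrite [X in X + _](bigD1 j) //= ak0.
have : \sum_(k | k != j) a k <= \sum_(k | k != j) val y0 k.
  by apply: leq_sum => i _; have [lo _ _] := Ha i; apply: lo.
move=> /= h1 h2 h3; move: h1 h2 h3.
move: (\sum_(k | _) _) (\sum_(k | _) _) => p1 p2; lia.
Qed.
End Grid.

(** * Zeros of inward pointing fields on a simplex *)

Section Eps.
Local Open Scope classical_set_scope.
Local Open Scope ring_scope.
Variable R : realType.

Lemma coord_le_norm n (x : 'rV[R]_n) i : `|x ord0 i| <= `|x|.
Proof.
rewrite [leRHS]/Num.Def.normr /= mx_normrE.
by apply/bigmax_geP; right => /=; exists (ord0, i).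
Qed.

Lemma norm_le_coord n (x : 'rV[R]_n) e : 0 <= e ->
  (forall i, `|x ord0 i| <= e) -> `|x| <= e.
Proof.
move=> e0 H; rewrite [leLHS]/Num.Def.normr /= mx_normrE; apply/bigmax_leP; split=> //.
by move=> [a i] _ /=; rewrite (ord1 a).
Qed.

Lemma norm_lt_coord n (x : 'rV[R]_n) e : 0 < e ->
  (forall i, `|x ord0 i| < e) -> `|x| < e.
Proof.
move=> e0 H; rewrite [ltLHS]/Num.Def.normr /= mx_normrE; apply/bigmax_ltP; split=> //.
by move=> [a i] _ /=; rewrite (ord1 a).
Qed.

(** Continuity of f within A, in the form used by metric estimates. *)
Definition cont_on (U V : normedModType R) (A : set U) (f : U -> V) :=
  forall x, A x -> forall e, 0 < e -> exists2 d, 0 < d &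
  forall y, A y -> `|x - y| < d -> `|f x - f y| < e.

Lemma cont_onP (U V : normedModType R) (A : set U) (f : U -> V) :
  {within A, continuous f} <-> cont_on A f.
Proof.
split=> [/subspace_continuousP H x Ax e e0|H].
  have /cvgrPdist_lt/(_ e e0) := H x Ax.
  rewrite near_withinE => /nbhs_ballP[d /= d0 Hd]; exists d => // y Ay xy.
  by apply: Hd => //; rewrite -ball_normE.
apply/subspace_continuousP => x Ax; apply/cvgrPdist_lt => e e0.
have [d d0 Hd] := H x Ax e e0; rewrite near_withinE; apply/nbhs_ballP.
by exists d => //= y; rewrite -ball_normE /= => xy Ay; apply: Hd.
Qed.

Lemma closed_eps (U : normedModType R) (A : set U) :
  (forall x, (forall e, 0 < e -> exists2 y, A y & `|x - y| < e) -> A x) -> closed A.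
Proof.
move=> H x clx; apply: H => e e0.
have [y [Ay By]] := clx _ (nbhsx_ballx x e e0).
by exists y => //; move: By; rewrite -ball_normE.
Qed.

Lemma compact_eps n (A : set 'rV[R]_n) M : (forall x, A x -> `|x| <= M) ->
  (forall x, (forall e, 0 < e -> exists2 y, A y & `|x - y| < e) -> A x) -> compact A.
Proof.
move=> AM /closed_eps cA; apply: bounded_closed_compact cA.
exists M; split; first by rewrite num_real.
by move=> N MN x /AM xM; apply: (le_trans xM); apply: ltW.
Qed.

Lemma compact_cluster (U : normedModType R) (K : set U) (u : nat -> U) :
  compact K -> (forall N, K (u N)) ->
  exists2 p, K p & forall e N0, 0 < e -> exists2 N, (N0 <= N)%N & `|p - u N| < e.
Proof.
move=> cK uK.
have uoo : (u @ \oo) K by exists 0%N => // N _; apply: uK.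
have [p [Kp clp]] := cK (u @ \oo) _ uoo.
exists p => // e N0 e0.
have [||x [[N /= N0N <-] By]] := clp (u @` [set N | (N0 <= N)%N]) (ball p e).
- by exists N0 => // N /= ?; exists N.
- exact: nbhsx_ballx.
by exists N => //; move: By; rewrite -ball_normE.
Qed.

(** The inverse of F is uniformly continuous: two sequences that stay apart
while their images come together would cluster at two points with the same
image. *)
Lemma compact_uniformly_injective (U V : normedModType R) (K : set U) (F : U -> V) :
  compact K -> cont_on K F -> {in K &, injective F} ->
  forall d, 0 < d -> exists2 e, 0 < e &
    forall x y, K x -> K y -> d <= `|x - y| -> e <= `|F x - F y|.
Proof.
move=> cK cF iF d d0; apply: contrapT => nH.
have /choice[u Hu] (N : nat) : exists xy : U * U,
    [/\ K xy.1, K xy.2, d <= `|xy.1 - xy.2| & `|F xy.1 - F xy.2| < N.+1%:R^-1].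
  apply: contrapT => H; apply: nH; exists N.+1%:R^-1; first by rewrite invr_gt0.
  move=> x y Kx Ky xy; rewrite leNgt; apply/negP => Fxy.
  by apply: H; exists (x, y).
have [[p q] [/= Kp Kq] Hpq] := compact_cluster (compact_setX cK cK)
  (fun N => let: And4 a b _ _ := Hu N in conj a b).
have pq_close e N0 : 0 < e -> exists2 N, (N0 <= N)%N &
    `|p - (u N).1| < e /\ `|q - (u N).2| < e.
  move=> e0; have [N N0N] := Hpq e N0 e0; rewrite prod_normE /= gt_max => /andP[? ?].
  by exists N.
have Fpq : F p = F q.
  apply/eqP; rewrite -subr_eq0 -normr_le0 leNgt; apply/negP => Fpq.
  set e := `|F p - F q| in Fpq; have e3 : 0 < e / 3 by rewrite divr_gt0.
  have [d1 d10 H1] := cF p Kp _ e3; have [d2 d20 H2] := cF q Kq _ e3.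
  have [N1 N1e] : exists N1, N1.+1%:R^-1 < e / 3.
    have [k] := ltr_add_invr (y := 0) (x := e / 3) e3.
    by rewrite add0r => ?; exists k.
  have [N NN1 [pN qN]] := pq_close (Num.min d1 d2) N1 ltac:(by rewrite lt_min d10).
  move: pN qN; rewrite !lt_min => /andP[pN _] /andP[_ qN].
  have [KN1 KN2 _ FN] := Hu N.
  have := H1 _ KN1 pN; have := H2 _ KN2 qN; move=> h2 h1.
  have FN' : `|F (u N).1 - F (u N).2| < e / 3.
    apply: (lt_trans FN); apply: le_lt_trans N1e.
    by rewrite lef_pV2 ?posrE // ler_nat.
  have : e <= `|F p - F (u N).1| + `|F (u N).1 - F (u N).2| + `|F q - F (u N).2|.
    rewrite (distrC (F q)) /e.
    have -> : F p - F q = (F p - F (u N).1) + (F (u N).1 - F (u N).2) + (F (u N).2 - F q).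
      by rewrite !addrA !subrK.
    by apply: (le_trans (ler_normD _ _)); rewrite lerD2r ler_normD.
  by lra.
have epq : p = q by apply: iF; rewrite ?inE.
have d2 : 0 < d / 2 by rewrite divr_gt0.
have [N _ [pN qN]] := pq_close _ 0%N d2.
have [_ _ dN _] := Hu N.
have : `|(u N).1 - (u N).2| <= `|p - (u N).1| + `|q - (u N).2|.
  rewrite (distrC p) -epq; have -> : (u N).1 - (u N).2 = ((u N).1 - p) + (p - (u N).2) by rewrite addrA subrK.
  exact: ler_normD.
by lra.
Qed.

Definition simplex n : set 'rV[R]_n :=
  [set x | (forall i, 0 <= x ord0 i) /\ \sum_i x ord0 i = 1].

Lemma simplex_le1 n (x : 'rV[R]_n) i : simplex x -> x ord0 i <= 1.
Proof.
by move=> [x0 <-]; rewrite (bigD1 i) //= lerDl sumr_ge0.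
Qed.

Lemma simplex_norm n (x : 'rV[R]_n) : simplex x -> `|x| <= 1.
Proof.
move=> Sx; apply: norm_le_coord => // i.
by rewrite ger0_norm ?simplex_le1 //; case: Sx.
Qed.

Lemma coord_sum_continuous n : continuous (fun x : 'rV[R]_n => \sum_i x ord0 i).
Proof.
apply: (continuous_big (op := fun a b : R => a + b)) => [|i _].
  exact: add_continuous.
exact: coord_continuous.
Qed.

Lemma simplex_closed n : closed (@simplex n).
Proof.
have -> : @simplex n = \bigcap_(i : 'I_n) [set x | 0 <= x ord0 i] `&`
    [set x | \sum_i x ord0 i = 1].
  apply/seteqP; split=> x /= [x0 x1]; split=> // i; [move=> _|]; exact: x0.
apply: closedI; last first.
  apply: (@closed_comp _ _ (fun x : 'rV[R]_n => \sum_i x ord0 i) [set y | y = 1]).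
    by move=> x _; apply: coord_sum_continuous.
  exact: closed_eq.
apply: closed_bigI => i _.
apply: (@closed_comp _ _ (fun x : 'rV[R]_n => x ord0 i) [set y | 0 <= y]).
  by move=> x _; apply: coord_continuous.
exact: closed_ge.
Qed.

Lemma simplex_compact n : compact (@simplex n).
Proof.
apply: bounded_closed_compact; last exact: simplex_closed.
exists 1; split; first by rewrite num_real.
by move=> N N1 x /simplex_norm x1; apply: (le_trans x1); apply: ltW.
Qed.

Definition barycenter n : 'rV[R]_n.+1 := \row_i n.+1%:R^-1.

Lemma barycenter_gt0 n i : 0 < barycenter n ord0 i.
Proof. by rewrite mxE invr_gt0 ltr0n. Qed.

Lemma barycenter_simplex n : simplex (barycenter n).
Proof.
split=> [i|]; first exact: ltW (barycenter_gt0 i).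
rewrite (eq_bigr (fun=> n.+1%:R^-1)) => [|i _]; last by rewrite mxE.
by rewrite sumr_const card_ord -[_ *+ _]mulr_natl divff // pnatr_eq0.
Qed.

Lemma small_invn (e : R) : 0 < e -> exists N0 : nat, forall N, (N0 <= N)%N -> N.+1%:R^-1 < e.
Proof.
move=> e0; have [k] := ltr_add_invr (y := 0) e0; rewrite add0r => Hk.
exists k => N kN; apply: le_lt_trans Hk.
by rewrite lef_pV2 ?posrE // ler_nat.
Qed.

(** Equivalent to Brouwer's fixed point theorem. Colour a point of a fine grid
by a coordinate along which h is nonnegative, which exists as the coordinates
of h add up to 0. By [grid_kkm] there are points near which each colour
appears, unless the coordinate of that colour is small; at a cluster point of
them all the coordinates of h are nonnegative, by continuity or by the
condition on the boundary, hence 0. *)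
Theorem inward_field_zero n (h : 'rV[R]_n.+1 -> 'rV[R]_n.+1) :
  cont_on (@simplex n.+1) h ->
  (forall x, simplex x -> \sum_i h x ord0 i = 0) ->
  (forall x i, simplex x -> x ord0 i = 0 -> 0 <= h x ord0 i) ->
  exists2 x, simplex x & h x = 0.
Proof.
move=> ch h0 hb.
pose pt N (y : {ffun 'I_n.+1 -> 'I_N.+2}) : 'rV[R]_n.+1 := \row_i ((y i)%:R / N.+1%:R).
have ptS (N : nat) (y : {ffun 'I_n.+1 -> 'I_N.+2}) : on_grid y -> simplex (pt N y).
  move=> /eqP yN; split=> [i|]; first by rewrite mxE divr_ge0.
  rewrite (eq_bigr (fun i => (y i)%:R / N.+1%:R)); last by move=> i _; rewrite mxE.
  rewrite -mulr_suml -natr_sum yN; by rewrite divff // pnatr_eq0.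
pose c N (y : {ffun 'I_n.+1 -> 'I_N.+2}) : 'I_n.+1 :=
  odflt ord0 [pick i | 0 <= h (pt N y) ord0 i].
have cP : forall (M : nat) (y : {ffun 'I_n.+1 -> 'I_M.+2}), on_grid y -> 0 <= h (pt M y) ord0 (c M y).
  move=> M y yg; rewrite /c; case: pickP => //= H.
  have : \sum_i h (pt M y) ord0 i < 0.
    rewrite big_ord_recl; apply: ltr_wnDr; last by rewrite ltNge H.
    by apply: sumr_le0 => i _; apply: ltW; rewrite ltNge H.
  by rewrite h0 ?ltxx //; apply: ptS.
have /choice[u Hu] (N : nat) : exists y0 : 'rV[R]_n.+1, simplex y0 /\ forall k,
    (exists2 y, simplex y & 0 <= h y ord0 k /\
       forall i, `|y ord0 i - y0 ord0 i| <= n.+1%:R / N.+1%:R) \/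
    y0 ord0 k <= n.+1%:R / N.+1%:R.
  have [y0 y0g H] := @grid_kkm 'I_n.+1 ord0 N.+1 (c N).
  exists (pt N y0); split; first exact: ptS.
  move=> k; case: (H k) => [[y [yg ck close]]|y0k]; [left|right].
    exists (pt N y); first exact: ptS.
    split; first by rewrite -ck; apply: cP.
    move=> i; have := close i; rewrite card_ord => -[c1 c2].
    rewrite !mxE -mulrBl normrM (ger0_norm (x := N.+1%:R^-1)) ?invr_ge0 //.
    rewrite ler_pM2r ?invr_gt0 // ler_norml.
    have : (y i)%:R <= (y0 i)%:R + n.+1%:R :> R by rewrite -natrD ler_nat ltnW.
    have : (y0 i)%:R <= (y i)%:R + n.+1%:R :> R by rewrite -natrD ler_nat ltnW.
    by move=> ? ?; apply/andP; split; lra.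
  by rewrite mxE ler_pM2r ?invr_gt0 // ler_nat; move: y0k; rewrite card_ord => /ltnW.
have [x Sx clx] := compact_cluster (@simplex_compact n.+1) (fun N => proj1 (Hu N)).
exists x => //.
have hge i : 0 <= h x ord0 i.
  rewrite leNgt; apply/negP => hi.
  have xi : 0 < x ord0 i.
    rewrite lt_neqAle; case: (Sx) => /(_ i) -> _; rewrite andbT.
    by apply: contraTneq hi => /esym /hb; rewrite -leNgt; apply.
  have [d d0 Hd] := ch x Sx (- h x ord0 i) ltac:(by rewrite oppr_gt0).
  pose r := Num.min d (x ord0 i) / 2.
  have r0 : 0 < r by rewrite divr_gt0 // lt_min d0.
  have rd : r <= d / 2 by rewrite ler_pM2r ?invr_gt0 // ge_min lexx.
  have rx : r <= x ord0 i / 2 by rewrite ler_pM2r ?invr_gt0 // ge_min lexx orbT.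
  clearbody r; have [N0 HN0] := @small_invn (r / n.+1%:R) ltac:(by rewrite divr_gt0).
  have [N /HN0] := clx r N0 r0; rewrite ltr_pdivlMr // mulrC => Nr xN.
  have xNi j : `|x ord0 j - u N ord0 j| < r.
    by apply: le_lt_trans xN; have := coord_le_norm (x - u N) j; rewrite !mxE.
  case: (Hu N) => SN /(_ i)[[y Sy [hy close]]|].
    have : `|x - y| < d.
      apply: norm_lt_coord => // j; rewrite !mxE.
      have h1 := xNi j; have h2 := le_lt_trans (close j) Nr.
      have h3 : `|x ord0 j - y ord0 j| <= `|x ord0 j - u N ord0 j| + `|y ord0 j - u N ord0 j|.
        by rewrite (distrC (y ord0 j)); apply: le_trans (ler_normD _ _); rewrite addrA subrK.
      by lra.
    move=> /(Hd _ Sy) hxy.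
    have := coord_le_norm (h x - h y) i; rewrite !mxE => H.
    have := le_lt_trans H hxy; rewrite distrC => /(le_lt_trans (ler_norm _)) h1.
    by lra.
  move=> /le_lt_trans/(_ Nr) h1; have := xNi i; move=> /(le_lt_trans (ler_norm _)); lra.
have := h0 x Sx; move/eqP; rewrite psumr_eq0 // => /allP H.
by apply/rowP => i; rewrite mxE; apply/eqP; apply: H; rewrite mem_index_enum.
Qed.

End Eps.

(** * Invariance of domain *)

Section InvarianceOfDomain.
Local Open Scope classical_set_scope.
Local Open Scope ring_scope.
Variable R : realType.

Lemma cont_on_comp (U V W : normedModType R) (A : set U) (B : set V) (f : U -> V) (g : V -> W) :
  cont_on A f -> (forall x, A x -> B (f x)) -> cont_on B g -> cont_on A (g \o f).
Proof.
move=> cf AB cg x Ax e e0; have [d d0 Hd] := cg (f x) (AB x Ax) e e0.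
have [d' d'0 Hd'] := cf x Ax d d0; exists d' => // y Ay xy.
by apply: Hd; [exact: AB|exact: Hd'].
Qed.

Lemma lipschitz_cont_on (U V : normedModType R) (A : set U) (f : U -> V) L :
  (forall x y, `|f x - f y| <= L * `|x - y|) -> cont_on A f.
Proof.
move=> fL x Ax e e0; exists (e / (`|L| + 1)); first by rewrite divr_gt0 ?ltr_wpDl.
move=> y _; rewrite ltr_pdivlMr ?ltr_wpDl // => xy.
apply: le_lt_trans (fL x y) (le_lt_trans _ xy); rewrite mulrC.
apply: ler_wpM2l; first exact: normr_ge0.
by apply: le_trans (ler_norm _) _; rewrite lerDl.
Qed.

Lemma at_cont_on (U V : normedModType R) (A : set U) (f : U -> V) :
  (forall x, A x -> {for x, continuous f}) -> cont_on A f.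
Proof.
move=> H; apply/cont_onP; apply/subspace_continuousP => x Ax.
apply: cvg_trans (H x Ax); exact: (cvg_app f (cvg_within A)).
Qed.

Lemma norm_coord n (x : 'rV[R]_n) : `|x| != 0 -> exists i, `|x| = `|x ord0 i|.
Proof.
move=> /mx_norm_neq0[[a i] /= H]; by exists i; move: H; rewrite (ord1 a) => H; exact: H.
Qed.

(** The boundary of the cube has one dimension less than the space. Cut it
into a number of order N^k of cells of size 2 e / N, and consider the M^(k+1)
values on a grid of mesh d / M: two of them cannot come from the same cell if
N is a large multiple of M, but for M large there are more values than cells.
*)
Lemma lipschitz_cube_boundary k (P : 'rV[R]_k.+1 -> 'rV[R]_k.+1) L (c : 'rV[R]_k.+1) e d :
  0 <= L -> (forall x y, `|P x - P y| <= L * `|x - y|) -> 0 < e -> 0 < d ->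
  exists2 v, `|v| <= d & forall y, `|y - c| = e -> P y != v.
Proof.
move=> L0 PL e0 d0; apply: contrapT => nH.
have fill v : `|v| <= d -> exists2 y, `|y - c| = e & P y = v.
  move=> vd; apply: contrapT => H; apply: nH; exists v => // y yc.
  by apply/eqP => Py; apply: H; exists y.
(* The image of a cell has size at most L * (2 e / N), less than the mesh d /
   M if N = B M; and M^(k+1) exceeds the number 2 (k + 1) (N + 1)^k of cells.
   *)
pose B := (Num.truncn (2 * L * e / d)).+1.
have HB : 2 * L * e / d < B%:R by apply: truncnS_gt.
pose M := (2 * k.+1 * (2 * B) ^ k).+1.
pose N := (B * M)%N.
have N0 : 0 < N%:R :> R by rewrite ltr0n.
have M0 : 0 < M%:R :> R by rewrite ltr0n.
have e2N : 0 <= 2 * e / N%:R.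
  by apply: divr_ge0; [apply: mulr_ge0 => //; exact: ltW|exact: ltW].
pose v (a : {ffun 'I_k.+1 -> 'I_M}) : 'rV[R]_k.+1 := \row_i (d / M%:R * (a i)%:R).
have vd a : `|v a| <= d.
  apply: norm_le_coord => [|i]; first exact: ltW.
  rewrite mxE ger0_norm; last by rewrite mulr_ge0 // divr_ge0 // ltW.
  rewrite mulrAC ler_pdivrMr // ler_pM2l // ler_nat; exact: ltnW.
have /choice[y Hy] a : exists y, `|y - c| = e /\ P y = v a.
  by have [y] := fill _ (vd a); exists y.
have side a : exists i, `|y a ord0 i - c ord0 i| = e.
  have [ya _] := Hy a; have [|i] := @norm_coord _ (y a - c); first by rewrite ya gt_eqF.
  by rewrite ya !mxE => ->; exists i.
have [s Hs] := choice side.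
pose cell (t : R) := Num.truncn ((t + e) * N%:R / (2 * e)).
have cellN t : `|t| <= e -> (cell t < N.+1)%N.
  rewrite ler_norml => /andP[t1 t2]; rewrite ltnS truncn_le_nat.
  apply: (@le_lt_trans _ _ N%:R); last by rewrite ltr_nat.
  rewrite ler_pdivrMr ?mulr_gt0 // mulrC ler_pM2l //; lra.
have cellP t t' : `|t| <= e -> `|t'| <= e -> cell t = cell t' ->
    `|t - t'| <= 2 * e / N%:R.
  move=> te t'e ct.
  have pos u : `|u| <= e -> 0 <= (u + e) * N%:R / (2 * e).
    rewrite ler_norml => /andP[u1 _]; rewrite divr_ge0 ?mulr_ge0 ?(ltW e0) //.
    by rewrite -lerBlDr sub0r.
  have /andP[a1 a2] := truncn_itv (pos _ te).
  have /andP[b1 b2] := truncn_itv (pos _ t'e).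
  move: a1 a2 b1 b2; rewrite -/(cell t) -/(cell t') ct.
  rewrite !ler_pdivlMr ?mulr_gt0 // !ltr_pdivrMr ?mulr_gt0 // -[(cell t').+1%:R]natr1.
  move: ((cell t')%:R) (N%:R) N0 => w n n0 a1 a2 b1 b2.
  rewrite -{1}(gtr0_norm n0) -normrM ler_norml; apply/andP; split; lra.
pose code a : 'I_k.+1 * bool * {ffun 'I_k -> 'I_N.+1} :=
  (s a, 0 < y a ord0 (s a) - c ord0 (s a),
   [ffun j => inord (cell (y a ord0 (lift (s a) j) - c ord0 (lift (s a) j)))]).
have yc a i : `|y a ord0 i - c ord0 i| <= e.
  by have [<- _] := Hy a; have := coord_le_norm (y a - c) i; rewrite !mxE.
have code_inj : injective code.
  move=> a b ab; have sab : s a = s b by case: ab.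
  have close : `|y a - y b| <= 2 * e / N%:R.
    apply: norm_le_coord => [|i]; first exact: e2N.
    rewrite !mxE.
    have -> : y a ord0 i - y b ord0 i = (y a ord0 i - c ord0 i) - (y b ord0 i - c ord0 i).
      by rewrite opprB addrA subrK.
    have [j ->|->] := unliftP (s a) i.
      apply: cellP => //; case: ab => _ _ /ffunP/(_ j); rewrite !ffunE -sab.
      by move/(congr1 val); rewrite /= !inordK ?cellN.
    have : (0 < y a ord0 (s a) - c ord0 (s a)) = (0 < y b ord0 (s a) - c ord0 (s a)).
      by rewrite {3 4}sab; case: ab.
    have := Hs a; have := Hs b; rewrite -sab.
    move: (y a ord0 _ - _) (y b ord0 _ - _) => p q qe pe.
    have [q0|q0] := ltP 0 q; have [p0|p0] := ltP 0 p => // _.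
      rewrite gtr0_norm // in qe; rewrite gtr0_norm // in pe.
      by rewrite pe qe subrr normr0.
    rewrite ler0_norm // in qe; rewrite ler0_norm // in pe.
    have -> : p - q = 0 by lra.
    by rewrite normr0.
  apply/ffunP => i; apply: ord_inj; apply/eqP; apply: contraT => ai.
  have : d / M%:R <= `|v a - v b|.
    apply: le_trans (coord_le_norm _ i); rewrite !mxE -mulrBr normrM.
    rewrite ger0_norm ?divr_ge0 ?(ltW d0) // ler_peMr ?divr_ge0 ?(ltW d0) //.
    have one (p q : nat) : (p < q)%N -> 1 <= q%:R - p%:R :> R.
      by move=> pq; rewrite lerBrDr addrC natr1 ler_nat.
    have /orP[lt|lt] : (a i < b i)%N || (b i < a i)%N by rewrite -neq_ltn.
      by rewrite ler_normr opprB (one _ _ lt) orbT.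
    by rewrite ler_normr (one _ _ lt).
  have [_ <-] := Hy a; have [_ <-] := Hy b.
  move=> /le_trans/(_ (PL _ _)) H1.
  have := le_trans H1 (ler_wpM2l L0 close).
  rewrite leNgt => /negP H2; exfalso; apply: H2.
  rewrite /N natrM invfM !mulrA ltr_pM2r ?invr_gt0 //.
  rewrite ltr_pdivrMr ?ltr0n //; move: HB; rewrite ltr_pdivrMr //.
  by rewrite (mulrC B%:R) (mulrC L).
have := leq_card _ code_inj.
rewrite card_ffun !card_ord !card_prod card_bool card_ffun !card_ord.
apply/negP; rewrite -ltnNge.
have N2 : (N.+1 <= 2 * B * M)%N by rewrite /N -mulnA mul2n -addnn -addn1 leq_add2l muln_gt0.
have : (N.+1 ^ k <= (2 * B) ^ k * M ^ k)%N.
  rewrite -expnMn.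
  by elim: (k) => // j IH; rewrite !expnS leq_mul.
rewrite expnS => H; apply: (@leq_ltn_trans (k.+1 * 2 * ((2 * B) ^ k * M ^ k))).
  by rewrite leq_mul2l H orbT.
rewrite mulnA ltn_pmul2r ?expn_gt0 // /M.
by rewrite ltnS (mulnC k.+1).
Qed.


(** Inf-convolution of the inverse with a cone of slope L, large enough to
beat the modulus of continuity given by [compact_uniformly_injective]. The
infimum runs over K, and makes sense at every point of the space. *)
Lemma lipschitz_approx_inverse p q (K : set 'rV[R]_p) (F : 'rV[R]_p -> 'rV[R]_q) d :
  compact K -> K !=set0 -> cont_on K F -> {in K &, injective F} -> 0 < d ->
  exists L, exists2 P : 'rV[R]_q -> 'rV[R]_p,
    0 <= L /\ (forall y z, `|P y - P z| <= L * `|y - z|) &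
    forall x, K x -> `|P (F x) - x| <= d.
Proof.
move=> cK [x0 Kx0] cF iF d0.
have [B B0 KB] : exists2 B, 0 < B & forall x, K x -> `|x| <= B.
  have [B [_ HB]] := compact_bounded cK.
  exists (`|B| + 1); first by rewrite ltr_wpDl.
  move=> x; apply: HB; rewrite ltr_pwDr //; exact: ler_norm.
have [h h0 Hh] := compact_uniformly_injective cK cF iF d0.
pose L := 2 * B / h.
have L0 : 0 < L by rewrite divr_gt0 // mulr_gt0.
pose A (y : 'rV[R]_q) j := [set x ord0 j + L * `|y - F x| | x in K].
have Albd y j : has_lbound (A y j).
  exists (- B) => _ [x Kx <-]; have := le_trans (coord_le_norm x j) (KB x Kx).
  rewrite ler_norml => /andP[xB _]; apply: (le_trans xB).
  by rewrite lerDl mulr_ge0 // ltW.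
have A0 y j : A y j !=set0 by exists (x0 ord0 j + L * `|y - F x0|); exists x0.
have lip y z j : inf (A y j) <= inf (A z j) + L * `|y - z|.
  rewrite -lerBlDr; apply: lb_le_inf => // _ [x Kx <-]; rewrite lerBlDr.
  apply: (@le_trans _ _ (x ord0 j + L * `|y - F x|)); first by apply: ge_inf => //; exists x.
  rewrite -addrA lerD2l -mulrDr ler_pM2l // [leRHS]addrC.
  by apply: le_trans (ler_normD _ _); rewrite addrA subrK.
exists L, (fun y => \row_j inf (A y j)).
  split=> [|y z]; first exact: ltW.
  apply: norm_le_coord => [|j]; first by rewrite mulr_ge0 // ltW.
  rewrite !mxE ler_norml; have := lip y z j; have := lip z y j; rewrite (distrC z).
  by move=> ? ?; apply/andP; split; lra.
move=> x Kx; apply: norm_le_coord => [|j]; first exact: ltW.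
rewrite !mxE ler_norml; apply/andP; split; last first.
  rewrite lerBlDr; apply: (@le_trans _ _ (x ord0 j + L * `|F x - F x|)).
    by apply: ge_inf => //; exists x.
  by rewrite subrr normr0 mulr0 addr0 lerDr ltW.
rewrite lerBrDr; apply: lb_le_inf => // _ [z Kz <-].
have [xz|xz] := ltP `|x - z| d.
  have := le_lt_trans (coord_le_norm (x - z) j) xz; rewrite !mxE => /(le_lt_trans (ler_norm _)) xzj.
  by apply: (@le_trans _ _ (z ord0 j)); [lra|rewrite lerDl mulr_ge0 // ltW].
have Fxz := Hh x z Kx Kz xz.
have : 2 * B <= L * `|F x - F z|.
  by rewrite /L -mulrA ler_peMr ?mulr_ge0 ?(ltW B0) // mulrC ler_pdivlMr // mul1r.
have := le_trans (coord_le_norm x j) (KB x Kx); have := le_trans (coord_le_norm z j) (KB z Kz).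
rewrite !ler_norml => /andP[z1 z2] /andP[x1 x2]; lra.
Qed.

(** Moves the cube of centre c and radius e radially onto its boundary, and
fixes the other points. *)
Definition push_out n (c : 'rV[R]_n) (e : R) (y : 'rV[R]_n) : 'rV[R]_n :=
  c + Num.max 1 (e / `|y - c|) *: (y - c).

Lemma push_out_cont n (c : 'rV[R]_n) e : cont_on [set y | y != c] (push_out c e).
Proof.
apply: at_cont_on => y /= yc.
have sub : {for y, continuous (fun y : 'rV[R]_n => y - c)}.
  by apply: continuousB; [move=> A|exact: cst_continuous].
apply: continuousD; first exact: cst_continuous.
apply: continuousZ; last exact: sub.
apply: (@continuous_max R _ (fun=> 1) (fun y : 'rV[R]_n => e / `|y - c|)); first exact: cst_continuous.
apply: continuousM; first exact: cst_continuous.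
apply: continuousV; first by rewrite normr_eq0 subr_eq0.
exact: (cvg_norm sub).
Qed.

Lemma push_out_far n (c : 'rV[R]_n) e y : 0 < e -> e <= `|y - c| -> push_out c e y = y.
Proof.
move=> e0 ey; rewrite /push_out.
have -> : Num.max 1 (e / `|y - c|) = 1.
  by apply/max_idPl; rewrite ler_pdivrMr ?mul1r // (lt_le_trans e0).
by rewrite scale1r addrC subrK.
Qed.

Lemma push_out_near n (c : 'rV[R]_n) e y : 0 < e -> y != c -> `|y - c| < e ->
  `|push_out c e y - c| = e.
Proof.
move=> e0 yc ey; have yc0 : 0 < `|y - c| by rewrite normr_gt0 subr_eq0.
have em : Num.max 1 (e / `|y - c|) = e / `|y - c|.
  by apply/max_idPr; rewrite ler_pdivlMr // mul1r ltW.
rewrite /push_out em.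
by rewrite addrC addKr normrZ ger0_norm ?divr_ge0 ?(ltW e0) // divfK // gt_eqF.
Qed.

Lemma rowB_coord n (x y : 'rV[R]_n) i : (x - y) ord0 i = x ord0 i - y ord0 i.
Proof. by rewrite !mxE. Qed.

Lemma simplexB_last n (x p : 'rV[R]_n.+1) : simplex x -> simplex p ->
  \sum_j (x - p) ord0 (lift ord_max j) = - (x - p) ord0 ord_max.
Proof.
move=> [_ x1] [_ p1].
have : \sum_j (x - p) ord0 j = 0.
  rewrite (eq_bigr (fun j => x ord0 j - p ord0 j)) => [|j _]; last exact: rowB_coord.
  by rewrite sumrB x1 p1 subrr.
rewrite big_ord_recr /= => /eqP; rewrite addr_eq0 => /eqP <-.
by apply: eq_bigr => j _; congr (_ _ _); apply: ord_inj; rewrite lift_max.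
Qed.

(** Completes - v by a last coordinate to a vector with sum 0. With this sign,
when v approximates the first coordinates of x - p the field points inwards.
*)
Definition tangent n (v : 'rV[R]_n) : 'rV[R]_n.+1 :=
  \row_i oapp (fun j => - v ord0 j) (\sum_j v ord0 j) (unlift ord_max i).

Lemma tangent_sum n (v : 'rV[R]_n) : \sum_i tangent v ord0 i = 0.
Proof.
rewrite big_ord_recr /= mxE unlift_none /= -[RHS](addNr (\sum_j v ord0 j)) -sumrN.
congr (_ + _); apply: eq_bigr => i _.
have -> : widen_ord (leqnSn n) i = lift ord_max i by apply: ord_inj; rewrite lift_max.
by rewrite mxE liftK.
Qed.

Lemma tangent_lift n (v : 'rV[R]_n) j : tangent v ord0 (lift ord_max j) = - v ord0 j.
Proof. by rewrite mxE liftK. Qed.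

Lemma tangent_max n (v : 'rV[R]_n) : tangent v ord0 ord_max = \sum_j v ord0 j.
Proof. by rewrite mxE unlift_none. Qed.

Lemma tangent_lipschitz n (v w : 'rV[R]_n) : `|tangent v - tangent w| <= n.+1%:R * `|v - w|.
Proof.
have le1 : `|v - w| <= n.+1%:R * `|v - w|.
  by rewrite ler_peMl // ler1n.
apply: norm_le_coord => [|i]; first by rewrite mulr_ge0.
case: (unliftP ord_max i) => [j ->|->]; rewrite rowB_coord.
  rewrite !tangent_lift -opprD normrN; apply: le_trans le1.
  by have := coord_le_norm (v - w) j; rewrite !mxE.
rewrite !tangent_max -sumrB; apply: le_trans (ler_norm_sum _ _ _) _.
apply: (@le_trans _ _ (\sum_(j < n) `|v - w|)).
  by apply: ler_sum => j _; have := coord_le_norm (v - w) j; rewrite !mxE.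
by rewrite sumr_const card_ord -[leLHS]mulr_natl ler_wpM2r // ler_nat.
Qed.

(** Suppose that c, very close to F p, is not a value of F. Push the image of
F out of a small cube around c, then apply a Lipschitz approximation of F x
|-> x - p, shifted so that it has no zero on the boundary of the cube, by
[lipschitz_cube_boundary]. The composite vanishes nowhere: outside the cube x
is too far from p. On the boundary of the simplex it is close to x - p, so
that it yields an inward pointing field without zeros, against
[inward_field_zero]. *)
Theorem invariance_of_domain k (F : 'rV[R]_k.+2 -> 'rV[R]_k.+1) (p : 'rV[R]_k.+2) :
  cont_on (@simplex R k.+2) F -> {in @simplex R k.+2 &, injective F} ->
  simplex p -> (forall i, 0 < p ord0 i) ->
  exists2 e, 0 < e & forall z, `|z - F p| < e -> exists2 x, simplex x & F x = z.
Proof.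
move=> cF iF Sp p0.
pose S := @simplex R k.+2.
have cS : compact S by exact: simplex_compact.
have [mu mu0 mup] : exists2 mu, 0 < mu & forall i, mu <= p ord0 i.
  have [i _ Hi] := @arg_minP _ _ _ (ord0 : 'I_k.+2) xpredT (fun i => p ord0 i) isT.
  by exists (p ord0 i) => // j; apply: Hi.
have [h h0 Hh] := compact_uniformly_injective cS cF iF mu0.
pose e := h / 2; have e0 : 0 < e by rewrite divr_gt0.
exists e => // c cq; apply: contrapT => cF'.
have cK x : S x -> F x != c by move=> Sx; apply/eqP => Fx; apply: cF'; exists x.
have bd x i : S x -> x ord0 i = 0 -> e <= `|F x - c|.
  move=> Sx xi.
  have : mu <= `|x - p|.
    apply: le_trans (coord_le_norm _ i); rewrite !mxE xi sub0r normrN.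
    by rewrite ger0_norm ?mup // ltW.
  move/(Hh _ _ Sx Sp).
  have : `|F x - F p| <= `|F x - c| + `|c - F p|.
    by apply: le_trans (ler_normD _ _); rewrite addrA subrK.
  have : h = e + e by rewrite /e; lra.
  by move: cq; lra.
have [d0 d00 Hd0] := cF p Sp (e - `|c - F p|) ltac:(by rewrite subr_gt0).
have near x : S x -> `|p - x| < d0 -> `|F x - c| < e.
  move=> Sx /(Hd0 _ Sx) H.
  have : `|F x - c| <= `|F p - F x| + `|c - F p|.
    rewrite (distrC c) (distrC (F p) (F x)).
    by apply: le_trans (ler_normD _ _); rewrite addrA subrK.
  by lra.
(* The last coordinate of x - p is minus the sum of the k + 1 others, whence
   the factor k + 1. *)
pose d := Num.min d0 mu / k.+1%:R.
have k0 : 0 < k.+1%:R :> R by rewrite ltr0n.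
have d1 : 0 < d by rewrite divr_gt0 // lt_min d00.
have dk : k.+1%:R * d = Num.min d0 mu by rewrite mulrC divfK // gt_eqF.
have dd0 : k.+1%:R * d <= d0 by rewrite dk ge_min lexx.
have dmu : k.+1%:R * d <= mu by rewrite dk ge_min lexx orbT.
have dle : d <= k.+1%:R * d by rewrite ler_peMl ?ler1n // ltW.
clearbody d => {dk}.
have S0 : S !=set0 by exists p.
have d2 : 0 < d / 2 by rewrite divr_gt0.
have [L [P [L0 PL] PF]] := lipschitz_approx_inverse cS S0 cF iF d2.
pose Q y : 'rV[R]_k.+1 := \row_j (P y - p) ord0 (lift ord_max j).
have QL y z : `|Q y - Q z| <= L * `|y - z|.
  apply: le_trans (PL y z); apply: norm_le_coord => // j.
  have := coord_le_norm (P y - P z) (lift ord_max j); rewrite !mxE.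
  by rewrite opprB addrA subrK.
have d4 : 0 < d / 4 by rewrite divr_gt0.
have [v vd vQ] := lipschitz_cube_boundary c L0 QL e0 d4.
pose H x := tangent (Q (push_out c e (F x)) - v).
have cH : cont_on S H.
  have cT : cont_on setT (fun y => tangent (Q y - v)).
    apply: (@lipschitz_cont_on _ _ _ _ (k.+2%:R * L)) => y z.
    apply: le_trans (tangent_lipschitz _ _) _; rewrite -mulrA ler_pM2l //.
    by rewrite opprB addrA subrK; apply: QL.
  have cQ := cont_on_comp (@push_out_cont _ c e) (fun _ _ => I) cT.
  exact: (cont_on_comp cF cK cQ).
have [||x Sx Hx] := inward_field_zero cH.
- by move=> x _; apply: tangent_sum.
- move=> x i Sx xi; rewrite /H push_out_far //; last exact: (bd x i).
  have err j : `|(Q (F x) - v) ord0 j - (x - p) ord0 (lift ord_max j)| <= d.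
    have := coord_le_norm (P (F x) - x) (lift ord_max j); have := PF x Sx.
    have := coord_le_norm v j; rewrite !mxE.
    move: (P (F x) ord0 _) (x ord0 _) (p ord0 _) => a b f v1 h1 h2.
    have -> : a - f - v ord0 j - (b - f) = (a - b) + (- v ord0 j) by ring.
    apply: (le_trans (ler_normD _ _)); rewrite normrN; lra.
  case: (unliftP ord_max i) => [j ij|ij].
    rewrite ij tangent_lift; have := err j; rewrite rowB_coord -ij xi.
    have := mup i; rewrite ler_norml => ? /andP[? ?]; lra.
  rewrite ij tangent_max.
  have xp : \sum_j (x - p) ord0 (lift ord_max j) = p ord0 ord_max.
    by rewrite (simplexB_last Sx Sp) rowB_coord -ij xi sub0r opprK ij.
  have : \sum_j (Q (F x) - v) ord0 j >= \sum_(j < k.+1) ((x - p) ord0 (lift ord_max j) - d).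
    by apply: ler_sum => j _; have := err j; rewrite ler_norml => /andP[? ?]; lra.
  rewrite sumrB xp sumr_const card_ord -[d *+ _]mulr_natl; have := mup ord_max; lra.
have {Hx} Qv : Q (push_out c e (F x)) = v.
  apply/eqP; rewrite -subr_eq0; apply/eqP/rowP => j.
  by have := tangent_lift (Q (push_out c e (F x)) - v) j; rewrite -/(H x) Hx !mxE; lra.
have [xc|xc] := ltP `|F x - c| e.
  have := vQ _ (push_out_near e0 (cK x Sx) xc).
  by rewrite Qv eqxx.
move: Qv; rewrite push_out_far // => Qv.
have : d0 <= `|p - x|.
  by rewrite leNgt; apply/negP => /(near x Sx); rewrite ltNge xc.
apply/negP; rewrite -ltNge distrC.
have err j : `|(x - p) ord0 (lift ord_max j)| <= 3 / 4 * d.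
  have := coord_le_norm (P (F x) - x) (lift ord_max j); have := PF x Sx.
  have := coord_le_norm v j; rewrite -{1}Qv !mxE.
  move: (P (F x) ord0 _) (x ord0 _) (p ord0 _) => a b f v1 h1 h2.
  have -> : b - f = (a - f) - (a - b) by ring.
  apply: (le_trans (ler_normB _ _)); lra.
have kd : 3 / 4 * d <= k.+1%:R * (3 / 4 * d) by rewrite ler_peMl ?ler1n //; lra.
apply: (@le_lt_trans _ _ (k.+1%:R * (3 / 4 * d))); last by lra.
apply: norm_le_coord => [|i]; first by lra.
case: (unliftP ord_max i) => [j ->|->]; first by apply: le_trans kd.
have -> : (x - p) ord0 ord_max = - \sum_j (x - p) ord0 (lift ord_max j).
  by rewrite (simplexB_last Sx Sp) opprK.
rewrite normrN; apply: le_trans (ler_norm_sum _ _ _) _.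
apply: (@le_trans _ _ (\sum_(j < k.+1) (3 / 4 * d))); first exact: ler_sum.
by rewrite sumr_const card_ord -[leLHS]mulr_natl.
Qed.
End InvarianceOfDomain.

(** * Compact convex bodies *)

Section Convex.
Local Open Scope classical_set_scope.
Local Open Scope ring_scope.
Variable R : realType.

Lemma homeomorphicP (U V : normedModType R) (A : set U) (B : set V) :
  homeomorphic A B <-> exists (f : U -> V) (g : V -> U),
    [/\ cont_on A f, cont_on B g, forall x, A x -> B (f x) /\ g (f x) = x
      & forall y, B y -> A (g y) /\ f (g y) = y].
Proof.
by split=> -[f [g [cf cg fg gf]]]; exists f, g; split=> //; apply/cont_onP.
Qed.

Lemma homeomorphic_trans (U V W : normedModType R) (A : set U) (B : set V) (C : set W) :
  homeomorphic A B -> homeomorphic B C -> homeomorphic A C.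
Proof.
move=> /homeomorphicP[f [g [cf cg fg gf]]] /homeomorphicP[f' [g' [cf' cg' fg' gf']]].
apply/homeomorphicP; exists (f' \o f), (g \o g'); split.
- by apply: cont_on_comp cf _ cf' => x /fg[].
- by apply: cont_on_comp cg' _ cg => x /gf'[].
- by move=> x Ax /=; have [Bx gx] := fg x Ax; have [Cx g'x] := fg' _ Bx; rewrite g'x gx.
- by move=> y Cy /=; have [By fy] := gf' y Cy; have [Ay f'y] := gf _ By; rewrite f'y fy.
Qed.

Lemma compact_homeomorphic (U V : normedModType R) (K : set U) (F : U -> V) :
  compact K -> cont_on K F -> {in K &, injective F} -> homeomorphic K (F @` K).
Proof.
move=> cK cF iF; apply/homeomorphicP.
pose G y := xget 0 [set x | K x /\ F x = y].
have GP x : K x -> G (F x) = x.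
  move=> Kx; rewrite /G; case: xgetP => [x' _ [Kx' Fx']|/(_ x)[]] //.
  by apply: iF; rewrite ?inE.
exists F, G; split=> //.
- move=> _ [x Kx <-] e e0; have [d d0 Hd] := compact_uniformly_injective cK cF iF e0.
  exists d => // _ [y Ky <-]; rewrite !GP // => Fxy.
  by rewrite ltNge; apply/negP => /(Hd _ _ Kx Ky); rewrite leNgt Fxy.
- by move=> x Kx; rewrite GP //; split=> //; exists x.
- by move=> _ [x Kx <-]; rewrite GP.
Qed.

Lemma lipschitz_at (U V : normedModType R) (f : U -> V) L :
  (forall x y, `|f x - f y| <= L * `|x - y|) -> forall x, {for x, continuous f}.
Proof.
move=> /(lipschitz_cont_on (A := setT)) fL x; apply/cvgrPdist_lt => e e0; apply/nbhs_ballP.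
have [d d0 Hd] := fL x I e e0.
by exists d => //= y; rewrite -ball_normE /= => xy; apply: Hd.
Qed.

Definition is_convex n (C : set 'rV[R]_n) := forall x y (s : R),
  C x -> C y -> 0 <= s <= 1 -> C (s *: x + (1 - s) *: y).

(** The Minkowski functional of C. *)
Definition gauge n (C : set 'rV[R]_n) (y : 'rV[R]_n) : R :=
  inf [set l | 0 < l /\ C (l^-1 *: y)].

Section Gauge.
Variables (n : nat) (C : set 'rV[R]_n) (r B : R).
Hypotheses (r0 : 0 < r) (B0 : 0 < B).
Hypothesis convC : is_convex C.
Hypothesis closC : closed C.
Hypothesis inner : forall y, `|y| <= r -> C y.
Hypothesis outer : forall y, C y -> `|y| <= B.

Let lset y := [set l | 0 < l /\ C (l^-1 *: y)].

Lemma gauge_body0 : C 0. Proof. by apply: inner; rewrite normr0 ltW. Qed.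

Lemma gauge_lbound y : lbound (lset y) (`|y| / B).
Proof.
move=> l [l0 /outer]; rewrite normrZ ger0_norm ?invr_ge0 ?(ltW l0) //.
by rewrite mulrC ler_pdivrMr // => H; rewrite ler_pdivrMr // mulrC.
Qed.

Lemma gauge_has_lbound y : has_lbound (lset y).
Proof. by exists (`|y| / B); apply: gauge_lbound. Qed.

Lemma gauge_mem y l : 0 < l -> `|y| <= l * r -> lset y l.
Proof.
move=> l0 yl; split=> //; apply: inner.
by rewrite normrZ ger0_norm ?invr_ge0 ?(ltW l0) // mulrC ler_pdivrMr // mulrC.
Qed.

Lemma gauge_nonempty y : lset y !=set0.
Proof.
exists ((`|y| + 1) / r); apply: gauge_mem; first by rewrite divr_gt0 // ltr_wpDl.
by rewrite divfK ?gt_eqF // lerDl.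
Qed.

Lemma gauge_le_norm y : gauge C y <= `|y| / r.
Proof.
apply/ler_addgt0Pl => e e0; apply: ge_inf; first exact: gauge_has_lbound.
apply: gauge_mem; first by rewrite ltr_wpDr // divr_ge0 // ltW.
by rewrite mulrDl divfK ?gt_eqF // lerDr mulr_ge0 // ltW.
Qed.

Lemma norm_le_gauge y : `|y| / B <= gauge C y.
Proof. by apply: lb_le_inf; [exact: gauge_nonempty|exact: gauge_lbound]. Qed.

Lemma gauge_gt0 y : y != 0 -> 0 < gauge C y.
Proof. by move=> y0; apply: lt_le_trans (norm_le_gauge y); rewrite divr_gt0 // normr_gt0. Qed.

Lemma gaugeZ_le a y : 0 < a -> gauge C (a *: y) <= a * gauge C y.
Proof.
move=> a0; rewrite mulrC -ler_pdivrMr //; apply: lb_le_inf; first exact: gauge_nonempty.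
move=> l [l0 Cl]; rewrite ler_pdivrMr //; apply: ge_inf; first exact: gauge_has_lbound.
split; first exact: mulr_gt0.
by rewrite invfM scalerA -mulrA mulVf ?mulr1 // gt_eqF.
Qed.

Lemma gaugeZ a y : 0 < a -> gauge C (a *: y) = a * gauge C y.
Proof.
move=> a0; apply/eqP; rewrite eq_le gaugeZ_le //=.
rewrite mulrC -ler_pdivlMr // mulrC.
have := @gaugeZ_le a^-1 (a *: y); rewrite invr_gt0 scalerA mulVf ?gt_eqF // scale1r.
exact.
Qed.

Lemma gaugeD x y : gauge C (x + y) <= gauge C x + gauge C y.
Proof.
rewrite -lerBlDr; apply: lb_le_inf; first exact: gauge_nonempty.
move=> a [a0 Ca]; rewrite lerBlDr -lerBlDl; apply: lb_le_inf; first exact: gauge_nonempty.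
move=> b [b0 Cb]; rewrite lerBlDl; apply: ge_inf; first exact: gauge_has_lbound.
have ab0 : 0 < a + b by rewrite addr_gt0.
split=> //; have := convC (s := a / (a + b)) Ca Cb.
have -> : 1 - a / (a + b) = b / (a + b).
  by rewrite -[X in X - _](divff (x := a + b)) ?gt_eqF // -mulrBl addrC addKr.
rewrite !scalerA !(mulrAC _ (a + b)^-1) !divff ?gt_eqF // !mul1r -scalerDr.
by apply; rewrite ler_pdivrMr // mul1r lerDl divr_ge0 ltW.
Qed.

Lemma gauge_lipschitz x y : `|gauge C x - gauge C y| <= r^-1 * `|x - y|.
Proof.
have H u v : gauge C u - gauge C v <= r^-1 * `|u - v|.
  rewrite lerBlDr; apply: (@le_trans _ _ (gauge C (u - v) + gauge C v)).
    by rewrite -{1}(subrK v u) gaugeD.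
  by rewrite lerD2r mulrC gauge_le_norm.
rewrite ler_norml lerNl opprB H andbT distrC; exact: H.
Qed.

(** When the infimum is 1 it only places multiples of y arbitrarily close to y
in C, and C is closed. *)
Lemma gauge_le1 y : C y <-> gauge C y <= 1.
Proof.
split=> [Cy|gy].
  apply: ge_inf; first exact: gauge_has_lbound.
  by split=> //; rewrite invr1 scale1r.
have shrink l : 0 < l -> l <= 1 -> C (l^-1 *: y) -> C y.
  move=> l0 l1 Cl; have := convC (s := l) Cl gauge_body0.
  by rewrite scaler0 addr0 scalerA divff ?gt_eqF // scale1r; apply; rewrite l1 ltW.
have [[l [l0 Cl] l1]|H] := pselect (exists2 l, lset y l & l <= 1); first exact: (shrink l).
apply: closC => U /nbhs_ballP[e /= e0 eU].
pose d := e / (`|y| + 1).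
have d0 : 0 < d by rewrite divr_gt0 // ltr_wpDl.
have [l [l0 Cl] ld] := @inf_adherent _ (lset y) d d0 (conj (gauge_nonempty y) (gauge_has_lbound y)).
have l1 : 1 < l by rewrite ltNge; apply/negP => l1; apply: H; exists l.
exists (l^-1 *: y); split=> //; apply: eU; rewrite -ball_normE /=.
have -> : y - l^-1 *: y = (1 - l^-1) *: y by rewrite scalerBl scale1r.
have li : l^-1 <= 1 by rewrite invf_le1 // ltW.
rewrite normrZ ger0_norm ?subr_ge0 //.
have : 1 - l^-1 < d.
  apply: (@le_lt_trans _ _ (l - 1)).
    have -> : 1 - l^-1 = l^-1 * (l - 1) by rewrite mulrBr mulVf ?gt_eqF // mulr1.
    by rewrite ler_piMl // subr_ge0 ltW.
  rewrite ltrBlDr; apply: (lt_le_trans ld); rewrite addrC lerD2l //.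
move=> H1; have := normr_ge0 y; rewrite le_eqVlt => /orP[/eqP <-|y0].
  by rewrite mulr0.
apply: (@lt_trans _ _ (d * `|y|)); first by rewrite ltr_pM2r.
by rewrite /d mulrAC ltr_pdivrMr ?ltr_wpDl // ltr_pM2l // ltrDl.
Qed.
End Gauge.

(** Rescale each ray by the quotient of the two gauges. Gauges are Lipschitz,
and comparable to the norm, which gives continuity at the origin. *)
Lemma radial_homeomorphic n (C1 C2 : set 'rV[R]_n) r1 B1 r2 B2 :
  0 < r1 -> 0 < B1 -> 0 < r2 -> 0 < B2 ->
  is_convex C1 -> closed C1 -> (forall y, `|y| <= r1 -> C1 y) -> (forall y, C1 y -> `|y| <= B1) ->
  is_convex C2 -> closed C2 -> (forall y, `|y| <= r2 -> C2 y) -> (forall y, C2 y -> `|y| <= B2) ->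
  homeomorphic C1 C2.
Proof.
pose h (D1 D2 : set 'rV[R]_n) y := (gauge D1 y / gauge D2 y) *: y.
suff main (D1 D2 : set 'rV[R]_n) s1 E1 s2 E2 :
  0 < s1 -> 0 < E1 -> 0 < s2 -> 0 < E2 ->
  is_convex D1 -> closed D1 -> (forall y, `|y| <= s1 -> D1 y) -> (forall y, D1 y -> `|y| <= E1) ->
  is_convex D2 -> closed D2 -> (forall y, `|y| <= s2 -> D2 y) -> (forall y, D2 y -> `|y| <= E2) ->
  cont_on D1 (h D1 D2) /\ forall x, D1 x -> D2 (h D1 D2 x) /\ h D2 D1 (h D1 D2 x) = x.
  move=> r10 B10 r20 B20 c1 cl1 i1 o1 c2 cl2 i2 o2; apply/homeomorphicP.
  have [ch hP] := main _ _ _ _ _ _ r10 B10 r20 B20 c1 cl1 i1 o1 c2 cl2 i2 o2.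
  have [ch' hP'] := main _ _ _ _ _ _ r20 B20 r10 B10 c2 cl2 i2 o2 c1 cl1 i1 o1.
  by exists (h C1 C2), (h C2 C1).
move=> s10 E10 s20 E20 c1 cl1 i1 o1 c2 cl2 i2 o2.
have g1gt y : y != 0 -> 0 < gauge D1 y by apply: (gauge_gt0 s10 E10).
have g2gt y : y != 0 -> 0 < gauge D2 y by apply: (gauge_gt0 s20 E20).
have hcont : cont_on D1 (h D1 D2).
  move=> x D1x e e0; have [->|x0] := eqVneq x 0.
    exists (e / (E2 / s1)); first by rewrite divr_gt0 // divr_gt0.
    move=> y _; rewrite /h scaler0 !sub0r !normrN ltr_pdivlMr ?divr_gt0 // => ye.
    apply: le_lt_trans ye; have [->|y0] := eqVneq y 0.
      by rewrite scaler0 normr0 mul0r.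
    rewrite normrZ mulrC ler_pM2l ?normr_gt0 // ger0_norm; last first.
      by rewrite divr_ge0 // ltW // ?g1gt ?g2gt.
    rewrite ler_pdivrMr ?g2gt //.
    apply: (le_trans (gauge_le_norm s10 E10 i1 o1 y)).
    rewrite mulrAC ler_pM2r ?invr_gt0 //.
    have := norm_le_gauge s20 E20 i2 o2 y; rewrite ler_pdivrMr // mulrC //.
  have gc1 : {for x, continuous (gauge D1 : _ -> R^o)}.
    exact: (lipschitz_at (gauge_lipschitz s10 E10 c1 i1 o1)).
  have gc2 : {for x, continuous (gauge D2 : _ -> R^o)}.
    exact: (lipschitz_at (gauge_lipschitz s20 E20 c2 i2 o2)).
  have ch : {for x, continuous (h D1 D2)}.
    apply: continuousZ; last by move=> A.
    apply: continuousM; first exact: gc1.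
    by apply: continuousV; [rewrite gt_eqF // g2gt|exact: gc2].
  have /cvgrPdist_lt/(_ e e0)/nbhs_ballP[d /= d0 Hd] := ch.
  by exists d => // y _ xy; apply: Hd; rewrite -ball_normE.
split=> // x D1x.
have [->|x0] := eqVneq x 0; first by rewrite /h !scaler0; split=> //; exact: gauge_body0 s20 i2.
have a0 : 0 < gauge D1 x / gauge D2 x by rewrite divr_gt0 ?g1gt ?g2gt.
have gh : gauge D2 (h D1 D2 x) = gauge D1 x.
  by rewrite /h (gaugeZ s20 E20) // divfK // gt_eqF // g2gt.
split; first by rewrite (gauge_le1 s20 E20 c2 cl2 i2 o2) gh -(gauge_le1 s10 E10 c1 cl1 i1 o1).
set a := gauge D1 x / gauge D2 x in a0.
have hx : h D1 D2 x = a *: x by [].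
rewrite [LHS]/h gh hx (gaugeZ s10 E10) // scalerA.
have g0 := g1gt x x0; rewrite (_ : _ * a = 1) ?scale1r //.
by field; rewrite !gt_eqF.
Qed.
End Convex.

(** * Facets as increasing sequences *)

Section Positions.
Variables (m t d : nat).
Implicit Types (q : nat -> nat) (u : mpoly.multinom m).

(** The factor of the monomial responsible for the vertex in position k: each
of the first t factors gives two vertices, each of the others one. *)
Definition level (k : nat) : nat := if k < t.*2 then k./2 else k - t.

(** Counting everything from zero absorbs the constants in the definition of
F_t(u); its final interval consists of the positions k where q takes the value
m. *)
Definition vertex_at q k : nat := q (level k) + k.

Definition admissible q := (forall i j, i <= j -> q i <= q j) /\ (forall i, d <= i -> q i = m).

Lemma admissible_le q i : admissible q -> q i <= m.
Proof. by move=> [qm qd]; rewrite -(qd (maxn d i)) ?leq_maxl // qm // leq_maxr. Qed.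

Lemma level_mono k k' : k <= k' -> level k <= level k'.
Proof. by rewrite /level => kk'; case: (ltnP k) => ?; case: (ltnP k') => ?; lia. Qed.

Lemma vertex_at_mono q k k' : admissible q -> k < k' -> vertex_at q k < vertex_at q k'.
Proof.
move=> [qm _] kk'; rewrite /vertex_at -addnS; apply: leq_add => //.
by apply: qm; apply: level_mono; apply: ltnW.
Qed.

Lemma vertex_at_inj q : admissible q -> injective (vertex_at q).
Proof.
move=> aq i j eij; case: (ltngtP i j) => // /(vertex_at_mono aq).
  by rewrite eij ltnn.
by rewrite eij ltnn.
Qed.

Lemma vertex_at_lt q k : admissible q -> k < d + t -> vertex_at q k < m + t + d.
Proof. by move=> aq kd; have := admissible_le (level k) aq; rewrite /vertex_at; lia. Qed.

Definition shift_facet q : {set 'I_(m + t + d)} :=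
  [set v : 'I_(m + t + d) | [exists k : 'I_(d + t), vertex_at q k == v]].

Lemma shift_facetP q (v : 'I_(m + t + d)) :
  reflect (exists2 k, k < d + t & vertex_at q k = v) (v \in shift_facet q).
Proof.
rewrite inE; apply: (iffP existsP) => [[k /eqP Hk]|[k kd Hk]]; first by exists k.
by exists (Ordinal kd); apply/eqP.
Qed.

Lemma eq_shift_facet q q' : q =1 q' -> shift_facet q = shift_facet q'.
Proof.
by move=> qq'; apply/setP => v; rewrite !inE; apply: eq_existsb => k; rewrite /vertex_at qq'.
Qed.

Lemma card_shift_facet q : admissible q -> #|shift_facet q| = d + t.
Proof.
move=> aq; pose e (k : 'I_(d + t)) := Ordinal (vertex_at_lt aq (ltn_ord k)).
have e_inj : injective e.
  by move=> k k' /(congr1 val) /= /(vertex_at_inj aq)/ord_inj.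
have -> : shift_facet q = [set e k | k : 'I_(d + t)].
  apply/setP => v; apply/shift_facetP/imsetP => [[k kd kv]|[k _ ->]]; last by exists k.
  by exists (Ordinal kd) => //; apply: ord_inj.
by rewrite card_imset // card_ord.
Qed.

Definition index_shift u (l : nat) : nat := (nth m.+1 (indices u) l).-1.

Lemma size_indices u : size (indices u) = mpoly.mdeg u.
Proof.
rewrite /indices mpoly.mdegE size_flatten /shape sumnE big_map big_map big_enum /=.
by apply: eq_bigr => i _; rewrite size_nseq.
Qed.

Lemma indices_range u x : x \in indices u -> 0 < x <= m.
Proof. by case/flatten_mapP => i _ /nseqP[-> _]; rewrite ltn_ord. Qed.

Lemma indices_sorted u : sorted leq (indices u).
Proof.
rewrite sorted_pairwise; last exact: leq_trans.
rewrite /indices.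
have : pairwise (fun i j : 'I_m => i < j) (enum 'I_m).
  rewrite -(pairwise_map val ltn) val_enum_ord -sorted_pairwise; last exact: ltn_trans.
  exact: iota_ltn_sorted.
elim: (enum 'I_m) => //= i s IH /andP[/allP lei /IH pw].
rewrite pairwise_cat pw andbT; apply/andP; split.
  apply/allrelP => x y /nseqP[-> _] /flatten_mapP[j js /nseqP[-> _]].
  by apply: ltnW; apply: lei.
elim: (mpoly.fun_of_multinom u i) => //= k ->; rewrite andbT.
by apply/allP => y /nseqP[->].
Qed.

Lemma index_shift_ge u l : mpoly.mdeg u <= l -> index_shift u l = m.
Proof. by move=> ul; rewrite /index_shift nth_default // size_indices. Qed.

Lemma index_shift_lt u l : l < mpoly.mdeg u -> (index_shift u l).+1 = nth 0 (indices u) l.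
Proof.
move=> ul; rewrite /index_shift (set_nth_default 0) ?size_indices // prednK //.
by have /indices_range/andP[] : nth 0 (indices u) l \in indices u by rewrite mem_nth ?size_indices.
Qed.

Lemma index_shift_admissible u : mpoly.mdeg u <= d -> admissible (index_shift u).
Proof.
move=> ud; split=> [i j ij|i di]; last by apply: index_shift_ge; apply: leq_trans di.
have [ju|ju] := ltnP j (mpoly.mdeg u); last first.
  rewrite (index_shift_ge ju); have [iu|iu] := ltnP i (mpoly.mdeg u); last by rewrite index_shift_ge.
  rewrite -ltnS (index_shift_lt iu).
  have /indices_range/andP[_ /leqW] : nth 0 (indices u) i \in indices u by rewrite mem_nth ?size_indices.
  exact.
rewrite -ltnS (index_shift_lt ju) (index_shift_lt (leq_ltn_trans ij ju)).
by apply: (sorted_leq_nth leq_trans leqnn 0 (indices_sorted u)) => //;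
  rewrite inE size_indices //; apply: leq_ltn_trans ju.
Qed.

(** From the degree of u on, [index_shift u] has the value m, and the vertices
m + k are those of the final interval; before, the positions 2l and 2l + 1 are
those of a pair when l < t, and the position l + t is that of a single vertex
when t <= l. *)
Lemma squeezed_facetE u : mpoly.mdeg u <= d -> squeezed_facet t d u = shift_facet (index_shift u).
Proof.
move=> ud; apply/setP => v; rewrite [LHS]inE.
have idx l : 0 < l -> l <= mpoly.mdeg u -> index_at u l = (index_shift u l.-1).+1.
  by move=> l0 lu; rewrite index_shift_lt //; case: l l0 lu.
rewrite /squeezed_labels; move: (mpoly.mdeg u) ud idx (@index_shift_ge u) => s sd idx qge.
have vlt := ltn_ord v.
apply/idP/shift_facetP.
- case: leqP => st; rewrite !mem_cat.
  + case/orP => [/flatten_mapP[l]|]; rewrite mem_index_iota.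
      case/andP=> l0 ls; rewrite !inE !idx ?(ltnW ls) //; case/orP => /eqP Hv.
        exists (l.-1).*2; first lia.
        rewrite /vertex_at /level; case: ltnP => ?; last lia.
        rewrite doubleK; move: (index_shift u l.-1) Hv => a; lia.
      exists (l.-1).*2.+1; first lia.
      rewrite /vertex_at /level; case: ltnP => ?; last lia.
      have -> : (l.-1).*2.+1./2 = l.-1 by lia.
      move: (index_shift u l.-1) Hv => a; lia.
    case/andP=> v1 v2; exists (v - m); first lia.
    rewrite /vertex_at qge; first lia.
    rewrite /level; case: ltnP => ?; lia.
  case/or3P => [/flatten_mapP[l]|/mapP[l]|]; rewrite mem_index_iota.
  + case/andP=> l0 ls; rewrite !inE !idx; [|lia..]; case/orP => /eqP Hv.
      exists (l.-1).*2; first lia.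
      rewrite /vertex_at /level; case: ltnP => ?; last lia.
      rewrite doubleK; move: (index_shift u l.-1) Hv => a; lia.
    exists (l.-1).*2.+1; first lia.
    rewrite /vertex_at /level; case: ltnP => ?; last lia.
    have -> : (l.-1).*2.+1./2 = l.-1 by lia.
    move: (index_shift u l.-1) Hv => a; lia.
  + case/andP=> l0 ls; rewrite idx; [|lia..] => Hv.
    exists (l.-1 + t); first lia.
    rewrite /vertex_at /level; case: ltnP => ?; first lia.
    rewrite addnK; move: (index_shift u l.-1) Hv => a; lia.
  case/andP=> v1 v2; exists (v - m); first lia.
  rewrite /vertex_at qge; first lia.
  rewrite /level; case: ltnP => ?; lia.
case=> k kd kv; have [ks|ks] := leqP s (level k).
  move: kv; rewrite /vertex_at qge // => kv.
  have tail a : a <= m + k -> v.+1 \in index_iota (a + 1) (m + t + d).+1.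
    by move=> ak; rewrite mem_index_iota; lia.
  case: ifP => st; rewrite !mem_cat tail ?orbT //; move: ks; rewrite /level; case: ltnP => ?; lia.
move: kv ks; rewrite /vertex_at /level; case: ltnP => kt kv ks.
  have pair n : k./2 < n -> n <= s -> v.+1 \in flatten
      [seq [:: index_at u l + 2 * (l - 1); index_at u l + 2 * l - 1] | l <- index_iota 1 n.+1].
    move=> kn ns; apply/flatten_mapP; exists (k./2).+1; first by rewrite mem_index_iota; lia.
    rewrite !inE idx ?(leq_trans kn) //=; move: (index_shift u _) kv => a; lia.
  by case: leqP => st; rewrite !mem_cat pair //; lia.
case: leqP => st; first by lia.
rewrite !mem_cat; apply/or3P; apply: Or32; apply/mapP; exists (k - t).+1.
  by rewrite mem_index_iota; lia.
by rewrite idx //=; move: (index_shift u _) kv => a; lia.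
Qed.

(** A sorted list is determined by the multiplicities of its terms, which are
the exponents to choose. *)
Lemma indices_of_sorted (L : seq nat) : sorted leq L -> (forall x, x \in L -> 0 < x <= m) ->
  exists u, indices u = L.
Proof.
move=> sL rL; exists (mpoly.Multinom [tuple count_mem i.+1 L | i < m]).
set u := mpoly.Multinom _.
have uE i : mpoly.fun_of_multinom u i = count_mem i.+1 L.
  by rewrite /mpoly.fun_of_multinom tnth_mktuple.
apply: (sorted_eq leq_trans anti_leq) => //; first exact: indices_sorted.
apply/allP => x _; apply/eqP; rewrite /indices count_flatten -map_comp sumnE big_map big_enum /=.
have cE (i : 'I_m) : count_mem x (nseq (mpoly.fun_of_multinom u i) i.+1) =
    if i.+1 == x then count_mem x L else 0.
  by rewrite count_nseq /= uE; case: eqP => [->|_]; rewrite ?mul1n.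
rewrite (eq_bigr _ (fun i _ => cE i)) -big_mkcond /=.
have [/andP[x0 xm]|xr] := boolP (0 < x <= m).
  have xm' : x.-1 < m by lia.
  rewrite (big_pred1 (Ordinal xm')) // => i /=.
  by rewrite -[RHS]val_eqE /=; apply/eqP/eqP; lia.
rewrite big_pred0 => [|i].
  by apply/esym/count_memPn/negP => /rL; rewrite (negbTE xr).
by apply: contraNF xr => /eqP <-; rewrite ltn_ord.
Qed.

Lemma index_shift_surj q : admissible q -> exists2 u, mpoly.mdeg u <= d & index_shift u =1 q.
Proof.
move=> aq; have [qm qd] := aq.
have ex : exists s, q s == m by exists d; rewrite qd.
case: (ex_minnP ex) => s /eqP qs smin.
have sd : s <= d by apply: smin; rewrite qd.
have lts l : l < s -> q l < m.
  move=> ls; rewrite ltn_neqAle admissible_le // andbT.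
  by apply/negP => /smin; rewrite leqNgt ls.
have [||u uL] := @indices_of_sorted [seq (q l).+1 | l <- iota 0 s].
- apply: (@homo_sorted _ _ (fun l => (q l).+1) leq leq) => [i j ij|]; first exact: qm.
  exact: iota_sorted.
- by move=> x /mapP[l]; rewrite mem_iota add0n => /lts ql ->.
have us : mpoly.mdeg u = s by rewrite -size_indices uL size_map size_iota.
exists u; first by rewrite us.
move=> l; have [ls|sl] := ltnP l s; last first.
  rewrite index_shift_ge ?us //; apply/esym/eqP; rewrite eqn_leq admissible_le //.
  by rewrite -[X in X <= _]qs qm.
by apply: succn_inj; rewrite index_shift_lt ?us // uL (nth_map 0) ?size_iota // nth_iota.
Qed.
End Positions.

(** * Ridges and adjacency of facets *)

Section Generated.
Import mathcomp.boot.finset.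
Variables (V : finType) (S : {set {set V}}) (e : nat).
Hypothesis cardS : forall F, F \in S -> #|F| = e.

Lemma generatedP (A : {set V}) :
  reflect (exists2 F, F \in S & A \subset F) (A \in generated_complex S).
Proof. by rewrite inE; apply: exists_inP. Qed.

Lemma facets_generated : facets (generated_complex S) = S.
Proof.
apply/setP => F; rewrite inE; apply/maxsetP/idP => [[]|FS].
  move/generatedP => [G GS FG] /(_ G) Hmax.
  by rewrite -Hmax //; apply/generatedP; exists G.
split; first by apply/generatedP; exists F.
move=> G /generatedP[H HS GH] FG; apply/eqP.
by rewrite eq_sym eqEcard FG (cardS FS) -(cardS HS) subset_leq_card.
Qed.

Hypothesis S0 : S != set0.

Lemma rank_generated : rank (generated_complex S) = e.
Proof.
apply/eqP; rewrite eqn_leq; apply/andP; split.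
  apply/bigmax_leqP => A /generatedP[F FS AF].
  by rewrite -(cardS FS) subset_leq_card.
have [F FS] := set0Pn _ S0; rewrite -(cardS FS).
apply: (@leq_bigmax_cond _ (mem (generated_complex S)) (fun A : {set V} => #|A|)).
by apply/generatedP; exists F.
Qed.

Lemma pure_generated : pure (generated_complex S).
Proof. by move=> F; rewrite facets_generated rank_generated => /cardS. Qed.

Lemma cofacets_sub (A : {set V}) : #|A|.+1 = e ->
  [set F in S | A \subset F] \subset [set v |: A | v in ~: A].
Proof.
move=> cA; apply/fintype.subsetP => F; rewrite inE => /andP[FS AF].
have /cards1P[v Fv] : #|F :\: A| == 1.
  by rewrite cardsD (setIidPr AF) (cardS FS) -cA subSnn.
have : v \in F :\: A by rewrite Fv set11.
rewrite inE => /andP[vA vF]; apply/imsetP; exists v; first by rewrite inE.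
by rewrite -(setID F A) (setIidPr AF) Fv setUC.
Qed.

Lemma ridge_degree_le (A : {set V}) : ridge (generated_complex S) A ->
  ridge_degree (generated_complex S) A + e <= #|V|.+1.
Proof.
rewrite /ridge rank_generated => -[_ cA]; rewrite /ridge_degree facets_generated.
have := subset_leq_card (cofacets_sub cA).
move=> /leq_trans/(_ (leq_imset_card _ _)) H.
by rewrite -(cardsC A) -cA addnS ltnS addnC leq_add2l.
Qed.

End Generated.

Section Complex.
Import mathcomp.boot.finset.
Variables (m t d : nat).
Implicit Types (q : nat -> nat).

Definition shift_facets : {set {set 'I_(m + t + d)}} :=
  [set F | `[< exists q, admissible m d q /\ F = shift_facet m t d q >]].

Definition shift_complex := generated_complex shift_facets.

Lemma shift_facetsP F :
  reflect (exists2 q, admissible m d q & F = shift_facet m t d q) (F \in shift_facets).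
Proof.
rewrite /shift_facets finset.in_set; apply: (iffP idP) => [/asboolP[q [aq ->]]|[q aq ->]].
  by exists q.
by apply/asboolP; exists q.
Qed.

Lemma card_shift_facets F : F \in shift_facets -> #|F| = d + t.
Proof. by case/shift_facetsP => q aq ->; rewrite card_shift_facet. Qed.

Lemma base_admissible : admissible m d (fun l => if l < d then 0 else m).
Proof.
split=> [i j ij|i di]; last by rewrite ltnNge di.
case: (ltnP i) => id; case: (ltnP j) => jd //; lia.
Qed.

Lemma shift_facets_neq0 : shift_facets != set0.
Proof.
by apply/set0Pn; exists (shift_facet m t d (fun l => if l < d then 0 else m)); apply/shift_facetsP;
   exists (fun l => if l < d then 0 else m) => //; exact: base_admissible.
Qed.

Lemma facets_shift_complex : facets shift_complex = shift_facets.
Proof. exact: (facets_generated card_shift_facets). Qed.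

Lemma rank_shift_complex : rank shift_complex = d + t.
Proof. exact: (rank_generated card_shift_facets shift_facets_neq0). Qed.

Lemma pure_shift_complex : pure shift_complex.
Proof. exact: (pure_generated card_shift_facets shift_facets_neq0). Qed.

Lemma shift_complex_degree_le A : ridge shift_complex A -> ridge_degree shift_complex A <= m.+1.
Proof.
move=> /(ridge_degree_le card_shift_facets shift_facets_neq0); rewrite card_ord.
by rewrite -/shift_complex; lia.
Qed.

Section Low.
Hypotheses (td : t < d).

Definition initial_ridge : {set 'I_(m + t + d)} := [set v : 'I_(m + t + d) | v < d + t - 1].

Lemma card_initial_ridge : #|initial_ridge|.+1 = d + t.
Proof.
have le : d + t - 1 <= m + t + d by lia.
have -> : initial_ridge = [set widen_ord le k | k : 'I_(d + t - 1)].
  apply/setP => v; rewrite inE; apply/idP/imsetP => [vd|[k _ ->]]; last exact: (ltn_ord k).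
  by exists (Ordinal vd) => //; apply: ord_inj.
rewrite card_imset ?card_ord; first by lia.
by move=> k k' /(congr1 val) /= /ord_inj.
Qed.

(** The first d - 1 factors, equal to the first variable, fill the initial
segment, and the last one gives a single vertex because t < d; a vertex at the
very end corresponds to a monomial of degree d - 1. *)
Lemma initial_cofacet (w : 'I_(m + t + d)) : w \notin initial_ridge ->
  w |: initial_ridge \in shift_facets.
Proof.
move=> wN; have wd : d + t - 1 <= w by move: wN; rewrite finset.in_set -leqNgt.
have wlt := ltn_ord w; apply/shift_facetsP.
pose q l := if l < d.-1 then 0 else if l < d then w - (d + t - 1) else m.
have aq : admissible m d q.
  rewrite /q; split=> [i j ij|i di]; last by do ![case: ifP => ?]; lia.
  do ![case: ifP => ?]; lia.
exists q => //; apply/eqP.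
rewrite eq_sym eqEcard card_shift_facet // cardsU1 wN add1n card_initial_ridge leqnn andbT.
apply/fintype.subsetP => v /shift_facetP[k kd kv]; rewrite !inE -val_eqE /= -kv.
move: kv; rewrite /vertex_at /level /q; case: (ltnP k (t.*2)) => kt.
  have -> : k./2 < d.-1 by lia.
  by lia.
by case: (ltnP (k - t) d.-1) => ?; [|have -> : k - t < d by lia]; lia.
Qed.

Lemma initial_ridge_ridge : 0 < m -> ridge shift_complex initial_ridge.
Proof.
move=> m0; split; last by rewrite rank_shift_complex card_initial_ridge.
have wlt : (m + t + d).-1 < m + t + d by lia.
have wn : Ordinal wlt \notin initial_ridge by rewrite inE /=; lia.
apply/generatedP; exists (Ordinal wlt |: initial_ridge).
  exact: initial_cofacet.
exact: subsetU1.
Qed.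

Lemma initial_ridge_degree : ridge_degree shift_complex initial_ridge = m.+1.
Proof.
rewrite /ridge_degree facets_shift_complex.
have -> : [set F in shift_facets | initial_ridge \subset F] =
    [set v |: initial_ridge | v in ~: initial_ridge].
  apply/eqP; rewrite eqEsubset (cofacets_sub card_shift_facets card_initial_ridge) /=.
  apply/fintype.subsetP => _ /imsetP[v vA ->]; rewrite inE subsetU1 andbT.
  by apply: initial_cofacet; rewrite inE in vA.
rewrite card_in_imset.
  by have := cardsC initial_ridge; have := card_initial_ridge; rewrite card_ord; lia.
move=> v w; rewrite !inE -!leqNgt => vA wA /setP/(_ v).
by rewrite !inE eqxx /= ltnNge vA orbF => /esym/eqP.
Qed.

End Low.

Section High.
Hypotheses (dt : d <= t).

(** Gale's evenness condition: since d <= t the vertices below a gap come in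
pairs, and all the vertices from m + 2d on belong to the facet. *)
Lemma shift_facet_gale q (w : 'I_(m + t + d)) : admissible m d q -> w \notin shift_facet m t d q ->
  ~~ odd #|[set v in shift_facet m t d q | v < w]|.
Proof.
move=> aq wF; have wlt := ltn_ord w.
have nhit k : k < d + t -> vertex_at t q k != w.
  by move=> kd; apply: contra wF => /eqP kw; apply/shift_facetP; exists k.
have -> : #|[set v in shift_facet m t d q | v < w]| = \sum_(0 <= k < d + t) (vertex_at t q k < w).
  rewrite big_mkord -big_mkcond sum1_card /=.
  pose e (k : 'I_(d + t)) := Ordinal (vertex_at_lt aq (ltn_ord k)).
  have e_inj : injective e.
    by move=> k k' /(congr1 val) /= /(vertex_at_inj aq)/ord_inj.
  rewrite -(card_imset _ e_inj); apply: eq_card => v; rewrite inE.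
  apply/andP/imsetP => [[/shift_facetP[k kd kv] vw]|[k]].
    by exists (Ordinal kd); [rewrite unfold_in /= kv|apply: ord_inj].
  by rewrite unfold_in => kw ->; split=> //; apply/shift_facetP; exists k.
have tail : \sum_(d.*2 <= k < d + t) (vertex_at t q k < w) = 0.
  have wm : w < m + d.*2.
    rewrite ltnNge; apply/negP => mw; have := nhit (w - m) ltac:(lia).
    have [_ qd] := aq; rewrite /vertex_at qd; first lia.
    by rewrite /level; case: ltnP => ?; lia.
  rewrite big_nat big1 // => k /andP[kd kt].
  have [_ qd] := aq; rewrite /vertex_at qd; first by have -> : m + k < w = false by lia.
  by rewrite /level; case: ltnP => ?; lia.
rewrite (big_cat_nat (n := d.*2)) //=; [|lia].
rewrite tail addn0.
have : forall j, j <= d -> ~~ odd (\sum_(0 <= k < j.*2) (vertex_at t q k < w)).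
  elim=> [|j IH] jd; first by rewrite big_geq.
  rewrite doubleS !big_nat_recr //= -addnA oddD (negbTE (IH (ltnW jd))) addFb.
  have := nhit j.*2 ltac:(lia); have := nhit j.*2.+1 ltac:(lia).
  rewrite /vertex_at /level; have -> : j.*2 < t.*2 by lia.
  have -> : j.*2.+1 < t.*2 by lia.
  have -> : j.*2.+1./2 = j by lia.
  rewrite doubleK; move: (q j) => a; rewrite addnS.
  by case: (ltngtP (a + j.*2) w) => // ? ?; [have -> : (a + j.*2).+1 < w by lia | case: ltnP; lia].
exact.
Qed.

(** Given three vertices that complete A, look at the middle one: it is a gap
of the facets defined by the two others, and these have numbers of vertices
below it that differ by one. *)
Lemma ridge_degree_le2 A : ridge shift_complex A -> ridge_degree shift_complex A <= 2.
Proof.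
move=> [_]; rewrite rank_shift_complex => cA; rewrite /ridge_degree facets_shift_complex leqNgt.
apply/negP => deg.
have [v1 [v2 [v3 [v12 v23 [A1 A2 A3] [F1 F2 F3]]]]] : exists v1 v2 v3 : 'I_(m + t + d),
    [/\ v1 < v2, v2 < v3, [/\ v1 \notin A, v2 \notin A & v3 \notin A] &
     [/\ v1 |: A \in shift_facets, v2 |: A \in shift_facets & v3 |: A \in shift_facets]].
  pose T := [set v in ~: A | v |: A \in shift_facets].
  have cT : 2 < #|T|.
    apply: leq_trans deg _; apply: (@leq_trans #|[set v |: A | v in T]|); last exact: leq_imset_card.
    apply: subset_leq_card; apply/fintype.subsetP => F FA.
    have /fintype.subsetP/(_ F FA)/imsetP[v vA Fv] := cofacets_sub card_shift_facets cA.
    by rewrite Fv; apply: imset_f; rewrite inE vA -Fv; move: FA; rewrite inE => /andP[].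
  have sz : size (enum T) = #|T| by rewrite -cardE.
  have x0 : 'I_(m + t + d) by case: (pickP (mem T)) cT => [v|/eq_card0 ->].
  pose f i := nth x0 (enum T) i.
  have fT i : i < 3 -> f i \in T.
    by move=> i3; rewrite -mem_enum mem_nth // sz; apply: leq_trans i3 cT.
  have st : sorted (fun i j : 'I_(m + t + d) => i < j) (enum T).
    rewrite /enum_mem; apply: sorted_filter; first by move=> ? ? ?; apply: ltn_trans.
    rewrite -enumT; have := iota_ltn_sorted 0 (m + t + d).
    by rewrite -val_enum_ord sorted_map.
  have lt i j : i < j -> j < 3 -> f i < f j.
    move=> ij j3; have tr : transitive (fun i j : 'I_(m + t + d) => i < j) by move=> ? ? ?; apply: ltn_trans.
    apply: (sorted_ltn_nth tr x0 st) => //; rewrite inE sz; apply: leq_trans cT; lia.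
  exists (f 0), (f 1), (f 2); have := fT 0 isT; have := fT 1 isT; have := fT 2 isT.
  rewrite !inE => /andP[a1 a2] /andP[b1 b2] /andP[c1 c2].
  by split; [apply: lt|apply: lt|split|split].
have par v : v \notin A -> v != v2 -> v |: A \in shift_facets ->
    ~~ odd ((v < v2) + #|[set x in A | x < v2]|).
  move=> vA vv2 /shift_facetsP[q aq Fq].
  have : v2 \notin v |: A by rewrite !inE negb_or eq_sym vv2.
  rewrite Fq => /(shift_facet_gale aq); rewrite -Fq.
  suff -> : #|[set x in v |: A | x < v2]| = (v < v2) + #|[set x in A | x < v2]| by [].
  have [vlt|vge] := boolP (v < v2).
    have -> : [set x in v |: A | x < v2] = v |: [set x in A | x < v2].
      apply/setP => x; rewrite !inE; case: eqP => [->|] //=.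
    by rewrite cardsU1 inE (negbTE vA).
  rewrite add0n; apply: eq_card => x; rewrite !inE.
  by case: eqP => [->|] //=; rewrite (negbTE vge) andbF.
have := par v1 A1 _ F1; have := par v3 A3 _ F3.
rewrite v12 ltnNge ltnW //= -!val_eqE /= !neq_ltn v12 v23 orbT.
by move=> /(_ isT) H3 /(_ isT); rewrite H3.
Qed.

Definition adjacent (A B : {set 'I_(m + t + d)}) : bool :=
  [&& A \in shift_facets, B \in shift_facets & #|A :&: B|.+1 == d + t].

Lemma adjacent_sym : symmetric adjacent.
Proof. by move=> A B; rewrite /adjacent setIC andbCA. Qed.

(** Lower by one the first positive term of q: a pair {j, j + 1} is replaced
by {j - 1, j}, where j - 1 was free because the preceding terms are 0. *)
Lemma adjacent_step q : admissible m d q -> 0 < \sum_(l < d) q l ->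
  exists q', [/\ admissible m d q', adjacent (shift_facet m t d q) (shift_facet m t d q')
     & \sum_(l < d) q' l < \sum_(l < d) q l].
Proof.
move=> aq sq; have [qm qd] := aq.
have ex : exists l, (l < d) && (0 < q l).
  apply/not_existsP => H; move: sq; rewrite big1 // => l _.
  by apply/eqP; rewrite -leqn0 leqNgt; apply/negP => ql; apply: (H l); rewrite ltn_ord.
case: (ex_minnP ex) => l0 /andP[l0d ql0] l0min.
have below l : l < l0 -> q l = 0.
  move=> ll0; apply/eqP; rewrite -leqn0 leqNgt; apply/negP => ql.
  by have := l0min l; rewrite ql (ltn_trans ll0 l0d) leqNgt ll0 => /(_ isT).
pose q' l := if l == l0 then (q l0).-1 else q l.
have aq' : admissible m d q'.
  split=> [i j ij|i di]; rewrite /q'; last by case: eqP => [il|_]; [lia|exact: qd].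
  case: eqP => [il|il]; case: eqP => [jl|jl] //; last exact: qm.
    by apply: leq_trans (leq_pred _) _; apply: qm; rewrite -il.
  by rewrite below //; lia.
exists q'; split=> //; last first.
  rewrite (bigD1 (Ordinal l0d)) //= [X in _ < X](bigD1 (Ordinal l0d)) //=.
  have -> : \sum_(l < d | l != Ordinal l0d) q' l = \sum_(l < d | l != Ordinal l0d) q l.
    by apply: eq_bigr => l; rewrite -val_eqE /= /q' => /negbTE ->.
  by rewrite ltn_add2r /q' eqxx prednK.
rewrite /adjacent; apply/and3P; split; [by apply/shift_facetsP; exists q|by apply/shift_facetsP; exists q'|].
set F := shift_facet m t d q; set F' := shift_facet m t d q'.
have cF : #|F| = d + t by apply: card_shift_facet.
have xlt : q l0 + l0.*2.+1 < m + t + d by have := admissible_le l0 aq; lia.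
pose x := Ordinal xlt.
have xF : x \in F.
  apply/shift_facetP; exists l0.*2.+1; first lia.
  rewrite /vertex_at /level; case: ltnP => ?; last lia.
  by have -> : l0.*2.+1./2 = l0 by lia.
have xF' : x \notin F'.
  apply/negP => /shift_facetP[k kd] /=; rewrite /vertex_at /level.
  rewrite /q'; case: (ltnP k) => kt; case: eqP => kl; try lia.
    have [kl0|kl0] := ltnP (k./2) l0; first by rewrite below //; lia.
    have := qm l0 (k./2) kl0; lia.
have sub : F :\ x \subset F :&: F'.
  apply/fintype.subsetP => v; rewrite !inE => /andP[vx vF]; rewrite vF /=.
  have /shift_facetP[k kd kv] : v \in F by rewrite inE.
  have vx' : v != q l0 + l0.*2.+1 :> nat by [].
  have -> : [exists k0 : 'I_(d + t), vertex_at t q' k0 == v] = (v \in F') by rewrite inE.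
  have [k2|k2] := eqVneq k l0.*2.
    apply/shift_facetP; exists l0.*2.+1; first lia.
    move: kv; rewrite k2 /vertex_at /level.
    case: ltnP => ?; last lia. case: ltnP => ?; last lia.
    have -> : l0.*2.+1./2 = l0 by lia.
    by rewrite doubleK /q' eqxx; lia.
  have [k3|k3] := eqVneq k l0.*2.+1.
    move: kv vx'; rewrite k3 /vertex_at /level; case: ltnP => ?; last lia.
    have -> : l0.*2.+1./2 = l0 by lia.
    by move=> -> /eqP.
  apply/shift_facetP; exists k => //; rewrite -kv /vertex_at /level /q'.
  case: ltnP => ?; case: eqP => //; lia.
have c1 := subset_leq_card sub; have c2 := cardsD1 x F.
have : F :&: F' \proper F.
  by apply/properP; split; [exact: subsetIl|exists x => //; rewrite inE xF (negbTE xF')].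
move/proper_card; rewrite cF => lt; rewrite eqn_leq lt /=.
by move: c2; rewrite xF cF add1n => ->; rewrite ltnS.
Qed.

Lemma connect_base q : admissible m d q ->
  connect adjacent (shift_facet m t d q) (shift_facet m t d (fun l => if l < d then 0 else m)).
Proof.
have [s] := ubnP (\sum_(l < d) q l); elim: s q => // s IH q sq aq.
have [/eqP|pos] := posnP (\sum_(l < d) q l); last first.
  have [q' [aq' adj lt]] := adjacent_step aq pos.
  apply: connect_trans (connect1 adj) (IH q' _ aq'); lia.
rewrite sum_nat_eq0 => /forallP H; have [_ qd] := aq.
rewrite (@eq_shift_facet m t d q (fun l => if l < d then 0 else m)) ?connect0 // => l.
by case: ltnP => [ld|/qd //]; have := H (Ordinal ld) => /= /eqP.
Qed.

Lemma shift_complex_strongly_connected : strongly_connected shift_complex.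
Proof.
move=> F G; rewrite facets_shift_complex rank_shift_complex => FS GS.
have [[q aq Fq] [q' aq' Gq']] := (shift_facetsP F FS, shift_facetsP G GS).
have : connect adjacent F G.
  rewrite Fq Gq'; apply: connect_trans (connect_base aq) _.
  by rewrite (sym_connect_sym adjacent_sym); apply: connect_base.
case/connectP => s ps Gs; exists s; split=> //.
  elim: s F ps {Gs FS Fq} => //= A s IH F /andP[/and3P[_ AS _] ps] B; rewrite inE => /orP[/eqP-> //|].
  exact: (IH A ps).
by apply: sub_path ps => A B /and3P[].
Qed.

Lemma shift_complex_pseudomanifold : pseudomanifold shift_complex.
Proof.
split; first exact: pure_shift_complex.
  exact: shift_complex_strongly_connected.
exact: ridge_degree_le2.
Qed.

End High.
End Complex.

Section Ideal.
Import mathcomp.boot.finset.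
Variables (K : fieldType) (m : nat) (U : classical_sets.set (mpoly.mpoly m K)).
Hypotheses (m0 : 0 < m) (hU : maximal_order_ideal U).

Lemma monomial_inj : injective (@monomial K m).
Proof.
move=> u v /(congr1 (mpoly.mcoeff v)); rewrite !mpoly.mcoeffX eqxx.
by case: eqP => //= _ /eqP; rewrite eq_sym oner_eq0.
Qed.

Lemma dmax_spec u : U (monomial K u) <-> mpoly.mdeg u <= dmax U.
Proof.
have [d d1 UE] := hU.
have Umon v : U (monomial K v) <-> mpoly.mdeg v <= d.
  rewrite UE /=; split=> [[w [/monomial_inj -> //]]|vd]; by exists v.
suff -> : dmax U = d by [].
have udeg : exists u : mpoly.multinom m, mpoly.mdeg u = d.
  exists (mpoly.Multinom [tuple if i == Ordinal m0 then d else 0 | i < m]).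
  rewrite mpoly.mdegE (bigD1 (Ordinal m0)) //= big1.
    by rewrite /mpoly.fun_of_multinom tnth_mktuple eqxx addn0.
  by move=> i /negbTE i0; rewrite /mpoly.fun_of_multinom tnth_mktuple i0.
have [u0 u0d] := udeg.
rewrite /dmax; case: xgetP => [e _ [[v [/Umon vd <-]] H]|/(_ d)[]].
  by apply/eqP; rewrite eqn_leq vd -u0d; apply: H; apply/Umon; rewrite u0d.
by split; [exists u0; split=> //; apply/Umon; rewrite u0d|move=> v /Umon].
Qed.

Lemma squeezed_complexE t : squeezed_complex U t = shift_complex m t (dmax U).
Proof.
congr generated_complex; apply/setP => F; rewrite !inE; apply/asboolP/asboolP.
  case=> u [/dmax_spec ud ->]; exists (index_shift u); split; first exact: index_shift_admissible.
  exact: squeezed_facetE.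
case=> q [aq ->]; have [u ud uq] := index_shift_surj aq.
exists u; split; first exact/dmax_spec.
by rewrite squeezed_facetE //; apply: eq_shift_facet => l; rewrite uq.
Qed.
End Ideal.

(** * Three simplices on a common ridge *)

Section Sheets.
Local Open Scope classical_set_scope.
Local Open Scope ring_scope.
Variables (R : realType) (V k : nat) (X : {set {set 'I_V}}).
Hypothesis X_down : forall S T : {set 'I_V}, T \in X -> S \subset T -> S \in X.
Variables (alpha : 'I_k.+1 -> 'I_V) (a b c : 'I_V).
Hypothesis alpha_inj : injective alpha.
Let A : {set 'I_V} := [set alpha i | i in 'I_k.+1]%SET.
Hypotheses (aA : a \notin A) (bA : b \notin A) (cA : c \notin A).
Hypotheses (ab : a != b) (ac : a != c) (bc : b != c).
Hypotheses (aX : (a |: A)%SET \in X) (bX : (b |: A)%SET \in X) (cX : (c |: A)%SET \in X).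

Let idx (v : 'I_V) : 'I_k.+1 := odflt ord0 [pick i | alpha i == v].

Lemma idxK i : idx (alpha i) = i.
Proof.
rewrite /idx; case: pickP => [j /eqP/alpha_inj //|/(_ i)].
by rewrite eqxx.
Qed.

Let n : R := k.+1%:R.
Let eta : R := (4 * n)^-1.
Let p : 'rV[R]_k.+2 := barycenter R k.+1.

Let n_gt0 : 0 < n. Proof. by rewrite ltr0n. Qed.
Let n_ge1 : 1 <= n. Proof. by rewrite ler1n. Qed.
Let eta_gt0 : 0 < eta. Proof. by rewrite invr_gt0 mulr_gt0. Qed.
Let etan : eta * n = 1 / 4.
Proof. by rewrite /eta invfM -mulrA mulVf ?gt_eqF // mulr1 mul1r. Qed.

Let wm (x : 'rV[R]_k.+2) : R := (x - p) ord0 ord_max.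
Let wj (x : 'rV[R]_k.+2) (i : 'I_k.+1) : R := (x - p) ord0 (lift ord_max i).

(** Folds the simplex along the hyperplane parallel to its last face through
the barycenter: the two sides go to the sheets a |: A and b |: A. The
displacement is scaled by eta to keep the coordinates at A positive, and the
term (wm - |wm|) / n, spread over A, restores the total mass 1. *)
Definition sheets (x : 'rV[R]_k.+2) : 'rV[R]_V := \row_v
  if v == a then eta * ((wm x + `|wm x|) / 2) else
  if v == b then eta * ((`|wm x| - wm x) / 2) else
  if v \in A then n^-1 + eta * (wj x (idx v) + (wm x - `|wm x|) / n) else 0.

Lemma alphaA i : alpha i \in A. Proof. exact: imset_f. Qed.

Lemma sum_over_A (h : 'I_V -> R) (v w : 'I_V) : v \notin A -> w \notin A -> v != w ->
  (forall u, u \notin A -> u != v -> u != w -> h u = 0) ->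
  \sum_u h u = h v + h w + \sum_i h (alpha i).
Proof.
move=> vA wA vw h0; rewrite (bigD1 v) //= (bigD1 w) /=; last by rewrite eq_sym.
rewrite addrA; congr (_ + _).
rewrite (bigID (fun u => u \in A)) /= addrC big1 ?add0r; last first.
  by move=> u /andP[/andP[uv uw] uA]; apply: h0.
rewrite -(big_imset (fun u => h u) (in2W alpha_inj)) /=.
apply: eq_bigl => u; case: (boolP (u \in A)) => uA; rewrite ?andbF // andbT.
by apply/andP; split; [apply: contraNneq vA => <-|apply: contraNneq wA => <-].
Qed.

Lemma sheets_a x : sheets x ord0 a = eta * ((wm x + `|wm x|) / 2).
Proof. by rewrite mxE eqxx. Qed.

Lemma sheets_b x : sheets x ord0 b = eta * ((`|wm x| - wm x) / 2).
Proof. by rewrite mxE eq_sym (negbTE ab) eqxx. Qed.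

Lemma sheets_alpha x i : sheets x ord0 (alpha i) = n^-1 + eta * (wj x i + (wm x - `|wm x|) / n).
Proof.
rewrite mxE alphaA idxK; case: eqP => [ai|_]; first by have := aA; rewrite -ai alphaA.
by case: eqP => // bi; have := bA; rewrite -bi alphaA.
Qed.

Lemma sheets_out x v : v != a -> v != b -> v \notin A -> sheets x ord0 v = 0.
Proof. by move=> va vb vA; rewrite mxE (negbTE va) (negbTE vb) (negbTE vA). Qed.

Lemma sum_wj x : simplex x -> \sum_i wj x i = - wm x.
Proof. by move=> Sx; exact: simplexB_last Sx (barycenter_simplex R k.+1). Qed.

Lemma w_le1 x i : simplex x -> `|(x - p) ord0 i| <= 1.
Proof.
move=> Sx; have p1 := simplex_le1 i (barycenter_simplex R k.+1); have x1 := simplex_le1 i Sx.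
case: Sx => /(_ i) x0 _; case: (barycenter_simplex R k.+1) => /(_ i) p0 _.
by rewrite rowB_coord ler_norml; apply/andP; split; lra.
Qed.

Lemma sheets_realization x : simplex x -> realization X (sheets x).
Proof.
move=> Sx; have wm1 : `|wm x| <= 1 by exact: w_le1.
have pos i : 0 <= sheets x ord0 (alpha i).
  rewrite sheets_alpha; have : `|wj x i| <= 1 by exact: w_le1.
  move=> wi; have ni : n^-1 = 4 * eta.
    apply: (@mulIf _ n); first by rewrite gt_eqF.
    by rewrite mulVf ?gt_eqF // -mulrA etan; lra.
  have : -2 <= (wm x - `|wm x|) / n.
    rewrite ler_pdivlMr //; have := ler_norm (- wm x); rewrite normrN => wn; have nn := n_ge1.
    by lra.
  move: wi; rewrite ler_norml ni => /andP[w1 _] w2.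
  have := eta_gt0; nra.
split.
- move=> v; have [->|va] := eqVneq v a.
    by rewrite sheets_a mulr_ge0 ?(ltW eta_gt0) //; have := ler_norm (- wm x); rewrite normrN; lra.
  have [->|vb] := eqVneq v b.
    by rewrite sheets_b mulr_ge0 ?(ltW eta_gt0) //; have := ler_norm (wm x); lra.
  have [/imsetP[i _ ->]|vA] := boolP (v \in A); first exact: pos.
  by rewrite sheets_out.
- rewrite (sum_over_A aA bA ab); last by move=> u uA ua ub; apply: sheets_out.
  rewrite sheets_a sheets_b (eq_bigr _ (fun i _ => sheets_alpha x i)).
  rewrite big_split /= -mulr_sumr big_split /= sum_wj // !sumr_const card_ord.
  rewrite -[n^-1 *+ _]mulr_natl -[(_ / n) *+ _]mulr_natl -/n (mulrC n (_ / n)) divfK ?gt_eqF //.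
  by rewrite divff ?gt_eqF //; field.
have sub u : (forall v, v != u -> v \notin A -> sheets x ord0 v = 0) -> (u |: A)%SET \in X ->
    [set i | sheets x ord0 i != 0]%SET \in X.
  move=> h0 /X_down; apply; apply/fintype.subsetP => v; rewrite !inE => sv.
  by apply: contraNT sv; rewrite negb_or => /andP[vu vA]; apply/eqP; apply: h0.
have [w0|w0] := leP 0 (wm x).
  apply: (sub a) => // v va vA; have [->|vb] := eqVneq v b; last by apply: sheets_out.
  by rewrite sheets_b ger0_norm // subrr mul0r mulr0.
apply: (sub b) => // v vb vA; have [->|va] := eqVneq v a; last by apply: sheets_out.
by rewrite sheets_a ler0_norm ?ltW // subrr mul0r mulr0.
Qed.

Lemma sheets_inj : injective sheets.
Proof.
move=> x y exy.
have wxy : wm x = wm y.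
  have := congr1 (fun z : 'rV_V => z ord0 a - z ord0 b) exy.
  rewrite !sheets_a !sheets_b; have := eta_gt0; nra.
have wjxy i : wj x i = wj y i.
  have := congr1 (fun z : 'rV_V => z ord0 (alpha i)) exy.
  rewrite /= !sheets_alpha wxy => /addrI H.
  have en : eta != 0 by rewrite gt_eqF.
  by move/(mulfI en)/addIr: H.
apply: (addIr (- p)); apply/rowP => i.
by case: (unliftP ord_max i) => [j ->|->]; [apply: wjxy|apply: wxy].
Qed.

Lemma sheets_cont D : cont_on D sheets.
Proof.
apply: (@lipschitz_cont_on _ _ _ _ _ (eta * 3)) => x y.
have w1 i : `|(x - p) ord0 i - (y - p) ord0 i| <= `|x - y|.
  have := coord_le_norm (x - y) i; rewrite !rowB_coord.
  by rewrite opprB addrA subrK.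
have wmxy : `|wm x - wm y| <= `|x - y| by exact: w1.
have nn : `| `|wm x| - `|wm y| | <= `|x - y| by apply: le_trans wmxy; exact: ler_dist_dist.
have e0 := eta_gt0.
have d0 : 0 <= `|x - y| by [].
apply: norm_le_coord => [|v]; first by rewrite !mulr_ge0 // ltW.
rewrite rowB_coord.
have [->|va] := eqVneq v a.
  rewrite !sheets_a -mulrBr normrM gtr0_norm // -mulrA ler_pM2l //.
  by move: wmxy nn; rewrite !ler_norml => /andP[? ?] /andP[? ?]; apply/andP; split; lra.
have [->|vb] := eqVneq v b.
  rewrite !sheets_b -mulrBr normrM gtr0_norm // -mulrA ler_pM2l //.
  by move: wmxy nn; rewrite !ler_norml => /andP[? ?] /andP[? ?]; apply/andP; split; lra.
have [/imsetP[i _ ->]|vA] := boolP (v \in A); last first.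
  by rewrite !sheets_out // subrr normr0 !mulr_ge0 // ltW.
have wjxy : `|wj x i - wj y i| <= `|x - y| by exact: w1.
rewrite !sheets_alpha opprD addrACA subrr add0r -mulrBr normrM gtr0_norm // -mulrA ler_pM2l //.
rewrite opprD addrACA -mulrBl.
set r := wm x - _ - _.
have rn : `|r / n| <= 2 * `|x - y|.
  rewrite normrM [`|n^-1|]gtr0_norm ?invr_gt0 // ler_pdivrMr //.
  have : `|r| <= 2 * `|x - y|.
    by move: wmxy nn; rewrite !ler_norml => /andP[? ?] /andP[? ?]; apply/andP; rewrite /r; split; lra.
  have := n_ge1; nra.
by apply: (le_trans (ler_normD _ _)); lra.
Qed.

(** The union of the first two sheets is a disc, and f maps it onto a
neighbourhood of the image of its centre; but points of the third sheet tend
to that centre. *)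
Theorem three_sheets_not_embeddable (f : 'rV[R]_V -> 'rV[R]_k.+1) :
  cont_on (@realization R V X) f -> ~ {in @realization R V X &, injective f}.
Proof.
move=> cf inf.
have cF : cont_on (@simplex R k.+2) (f \o sheets).
  exact: (cont_on_comp (@sheets_cont _) sheets_realization cf).
have iF : {in @simplex R k.+2 &, injective (f \o sheets)}.
  move=> x y; rewrite !inE => Sx Sy /inf H.
  by apply: sheets_inj; apply: H; rewrite inE; exact: sheets_realization.
have Sp := barycenter_simplex R k.+1.
have [e e0 He] := invariance_of_domain cF iF Sp (@barycenter_gt0 R k.+1).
have wmp : wm p = 0 by rewrite /wm subrr mxE.
have wjp i : wj p i = 0 by rewrite /wj subrr mxE.
have [d d0 Hd] := cf _ (sheets_realization Sp) e e0.
pose tau := Num.min (d / 2) 1.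
have tau0 : 0 < tau by rewrite lt_min divr_gt0 //=.
have tau1 : tau <= 1 by rewrite ge_min lexx orbT.
have taud : tau < d by rewrite gt_min; apply/orP; left; rewrite ltr_pdivrMr // mulr_natr mulr2n ltrDl.
pose g : 'rV[R]_V := \row_v (if v == c then tau else if v \in A then (1 - tau) / n else 0).
have gc : g ord0 c = tau by rewrite mxE eqxx.
have galpha i : g ord0 (alpha i) = (1 - tau) / n.
  by rewrite mxE alphaA; case: eqP => // ci; have := cA; rewrite -ci alphaA.
have gout v : v != c -> v \notin A -> g ord0 v = 0.
  by move=> vc vA; rewrite mxE (negbTE vc) (negbTE vA).
have Rg : realization X g.
  split.
  - move=> v; have [->|vc] := eqVneq v c; first by rewrite gc ltW.
    have [/imsetP[i _ ->]|vA] := boolP (v \in A); last by rewrite gout.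
    by rewrite galpha divr_ge0 ?subr_ge0 // ltW.
  - have ca : c != a by rewrite eq_sym.
    rewrite (sum_over_A cA aA ca); last by move=> u uA uc _; apply: gout.
    rewrite gc gout ?aA // (eq_bigr _ (fun i _ => galpha i)) sumr_const card_ord.
    by rewrite -[_ *+ _]mulr_natl -/n mulrC divfK ?gt_eqF // addr0 addrC subrK.
  apply: X_down cX _; apply/fintype.subsetP => v; rewrite !inE => gv.
  by apply: contraNT gv; rewrite negb_or => /andP[vc vA]; apply/eqP; apply: gout.
have close : `|sheets p - g| < d.
  apply: le_lt_trans taud; apply: norm_le_coord => [|v]; first exact: ltW.
  rewrite rowB_coord; have [->|vc] := eqVneq v c.
    by rewrite gc sheets_out ?sub0r ?normrN ?gtr0_norm // eq_sym.
  have [/imsetP[i _ ->]|vA] := boolP (v \in A).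
    rewrite galpha sheets_alpha wmp wjp normr0 subrr mul0r addr0 mulr0 addr0.
    have -> : n^-1 - (1 - tau) / n = tau / n by rewrite mulrBl mul1r opprB addrCA subrr addr0.
    by rewrite ger0_norm ?divr_ge0 ?(ltW tau0) ?(ltW n_gt0) // ler_pdivrMr // ler_peMr // ltW.
  rewrite gout // subr0; have [->|va] := eqVneq v a.
    by rewrite sheets_a wmp normr0 addr0 mul0r mulr0 normr0 ltW.
  have [->|vb] := eqVneq v b; last by rewrite sheets_out // normr0 ltW.
  by rewrite sheets_b wmp normr0 subrr mul0r mulr0 normr0 ltW.
have := Hd _ Rg close; rewrite distrC => /He[x Sx /inf].
rewrite !inE => /(_ (sheets_realization Sx) Rg) /(congr1 (fun z : 'rV_V => z ord0 c)).
rewrite gc sheets_out // ?[c == _]eq_sym // => t0.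
by rewrite -t0 ltxx in tau0.
Qed.
End Sheets.

(** * Moments and cyclic polytopes *)

Section DividedDifference.
Local Open Scope ring_scope.
Variable R : realFieldType.

(** Both sides are the coefficient of degree n of the interpolation polynomial
of p at the points a k. *)
Lemma divided_difference n (a : 'I_n.+1 -> R) (p : {poly R}) : injective a ->
  (size p <= n.+1)%N ->
  \sum_k p.[a k] / \prod_(j | j != k) (a k - a j) = p`_n.
Proof.
move=> a_inj sp; pose l k : {poly R} := \prod_(j | j != k) ('X - (a j)%:P).
pose c k := (\prod_(j | j != k) (a k - a j))^-1.
have lsize k : size (l k) = n.+1.
  have : size (\prod_j ('X - (a j)%:P)) = n.+2.
    by rewrite size_prod_XsubC /index_enum -enumT size_enum_ord.
  rewrite (bigD1 k) //= size_monicM ?monicXsubC ?size_XsubC //.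
    by case.
  by apply: monic_neq0; apply: monic_prod => j _; apply: monicXsubC.
have lmonic k : l k \is monic by apply: monic_prod => j _; apply: monicXsubC.
have lcoef k : (l k)`_n = 1 by have := monicP (lmonic k); rewrite /lead_coef lsize.
have lval k i : (l k).[a i] = if i == k then (c k)^-1 else 0.
  rewrite horner_prod; case: eqP => [->|/eqP ik].
    by rewrite /c invrK; apply: eq_bigr => j _; rewrite hornerXsubC.
  by rewrite (bigD1 i) //= hornerXsubC subrr mul0r.
have c0 k : c k != 0.
  by rewrite invr_eq0; apply/prodf_neq0 => j jk; rewrite subr_eq0 (inj_eq a_inj) eq_sym.
pose L := \sum_k (p.[a k] * c k) *: l k.
have pL : p = L.
  apply/eqP; rewrite -subr_eq0; apply/eqP.
  apply: (@roots_geq_poly_eq0 _ _ (codom a)).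
  - apply/allP => _ /codomP[i ->]; rewrite /root hornerD hornerN horner_sum.
    rewrite (bigD1 i) //= big1 => [|k ki]; last by rewrite hornerZ lval eq_sym (negbTE ki) mulr0.
    by rewrite hornerZ lval eqxx addr0 mulfK // subrr.
  - by apply/injectiveP.
  rewrite size_codom card_ord; apply: (leq_trans (size_polyD _ _)).
  rewrite size_polyN geq_max sp /=; apply: (leq_trans (size_sum _ _ _)).
  apply/bigmax_leqP => k _; rewrite -(lsize k); exact: size_scale_leq.
rewrite [in RHS]pL coef_sum; apply: eq_bigr => k _.
by rewrite coefZ lcoef mulr1.
Qed.

(** The n - k factors of index greater than k are the negative ones. *)
Lemma denominator_sign n (a : nat -> R) (k : nat) : (k <= n)%N ->
  (forall i j, (i < j)%N -> (j <= n)%N -> a i < a j) ->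
  0 < (-1) ^+ (n - k) * \prod_(j < n.+1 | (j : nat) != k) (a k - a j).
Proof.
move=> kn mono; rewrite -(big_mkord (fun j => j != k) (fun j => a k - a j)).
rewrite (big_cat_nat (n := k)) //=; last by lia.
rewrite [X in _ * (_ * X)]big_ltn_cond ?eqxx; last by lia.
rewrite mulrCA; apply: mulr_gt0.
  rewrite big_nat_cond; apply: prodr_gt0 => j /andP[/andP[_ jk] _].
  by rewrite subr_gt0 mono //; lia.
have -> : (-1) ^+ (n - k) = \prod_(k.+1 <= j < n.+1 | j != k) (-1) :> R.
  rewrite big_nat_cond (eq_bigl (fun j => (k.+1 <= j < n.+1)%N)); last by move=> j; lia.
  by rewrite -big_nat prodr_const_nat subSS.
rewrite -big_split /= big_nat_cond; apply: prodr_gt0 => j /andP[/andP[jk jd] _].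
by rewrite mulN1r opprB subr_gt0 mono.
Qed.
End DividedDifference.

Section Cover.

(** Greedy choice from the left: the first element of S found is paired with
its successor, and the search goes on after them. If the interval becomes too
short to leave a gap, the pairs fill it. *)
Lemma chain_or_cover (S : pred nat) N a d : d.*2 <= N ->
  (exists s : nat -> nat, (forall i, i <= d -> a <= s i < a + N /\ S (s i)) /\
      (forall i, i < d -> s i + 2 <= s i.+1)) \/
  (exists j : nat -> nat, [/\ forall i, i < d -> a <= j i /\ j i + 2 <= a + N,
      forall i, i.+1 < d -> j i + 2 <= j i.+1 &
      forall v, a <= v < a + N -> S v -> exists2 i, i < d & v = j i \/ v = j i + 1]).
Proof.
have [e] := ubnP N; elim: e N a d => // e IH N a d Ne dN.
have [Nd|Nd] := eqVneq N d.*2.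
  right; exists (fun i => a + i.*2); split=> [i id|i id|v av _]; try lia.
  exists ((v - a)./2); lia.
have N1 : N.-1 < e by lia.
case Sa: (S a); last first.
  have [||[s [s1 s2]]|[j [j1 j2 j3]]] := IH N.-1 a.+1 d; try lia.
    left; exists s; split=> // i id; have [? ?] := s1 i id; split=> //; lia.
  right; exists j; split=> [i id|//|v av Sv]; first by have := j1 i id; lia.
  apply: j3 => //; have : v != a by apply: contraTneq Sv => ->; rewrite Sa.
  by lia.
case: d dN Nd => [|d] dN Nd.
  by left; exists (fun=> a); split=> // i _; split=> //; lia.
have [||[s [s1 s2]]|[j [j1 j2 j3]]] := IH (N - 2) a.+2 d; try lia.
  left; exists (fun i => if i is i'.+1 then s i' else a); split=> [[|i] id|[|i] id].
  - by split=> //; lia.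
  - by have [? ?] := s1 i id; split=> //; lia.
  - by have [? _] := s1 0 isT; lia.
  - exact: s2.
right; exists (fun i => if i is i'.+1 then j i' else a); split=> [[|i] id|[|i] id|v av Sv].
- lia.
- by have := j1 i id; lia.
- by have := j1 0 id; lia.
- exact: j2.
have [->|va] := eqVneq v a; first by exists 0; [|left].
have [->|va1] := eqVneq v a.+1; first by exists 0; [|right; lia].
have [|i id vi] := j3 v _ Sv; first lia.
by exists i.+1.
Qed.
End Cover.

Section Linear.
Local Open Scope classical_set_scope.
Local Open Scope ring_scope.
Variable R : realType.

Lemma lincomb_lipschitz n (c : 'I_n -> R) (x y : 'rV[R]_n) :
  `|\sum_v x ord0 v * c v - \sum_v y ord0 v * c v| <= (\sum_v `|c v|) * `|x - y|.
Proof.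
rewrite -sumrB; apply: le_trans (ler_norm_sum _ _ _) _; rewrite mulr_suml.
apply: ler_sum => v _; rewrite -mulrBl normrM mulrC ler_wpM2l //.
by have := coord_le_norm (x - y) v; rewrite rowB_coord.
Qed.

Lemma lincomb_cont_on n (c : 'I_n -> R) A :
  cont_on A (fun x : 'rV[R]_n => \sum_v x ord0 v * c v : R^o).
Proof. exact: (lipschitz_cont_on (lincomb_lipschitz c)). Qed.

Lemma mulmx_cont_on p q (M : 'M[R]_(p, q)) A : cont_on A (fun x : 'rV[R]_p => x *m M).
Proof.
apply: (@lipschitz_cont_on _ _ _ _ _ (\sum_j \sum_v `|M v j|)) => x y.
apply: norm_le_coord => [|j].
  by rewrite mulr_ge0 // sumr_ge0 // => j _; rewrite sumr_ge0.
rewrite rowB_coord !mxE; apply: le_trans (lincomb_lipschitz (fun v => M v j) x y) _.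
rewrite ler_wpM2r // (bigD1 j) //= lerDl sumr_ge0 // => i _; exact: sumr_ge0.
Qed.

(** A limit of points of the realization has its support contained in the
supports of nearby points, and X is closed under taking subsets. *)
Lemma realization_compact n (X : {set {set 'I_n}}) :
  (forall S T : {set 'I_n}, T \in X -> S \subset T -> S \in X) ->
  compact (realization X : set 'rV[R]_n).
Proof.
move=> X_down; apply: (@compact_eps _ _ _ 1) => [x [x0 x1 _]|x Hx].
  exact: simplex_norm.
have [x0 x1] : simplex x.
  apply: (simplex_closed (n := n)) => U /nbhs_ballP[e /= e0 eU].
  have [y [y0 y1 _] xy] := Hx e e0; exists y; split=> //.
  by apply: eU; rewrite -ball_normE.
split=> //.
have [e e0 He] : exists2 e, 0 < e & forall i, x ord0 i != 0 -> e <= x ord0 i.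
  have [i0 i0P|H0] := pickP (fun i => x ord0 i != 0); last first.
    by exists 1 => // i; rewrite H0.
  case: (@arg_minP _ _ _ i0 (fun i => x ord0 i != 0) (fun i => x ord0 i) i0P) => i iP Hi.
  exists (x ord0 i); first by rewrite lt_neqAle eq_sym iP x0.
  by move=> j jP; apply: Hi.
have [y [_ _ yX] xy] := Hx e e0.
apply: X_down yX _; apply/fintype.subsetP => i; rewrite !inE => xi.
apply/eqP => yi; have := coord_le_norm (x - y) i; rewrite rowB_coord yi subr0 ger0_norm ?x0 //.
by rewrite leNgt (lt_le_trans xy) // He.
Qed.
End Linear.

Section UnitBall.
Local Open Scope classical_set_scope.
Local Open Scope ring_scope.
Variables (R : realType) (n : nat).

Lemma unit_ball_convex : is_convex (@unit_ball R n).
Proof.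
move=> x y s xB yB /andP[s0 s1]; rewrite /unit_ball /=.
apply: (@le_trans _ _ (\sum_i (s * x ord0 i ^+ 2 + (1 - s) * y ord0 i ^+ 2))).
  apply: ler_sum => i _; rewrite !mxE; move: (x ord0 i) (y ord0 i) => a b.
  have := mulr_ge0 (mulr_ge0 s0 (_ : 0 <= 1 - s)) (sqr_ge0 (a - b)).
  rewrite subr_ge0 => /(_ s1); nra.
rewrite big_split /= -!mulr_sumr; move: xB yB; rewrite /unit_ball /= => xB yB; nra.
Qed.

Lemma unit_ball_closed : closed (@unit_ball R n).
Proof.
have sq (y : 'rV[R]_n) : \sum_i y ord0 i ^+ 2 = \sum_i y ord0 i * y ord0 i.
  by apply: eq_bigr => i _; rewrite expr2.
have -> : @unit_ball R n = (fun y : 'rV[R]_n => \sum_i y ord0 i * y ord0 i) @^-1` [set z | z <= 1].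
  by apply/seteqP; split=> y; rewrite /unit_ball /= sq.
apply: closed_comp; last exact: closed_le.
move=> x _; move: x; apply: (continuous_big (op := fun a b : R => a + b)) => [|i _ x].
  exact: add_continuous.
by apply: continuousM; apply: coord_continuous.
Qed.

Lemma unit_ball_outer y : @unit_ball R n y -> `|y| <= 1.
Proof.
move=> yB; apply: norm_le_coord => // i.
rewrite -(@ler_pXn2r _ 2) // ?nnegrE // expr1n real_normK ?num_real //.
apply: le_trans yB; rewrite (bigD1 i) //= lerDl sumr_ge0 // => j _; exact: sqr_ge0.
Qed.

Lemma unit_ball_inner y : `|y| <= n.+1%:R^-1 -> @unit_ball R n y.
Proof.
move=> yn; rewrite /unit_ball /=.
have n1 : 0 < n.+1%:R :> R by rewrite ltr0n.
have nv : 0 < n.+1%:R^-1 :> R by rewrite invr_gt0.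
have n1' : n.+1%:R^-1 <= 1 :> R by rewrite invf_le1 // ler1n.
apply: (@le_trans _ _ (\sum_(i < n) n.+1%:R^-1)).
  apply: ler_sum => i _; have := le_trans (coord_le_norm y i) yn => yi.
  rewrite -real_normK ?num_real //; have := normr_ge0 (y ord0 i).
  by move: `|y ord0 i| (n.+1%:R^-1) yi nv n1' => u a *; nra.
by rewrite sumr_const card_ord -[_ *+ _]mulr_natl ler_pdivrMr // mul1r ler_nat.
Qed.
End UnitBall.

Section CyclicBall.
Local Open Scope classical_set_scope.
Local Open Scope ring_scope.
Variables (R : realType) (m t d k : nat).
Hypotheses (dt : (d <= t)%N) (d0 : (0 < d)%N) (kE : (d + t)%N = k.+2).
Let V := (m + t + d)%N.
Let W := (m + d.*2)%N.
Let X := shift_complex m t d.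
Let node (v : 'I_V) : R := (v : nat)%:R.

Definition moment (z : 'rV[R]_V) (j : nat) : R :=
  \sum_(v < V | (v < W)%N) z ord0 v * node v ^+ j.

(** The first m + 2d vertices are placed on the moment curve of dimension 2d -
1; the last t - d ones are cone points and keep their own coordinate. The
moment of order 0 is left out because it is determined by the total mass. *)
Definition moment_mx : 'M[R]_(V, k.+1) := \matrix_(v, j)
  if (j < d.*2.-1)%N then (if (v < W)%N then node v ^+ j.+1 else 0)
  else ((v : nat) == (W + (j - d.*2.-1))%N)%:R.

Lemma moment_mx_low (z : 'rV[R]_V) (j : 'I_k.+1) : (j < d.*2.-1)%N ->
  (z *m moment_mx) ord0 j = moment z j.+1.
Proof.
move=> jd; rewrite mxE /moment [RHS]big_mkcond /=; apply: eq_bigr => v _.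
by rewrite mxE jd; case: ifP => _ //; rewrite mulr0.
Qed.

Lemma moment_mx_high (z : 'rV[R]_V) (j : 'I_k.+1) (v : 'I_V) : (d.*2.-1 <= j)%N ->
  (v : nat) = (W + (j - d.*2.-1))%N -> (z *m moment_mx) ord0 j = z ord0 v.
Proof.
move=> jd vE; rewrite mxE (bigD1 v) //= big1 => [|u uv].
  by rewrite mxE ltnNge jd /= -vE eqxx mulr1 addr0.
by rewrite mxE ltnNge jd /= -vE (inj_eq val_inj) (negbTE uv) mulr0.
Qed.

Lemma sum_split (z : 'rV[R]_V) :
  \sum_v z ord0 v = moment z 0 + \sum_(v < V | ~~ (v < W)%N) z ord0 v.
Proof.
rewrite (bigID (fun v : 'I_V => (v < W)%N)) /=; congr (_ + _).
by apply: eq_bigr => v _; rewrite expr0 mulr1.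
Qed.

Lemma moment_kernel (z : 'rV[R]_V) : \sum_v z ord0 v = 0 -> z *m moment_mx = 0 ->
  (forall v : 'I_V, (W <= v)%N -> z ord0 v = 0) /\ (forall j, (j < d.*2)%N -> moment z j = 0).
Proof.
move=> z0 zM.
have high (v : 'I_V) : (W <= v)%N -> z ord0 v = 0.
  move=> Wv; have vlt := ltn_ord v.
  have jlt : (v - W + d.*2.-1 < k.+1)%N by move: vlt Wv kE; rewrite /V /W; lia.
  rewrite -(@moment_mx_high z (Ordinal jlt) v) ?zM ?mxE //=; lia.
split=> // -[|j] jd.
  move: z0; rewrite sum_split [X in _ + X]big1 ?addr0 // => v.
  by rewrite -leqNgt; apply: high.
have jlt : (j < k.+1)%N by lia.
by rewrite -(@moment_mx_low z (Ordinal jlt)) ?zM ?mxE //=; lia.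
Qed.

Lemma moment_kernel_conv (z : 'rV[R]_V) :
  (forall v : 'I_V, (W <= v)%N -> z ord0 v = 0) ->
  (forall j, (j < d.*2)%N -> moment z j = 0) ->
  \sum_v z ord0 v = 0 /\ z *m moment_mx = 0.
Proof.
move=> high low; split.
  rewrite sum_split low ?double_gt0 // add0r big1 // => v; rewrite -leqNgt; exact: high.
apply/rowP => j; rewrite [RHS]mxE; have [jd|jd] := ltnP j d.*2.-1.
  by rewrite moment_mx_low // low //; lia.
have vlt : (W + (j - d.*2.-1) < V)%N by have := ltn_ord j; rewrite /V /W; move: kE; lia.
by rewrite (@moment_mx_high z j (Ordinal vlt)) // high //= leq_addr.
Qed.

Lemma momentN (x y : 'rV[R]_V) j : moment (y - x) j = - moment (x - y) j.
Proof.
by rewrite /moment -sumrN; apply: eq_bigr => v _; rewrite !rowB_coord -mulNr opprB.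
Qed.

Lemma moment_poly (z : 'rV[R]_V) (r : {poly R}) n : (size r <= n)%N ->
  \sum_(v < V | (v < W)%N) z ord0 v * r.[node v] = \sum_(j < n) r`_j * moment z j.
Proof.
move=> sr; rewrite /moment.
under [RHS]eq_bigr do rewrite mulr_sumr.
rewrite exchange_big /=; apply: eq_bigr => v _.
rewrite (horner_coef_wide _ sr) mulr_sumr; apply: eq_bigr => j _.
by rewrite mulrCA.
Qed.

Lemma moment_poly0 (z : 'rV[R]_V) (r : {poly R}) : (size r <= d.*2)%N ->
  (forall j, (j < d.*2)%N -> moment z j = 0) ->
  \sum_(v < V | (v < W)%N) z ord0 v * r.[node v] = 0.
Proof.
move=> sr z0; rewrite (moment_poly z sr) big1 // => j _.
by rewrite z0 // mulr0.
Qed.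

(** Its roots are the vertices of the facet below m + 2d. Being pairs of
consecutive integers, they make it nonnegative at all the nodes, so that it
exposes a lower facet of the cyclic polytope of dimension 2d. *)
Definition facet_poly (q : nat -> nat) : {poly R} :=
  \prod_(i < d.*2) ('X - (vertex_at t q i)%:R%:P).

Lemma size_facet_poly q : size (facet_poly q) = d.*2.+1.
Proof. by rewrite size_prod_XsubC /index_enum -enumT size_enum_ord. Qed.

Lemma facet_poly_monic q : facet_poly q \is monic.
Proof. by apply: monic_prod => i _; apply: monicXsubC. Qed.

Lemma facet_poly_ge0 q (v : nat) : 0 <= (facet_poly q).[v%:R].
Proof.
rewrite horner_prod (eq_bigr (fun i : 'I_(d.*2) => v%:R - (vertex_at t q i)%:R)); last first.
  by move=> i _; apply: hornerXsubC.
rewrite -(big_mkord xpredT (fun i => v%:R - (vertex_at t q i)%:R)).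
have : forall j, (j <= d)%N -> 0 <= \prod_(0 <= i < j.*2) (v%:R - (vertex_at t q i)%:R : R).
  elim=> [|j IH] jd; first by rewrite big_geq.
  rewrite doubleS !big_nat_recr //= -mulrA; apply: mulr_ge0; first exact: IH (ltnW jd).
  rewrite /vertex_at /level; have -> : (j.*2 < t.*2)%N by lia.
  have -> : (j.*2.+1 < t.*2)%N by lia.
  have -> : (j.*2.+1./2 = j)%N by lia.
  rewrite doubleK; move: (q j) => a; rewrite addnS.
  have [va|va] := leqP v (a + j.*2).
    by apply: mulr_le0; rewrite subr_le0 ler_nat //; apply: leqW.
  by apply: mulr_ge0; rewrite subr_ge0 ler_nat // ltnW.
exact.
Qed.

Lemma facet_poly_root q (v : 'I_V) : admissible m d q -> (v < W)%N ->
  (v \in shift_facet m t d q) = ((facet_poly q).[node v] == 0).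
Proof.
move=> aq vW; rewrite -rootE; apply/shift_facetP/idP => [[i id iv]|].
  have i2 : (i < d.*2)%N.
    rewrite ltnNge; apply/negP => di; move: iv vW; have [_ qd] := aq.
    rewrite /vertex_at qd => [<-|]; first by rewrite /W; lia.
    by rewrite /level; case: ltnP => ?; lia.
  rewrite /root horner_prod; apply/eqP; rewrite (bigD1 (Ordinal i2)) //= hornerXsubC.
  by rewrite /node -iv subrr mul0r.
rewrite /root horner_prod => /eqP/eqP; rewrite prodf_seq_eq0 => /hasP[i _ /=].
rewrite hornerXsubC subr_eq0 /node eqr_nat => /eqP vi.
by exists i => //; have := ltn_ord i; lia.
Qed.

Lemma realization_support (x : 'rV[R]_V) : realization X x ->
  exists2 q, admissible m d q & forall v, v \notin shift_facet m t d q -> x ord0 v = 0.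
Proof.
case=> _ _ /generatedP[F /shift_facetsP[q aq ->] /fintype.subsetP H]; exists q => // v vF.
by apply/eqP; apply: contraNT vF => xv; apply: H; rewrite inE.
Qed.

(** Evaluate x - y against [facet_poly q] for a facet q carrying x: it is
monic of degree 2d, so the lower moments drop out and the moment of order 2d
remains, and x contributes nothing. *)
Lemma top_moment_le (x y : 'rV[R]_V) : realization X x -> realization X y ->
  (forall j, (j < d.*2)%N -> moment (x - y) j = 0) ->
  exists2 q, admissible m d q &
   [/\ forall v, v \notin shift_facet m t d q -> x ord0 v = 0,
       moment (x - y) d.*2 = - \sum_(v < V | (v < W)%N) y ord0 v * (facet_poly q).[node v] &
       forall v : 'I_V, (v < W)%N -> 0 <= y ord0 v * (facet_poly q).[node v]].
Proof.
move=> Rx Ry z0; have [q aq xq] := realization_support Rx; exists q => //.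
split=> // [|v vW]; last by apply: mulr_ge0; [case: Ry|apply: facet_poly_ge0].
have sz := size_facet_poly q; have := facet_poly_monic q; rewrite monicE lead_coefE sz /= => /eqP lc.
have := moment_poly (x - y) (eq_leq sz).
rewrite big_ord_recr /= lc mul1r [X in _ = X + _]big1 ?add0r => [<-|j _]; last by rewrite z0 // mulr0.
rewrite -sumrN; apply: eq_bigr => v vW; rewrite rowB_coord mulrBl.
have [|vF] := boolP (v \in shift_facet m t d q).
  by rewrite (facet_poly_root aq vW) => /eqP ->; rewrite !mulr0 subr0 oppr0.
by rewrite xq // mul0r sub0r.
Qed.

(** Applying [top_moment_le] both ways shows that the moments of order 2d
agree, so that y is carried by the facet of x; the coordinates at its 2d nodes
are then determined by the 2d lower moments. *)
Lemma moment_mx_inj : {in realization X &, injective (fun x : 'rV[R]_V => x *m moment_mx)}.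
Proof.
move=> x y; rewrite !inE => Rx Ry exy.
have xy0 : \sum_v (x - y) ord0 v = 0.
  rewrite (eq_bigr (fun v => x ord0 v - y ord0 v)) => [|v _]; last exact: rowB_coord.
  by rewrite sumrB; case: Rx => _ -> _; case: Ry => _ -> _; rewrite subrr.
have xyM : (x - y) *m moment_mx = 0 by rewrite mulmxBl exy subrr.
have [high low] := moment_kernel xy0 xyM.
have [q aq [xq m1 p1]] := top_moment_le Rx Ry low.
have low' j : (j < d.*2)%N -> moment (y - x) j = 0.
  by move=> /low H; rewrite momentN H oppr0.
have [q' aq' [_ m2 p2]] := top_moment_le Ry Rx low'.
have mN := momentN x y d.*2.
have s1 : 0 <= \sum_(v < V | (v < W)%N) y ord0 v * (facet_poly q).[node v] by apply: sumr_ge0.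
have s2 : 0 <= \sum_(v < V | (v < W)%N) x ord0 v * (facet_poly q').[node v] by apply: sumr_ge0.
have {s1 s2 m1 m2 mN} s0 : \sum_(v < V | (v < W)%N) y ord0 v * (facet_poly q).[node v] = 0 by lra.
have yq (v : 'I_V) : (v < W)%N -> v \notin shift_facet m t d q -> y ord0 v = 0.
  move=> vW; rewrite (facet_poly_root aq vW) => fv.
  move/eqP: s0; rewrite psumr_eq0 => [/allP/(_ v)|u uW]; last exact: p1.
  by rewrite mem_index_enum vW mulf_eq0 (negbTE fv) orbF => /(_ isT)/eqP.
apply/eqP; rewrite -subr_eq0; apply/eqP/rowP => v; rewrite [RHS]mxE.
have [/high //|vW] := leqP W v.
have [vF|vF] := boolP (v \in shift_facet m t d q); last first.
  by rewrite rowB_coord xq // yq // subrr.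
(* test against the product of the other roots *)
have /shift_facetP[i id iv] := vF.
have i2 : (i < d.*2)%N.
  rewrite ltnNge; apply/negP => di; move: iv vW; have [_ qd] := aq.
  rewrite /vertex_at qd => [<-|]; first by rewrite /W; lia.
  by rewrite /level; case: ltnP => ?; lia.
pose r : {poly R} := \prod_(j < d.*2 | j != Ordinal i2) ('X - (vertex_at t q j)%:R%:P).
have rm : r \is monic by apply: monic_prod => j _; apply: monicXsubC.
have fr : facet_poly q = ('X - (node v)%:P) * r by rewrite /facet_poly (bigD1 (Ordinal i2)) //= iv.
have sr : size r = d.*2.
  have := size_facet_poly q; rewrite fr size_monicM ?monicXsubC ?monic_neq0 // size_XsubC.
  by case.
have := moment_poly0 (eq_leq sr) low.
rewrite (bigD1 v) //= big1 ?addr0 => [|u /andP[uW uv]].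
  move/eqP; rewrite mulf_eq0 => /orP[/eqP //|].
  rewrite /r horner_prod prodf_seq_eq0 => /hasP[j _ /andP[ji]].
  rewrite hornerXsubC subr_eq0 /node -iv eqr_nat => /eqP vij.
  by move: ji; rewrite -val_eqE /= (vertex_at_inj aq vij) eqxx.
have [uF|uF] := boolP (u \in shift_facet m t d q); last by rewrite rowB_coord xq // yq // subrr mul0r.
move: uF; rewrite (facet_poly_root aq uW) fr hornerM hornerXsubC mulf_eq0 subr_eq0 /node eqr_nat.
by rewrite (inj_eq val_inj) (negbTE uv) /= => /eqP ->; rewrite mulr0.
Qed.
Lemma same_image_compact (x : 'rV[R]_V) :
  compact [set y : 'rV[R]_V | simplex y /\ y *m moment_mx = x *m moment_mx].
Proof.
apply: (@compact_eps _ _ _ 1) => [y [Sy _]|y Hy]; first exact: simplex_norm.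
split.
  apply: (simplex_closed (n := V)) => U /nbhs_ballP[e /= e0 eU].
  have [z [Sz _] yz] := Hy e e0; exists z; split=> //.
  by apply: eU; rewrite -ball_normE.
apply/eqP; rewrite -subr_eq0 -normr_le0 leNgt; apply/negP => e0.
have [a a0 Ha] := @mulmx_cont_on R V k.+1 moment_mx setT y I _ e0.
have [z [_ zx] yz] := Hy a a0.
by have := Ha z I yz; rewrite zx ltxx.
Qed.

Lemma small_step n (y z : 'rV[R]_n) : (forall v, 0 <= y ord0 v) ->
  (forall v, 0 < z ord0 v -> 0 < y ord0 v) ->
  exists2 e, 0 < e & forall v, e * z ord0 v <= y ord0 v.
Proof.
move=> y0 zy; have [v0 v0P|H0] := pickP (fun v => 0 < z ord0 v); last first.
  exists 1 => // v; rewrite mul1r; apply: le_trans (y0 v).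
  by rewrite leNgt H0.
case: (@arg_minP _ _ _ v0 (fun v => 0 < z ord0 v) (fun v => y ord0 v / z ord0 v) v0P) => u uP Hu.
exists (y ord0 u / z ord0 u); first by rewrite divr_gt0 // zy.
move=> v; have [zv|zv] := ltP 0 (z ord0 v); first by rewrite -ler_pdivlMr // Hu.
by apply: le_trans (y0 v); rewrite mulr_ge0_le0 // divr_ge0 // ltW.
Qed.

(** The coefficients of a divided difference of order 2d: their signs
alternate, starting and ending with a positive one. *)
Lemma lowering_dependency (a : nat -> nat) :
  (forall i j, (i < j)%N -> (j <= d.*2)%N -> (a i < a j)%N) -> (a d.*2 < W)%N ->
  exists z : 'rV[R]_V, [/\ forall v : 'I_V, (W <= v)%N -> z ord0 v = 0,
    forall j, (j < d.*2)%N -> moment z j = 0, moment z d.*2 = 1 &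
    forall v, 0 < z ord0 v -> exists2 i, (i <= d)%N & a i.*2 = v].
Proof.
move=> mono aW.
have ale i : (i <= d.*2)%N -> (a i < W)%N.
  rewrite leq_eqVlt => /orP[/eqP -> //|id]; apply: ltn_trans aW; exact: mono.
have WV : (W <= V)%N by rewrite /W /V; lia.
pose b (i : 'I_(d.*2.+1)) : R := (a i)%:R.
have b_inj : injective b.
  move=> i j /eqP; rewrite eqr_nat => /eqP aij; apply: ord_inj.
  have := mono i j; have := mono j i; rewrite aij ltnn.
  have := ltn_ord i; have := ltn_ord j; rewrite !ltnS.
  by case: ltngtP => // _ jd id H1 H2; [have := H1 isT id | have := H2 isT jd].
pose c (i : 'I_(d.*2.+1)) : R := (\prod_(j | j != i) (b i - b j))^-1.
have sgn (i : 'I_(d.*2.+1)) : 0 < (-1) ^+ i * c i.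
  have : 0 < (-1) ^+ (d.*2 - i) * \prod_(j < d.*2.+1 | (j : nat) != i) (b i - b j).
    apply: (@denominator_sign R d.*2 (fun i => (a i)%:R)); first exact: (ltn_ord i).
    by move=> i' j' ij jd; rewrite ltr_nat mono.
  rewrite -signr_odd oddB; last exact: (ltn_ord i).
  rewrite odd_double addFb signr_odd -invr_gt0 invfM invr_sign.
  by rewrite (eq_bigl (fun j => j != i)).
pose z : 'rV[R]_V := \row_(v < V) \sum_(i < d.*2.+1) (a i == v)%:R * c i.
have zsum (h : nat -> R) : \sum_(v < V | (v < W)%N) z ord0 v * h v = \sum_i c i * h (a i).
  under eq_bigr do rewrite mxE mulr_suml.
  rewrite exchange_big /=; apply: eq_bigr => i _.
  have ai := ale i (ltn_ord i); have aiV := leq_trans ai WV.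
  rewrite (bigD1 (Ordinal aiV)) //= eqxx mul1r big1 ?addr0 // => v /andP[_ vi].
  have -> : (a i == v) = false by apply: contraNF vi => /eqP av; apply/eqP/ord_inj.
  by rewrite !mul0r.
have zmom j : (j <= d.*2)%N -> moment z j = (d.*2 == j)%:R.
  move=> jd; rewrite /moment (zsum (fun v => v%:R ^+ j)).
  rewrite -coefXn -(divided_difference b_inj); last by rewrite size_polyXn.
  by apply: eq_bigr => i _; rewrite hornerXn mulrC.
exists z; split.
- move=> v Wv; rewrite mxE big1 // => i _.
  have := ale i (ltn_ord i); case: eqP => [->|_]; last by rewrite mul0r.
  by rewrite ltnNge Wv.
- by move=> j jd; rewrite zmom ?(ltnW jd) // gtn_eqF.
- by rewrite zmom // eqxx.
move=> v; rewrite mxE => zv.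
have [i /andP[ai ci]] : exists i : 'I_(d.*2.+1), (a i == v) && (0 < c i).
  apply/existsP; apply: contraTT zv => /existsPn H; rewrite -leNgt.
  apply: sumr_le0 => i _; have := H i; case: eqP => [_|_] /=; last by rewrite mul0r.
  by rewrite mul1r -leNgt.
have ie : ~~ odd i.
  apply/negP => io; have := sgn i; rewrite -signr_odd io expr1 mulN1r oppr_gt0.
  by rewrite ltNge ltW.
exists (i./2); first by have := ltn_ord i; lia.
by rewrite even_halfK //; apply/eqP.
Qed.

(** In the fibre of x choose a point with the least moment of order 2d. Its
support cannot contain d + 1 pairwise non-adjacent nodes, since subtracting a
[lowering_dependency] that interlaces them would decrease this moment; by
[chain_or_cover] it is covered by d disjoint pairs, which make up a facet. *)
Lemma moment_mx_onto (x : 'rV[R]_V) : simplex x ->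
  exists2 y, realization X y & y *m moment_mx = x *m moment_mx.
Proof.
move=> Sx; pose K := [set y : 'rV[R]_V | simplex y /\ y *m moment_mx = x *m moment_mx].
pose c (v : 'I_V) : R := if (v < W)%N then node v ^+ d.*2 else 0.
have momE y : moment y d.*2 = \sum_v y ord0 v * c v.
  rewrite /moment big_mkcond /=; apply: eq_bigr => v _.
  by rewrite /c; case: ifP => // _; rewrite mulr0.
have K0 : K !=set0 by exists x.
have cm : {within K, continuous (fun y : 'rV[R]_V => \sum_v y ord0 v * c v : R^o)}.
  by apply/cont_onP; apply: lincomb_cont_on.
have [y yK ymin] := compact_EVT_min K0 (@same_image_compact x) cm.
have [[y0 y1] yx] : K y by rewrite inE in yK.
exists y => //.
pose S (n : nat) := [exists v : 'I_V, ((v : nat) == n) && (0 < y ord0 v)].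
have dW : (d.*2 <= W)%N by rewrite /W leq_addl.
have [[s [s1 s2]]|[j [j1 j2 j3]]] := chain_or_cover S 0 dW.
  (* The chain occupies the even places; each odd place is the successor of
     the preceding node, and is strictly before the next one. *)
  exfalso; pose a i := if odd i then (s i./2).+1 else s i./2.
  have smono i i' : (i < i')%N -> (i' <= d)%N -> (s i + 2 <= s i')%N.
    elim: i' => // i' IH; rewrite ltnS leq_eqVlt => /orP[/eqP ->|ii'] id; first exact: s2.
    by have := IH ii' (ltnW id); have := s2 i' id; lia.
  have mono i i' : (i < i')%N -> (i' <= d.*2)%N -> (a i < a i')%N.
    move=> ii' id; have [e|ne] := eqVneq (i./2) (i'./2).
      by rewrite /a e; do 2 case: ifP => ?; lia.
    have := smono i./2 i'./2; rewrite /a; do 2 case: ifP => ?; lia.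
  have aW : (a d.*2 < W)%N.
    by rewrite /a odd_double doubleK; have [/andP[]] := s1 d (leqnn d).
  have [z [zhigh zlow ztop zpos]] := lowering_dependency mono aW.
  have zy v : 0 < z ord0 v -> 0 < y ord0 v.
    move=> /zpos[i id av]; have [_ /existsP[u /andP[/eqP us yu]]] := s1 i id.
    by have -> : v = u by apply: ord_inj; rewrite us -av /a odd_double doubleK.
  have [e e0 He] := small_step y0 zy.
  have [z0 zM] := moment_kernel_conv zhigh zlow.
  have Ky' : (y - e *: z) \in K.
    rewrite inE; split; last by rewrite mulmxBl -scalemxAl zM scaler0 subr0.
    split=> [v|]; first by rewrite rowB_coord mxE subr_ge0.
    rewrite (eq_bigr (fun v => y ord0 v - e * z ord0 v)) => [|v _]; last by rewrite rowB_coord mxE.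
    by rewrite sumrB -mulr_sumr z0 mulr0 subr0.
  have := ymin _ Ky'; rewrite -!momE.
  have -> : moment (y - e *: z) d.*2 = moment y d.*2 - e * moment z d.*2.
    rewrite /moment mulr_sumr -sumrB; apply: eq_bigr => v _.
    by rewrite rowB_coord mxE mulrBl mulrA.
  by rewrite ztop mulr1 lerBrDr gerDl leNgt e0.
pose q l := if (l < d)%N then (j l - l.*2)%N else m.
have jlow i : (i < d)%N -> (i.*2 <= j i)%N.
  by elim: i => // i IH id; have := IH (ltnW id); have := j2 i id; lia.
have aq : admissible m d q.
  split=> [|i di]; last by rewrite /q ltnNge di.
  apply: (@homo_leq _ q leq) => [//|? ? ?|i]; first exact: leq_trans.
  rewrite /q; case: (ltnP i.+1 d) => id; first by have := j2 i id; have := ltnW id; case: ltnP; lia.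
  by case: (ltnP i d) => // id'; have := j1 i id'; rewrite /W; lia.
split=> //; apply/generatedP; exists (shift_facet m t d q); first by apply/shift_facetsP; exists q.
apply/fintype.subsetP => v; rewrite inE => yv.
have [Wv|vW] := leqP W v.
  apply/shift_facetP; have vlt := ltn_ord v; exists (v - m)%N.
    by move: Wv vlt; rewrite /W /V; lia.
  have [_ qd] := aq; rewrite /vertex_at qd; first by move: Wv; rewrite /W; lia.
  by move: Wv; rewrite /W /level; case: ltnP => ?; lia.
have Sv : S v by apply/existsP; exists v; rewrite eqxx lt_neqAle eq_sym yv y0.
have [|i id vi] := j3 v _ Sv; first by rewrite leq0n.
have := jlow i id; apply/implyP; case: vi => vi; apply/implyP => ji.
  apply/shift_facetP; exists i.*2; first by lia.
  rewrite /vertex_at /level; have -> : (i.*2 < t.*2)%N by lia.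
  by rewrite doubleK /q id vi; lia.
apply/shift_facetP; exists i.*2.+1; first by lia.
rewrite /vertex_at /level; have -> : (i.*2.+1 < t.*2)%N by lia.
have -> : (i.*2.+1./2 = i)%N by lia.
by rewrite /q id vi; lia.
Qed.

Lemma shift_complex_down (S T : {set 'I_(m + t + d)}) : T \in X -> S \subset T -> S \in X.
Proof.
move=> /generatedP[F FS TF] ST; apply/generatedP; exists F => //.
exact: fintype.subset_trans TF.
Qed.

Let body : set 'rV[R]_k.+1 := (fun x : 'rV[R]_V => x *m moment_mx) @` realization X.

Lemma body_simplex (x : 'rV[R]_V) : simplex x -> body (x *m moment_mx).
Proof. by move=> /(moment_mx_onto)[y Ry <-]; exists y. Qed.

Lemma body_convex : is_convex body.
Proof.
move=> _ _ s [x [x0 x1 _] <-] [y [y0 y1 _] <-] /andP[s0 s1].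
rewrite /= !scalemxAl -mulmxDl; apply: body_simplex; split=> [i|].
  by rewrite !mxE addr_ge0 // mulr_ge0 // subr_ge0.
rewrite (eq_bigr (fun i => s * x ord0 i + (1 - s) * y ord0 i)) => [|i _]; last by rewrite !mxE.
by rewrite big_split /= -!mulr_sumr x1 y1 !mulr1 addrC subrK.
Qed.

Lemma body_compact : compact body.
Proof.
apply: continuous_compact; last exact: realization_compact shift_complex_down.
by apply/cont_onP; apply: mulmx_cont_on.
Qed.

Let q0 l := if (l < d)%N then 0%N else m.
Let facet_mx : 'M[R]_(k.+2, V) := \matrix_(i, v) (vertex_at t q0 i == v)%:R.

Lemma facet_mx_at (x : 'rV[R]_k.+2) (i : 'I_k.+2) (v : 'I_V) : vertex_at t q0 i = v ->
  (x *m facet_mx) ord0 v = x ord0 i.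
Proof.
move=> iv; rewrite mxE (bigD1 i) //= big1 ?addr0 => [|j ji]; first by rewrite mxE iv eqxx mulr1.
rewrite mxE -iv; case: eqP => [H|_]; last by rewrite mulr0.
by move: ji; rewrite (ord_inj (vertex_at_inj (base_admissible m d) H)) eqxx.
Qed.

Lemma facet_mx_realization (x : 'rV[R]_k.+2) : simplex x -> realization X (x *m facet_mx).
Proof.
move=> [x0 x1]; split.
- by move=> v; rewrite mxE sumr_ge0 // => i _; rewrite mxE mulr_ge0.
- rewrite -x1; under eq_bigr do rewrite mxE; rewrite exchange_big /=; apply: eq_bigr => i _.
  have iV : (vertex_at t q0 i < V)%N.
    by apply: (@vertex_at_lt m t d q0 i (base_admissible m d)); rewrite kE.
  rewrite (bigD1 (Ordinal iV)) //= mxE eqxx mulr1 big1 ?addr0 // => v vi.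
  rewrite mxE; case: eqP => [H|_]; last by rewrite mulr0.
  by move: vi; rewrite -val_eqE /= H eqxx.
apply/generatedP; exists (shift_facet m t d q0).
  by apply/shift_facetsP; exists q0 => //; exact: base_admissible.
apply/fintype.subsetP => v; rewrite inE => xv.
have [i iv] : exists i : 'I_k.+2, vertex_at t q0 i == v.
  apply/existsP; apply: contraNT xv => /existsPn H.
  by rewrite mxE big1 // => i _; rewrite mxE (negbTE (H i)) mulr0.
by apply/shift_facetP; exists i; [rewrite kE|apply/eqP].
Qed.

(** The image of a single facet already has an interior point, by invariance
of domain. *)
Lemma body_interior : exists c, exists2 e, 0 < e & forall z, `|z - c| < e -> body z.
Proof.
pose F (x : 'rV[R]_k.+2) := x *m facet_mx *m moment_mx.
have cF : cont_on (@simplex R k.+2) F.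
  have c1 := @mulmx_cont_on R _ _ facet_mx (@simplex R k.+2).
  exact: (cont_on_comp c1 (fun _ _ => I) (@mulmx_cont_on R _ _ moment_mx setT)).
have iF : {in @simplex R k.+2 &, injective F}.
  move=> x y; rewrite !inE => Sx Sy exy.
  have : x *m facet_mx = y *m facet_mx.
    by apply: (moment_mx_inj) exy; rewrite inE; exact: facet_mx_realization.
  move=> xy; apply/rowP => i.
  have iV : (vertex_at t q0 i < V)%N.
    by apply: (@vertex_at_lt m t d q0 i (base_admissible m d)); rewrite kE.
  by rewrite -(@facet_mx_at x i (Ordinal iV)) // -(@facet_mx_at y i (Ordinal iV)) // xy.
have [e e0 He] := invariance_of_domain cF iF (barycenter_simplex R k.+1) (@barycenter_gt0 R k.+1).
exists (F (barycenter R k.+1)), e => // z /He[x Sx <-].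
by case: (facet_mx_realization Sx) => ? ? _; apply: body_simplex.
Qed.

(** The image of the realization under [moment_mx] is convex, since it is also
the image of the whole simplex. *)
Theorem shift_complex_ball : is_simplicial_ball R X.
Proof.
split; first exact: pure_shift_complex.
have -> : (rank X).-1 = k.+1 by rewrite rank_shift_complex kE.
have hX : homeomorphic (@realization R V X) body.
  apply: compact_homeomorphic.
  - exact: realization_compact shift_complex_down.
  - exact: mulmx_cont_on.
  - exact: moment_mx_inj.
apply: (homeomorphic_trans hX).
have [c [e e0 He]] := body_interior.
pose body' := [set y | body (y + c)].
have hT : homeomorphic body body'.
  apply/homeomorphicP; exists (fun y => y - c), (fun y => y + c); split.
  - by apply: (@lipschitz_cont_on _ _ _ _ _ 1) => x y; rewrite mul1r opprB addrA subrK.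
  - by apply: (@lipschitz_cont_on _ _ _ _ _ 1) => x y; rewrite mul1r opprD addrACA subrr addr0.
  - by move=> x bx; rewrite /body' /= subrK.
  - by move=> y by_; rewrite addrK.
apply: (homeomorphic_trans hT).
have [B [_ HB]] := compact_bounded body_compact.
pose B' := `|B| + 1 + `|c|.
have B0 : 0 < B' by rewrite ltr_wpDr // ltr_wpDl.
have e2 : 0 < e / 2 by rewrite divr_gt0.
have clb : closed body by apply: compact_closed body_compact; exact: norm_hausdorff.
have r20 : 0 < k.+2%:R^-1 :> R by rewrite invr_gt0 ltr0n.
apply: (radial_homeomorphic (r1 := e / 2) (B1 := B') (r2 := k.+2%:R^-1) (B2 := 1)) => //.
- move=> x y s bx bY s01; rewrite /body' /=.
  have -> : s *: x + (1 - s) *: y + c = s *: (x + c) + (1 - s) *: (y + c).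
    by rewrite !scalerDr addrACA -scalerDl (addrC s) subrK scale1r.
  exact: body_convex.
- rewrite -[body']/((fun y : 'rV[R]_k.+1 => y + c) @^-1` body).
  apply: closed_comp => // y _.
  by apply: (@lipschitz_at _ _ _ _ 1) => u v; rewrite mul1r opprD addrACA subrr addr0.
- move=> y ye; apply: He; rewrite addrK; apply: le_lt_trans ye _.
  by rewrite ltr_pdivrMr // mulr_natr mulr2n ltrDl.
- move=> y by_; have -> : y = (y + c) - c by rewrite addrK.
  apply: le_trans (ler_normB _ _) _; rewrite lerD2r; apply: (HB (`|B| + 1)) => //.
  by rewrite (le_lt_trans (ler_norm B)) // ltrDl.
- exact: unit_ball_convex.
- exact: unit_ball_closed.
- exact: unit_ball_inner.
- exact: unit_ball_outer.
Qed.


End CyclicBall.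

Section Low.
Local Open Scope classical_set_scope.
Local Open Scope ring_scope.
Variables (R : realType) (m t d : nat).
Hypotheses (td : (t < d)%N) (m2 : (2 <= m)%N) (d2 : (2 <= d)%N).
Local Notation X := (shift_complex m t d).

Lemma shift_complex_not_pseudomanifold : ~ pseudomanifold X.
Proof.
case=> _ _ /(_ _ (initial_ridge_ridge td (ltnW m2))).
by rewrite initial_ridge_degree // ltnS leqNgt m2.
Qed.

Lemma shift_complex_not_ball : ~ is_simplicial_ball R X.
Proof.
case=> _; have [k kE] : exists k, (d + t)%N = k.+2 by exists (d + t - 2)%N; lia.
have -> : (rank X).-1 = k.+1 by rewrite rank_shift_complex kE.
move=> /homeomorphicP[f [g [cf _ fg _]]].
have kV : (k.+1 <= m + t + d)%N by lia.
have vV i : (i < 3)%N -> (k.+1 + i < m + t + d)%N by lia.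
pose v i (i3 : (i < 3)%N) := Ordinal (vV i i3).
have AE : [set widen_ord kV i | i in 'I_k.+1]%SET = initial_ridge m t d.
  apply/setP => u; rewrite finset.in_set; apply/imsetP/idP => [[i _ ->]|ud] /=.
    by have := ltn_ord i; lia.
  have uk : (u < k.+1)%N by lia.
  by exists (Ordinal uk) => //; apply: ord_inj.
have vA i (i3 : (i < 3)%N) : v i i3 \notin [set widen_ord kV i | i in 'I_k.+1]%SET.
  by rewrite AE finset.in_set /=; lia.
have vX i (i3 : (i < 3)%N) : (v i i3 |: [set widen_ord kV i | i in 'I_k.+1])%SET \in X.
  apply/generatedP; exists (v i i3 |: [set widen_ord kV i | i in 'I_k.+1])%SET => //.
  by rewrite AE; apply: initial_cofacet => //; rewrite -AE.
have winj : injective (widen_ord kV) by move=> i j /(congr1 val) /= /ord_inj.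
apply: (@three_sheets_not_embeddable R _ k X (@shift_complex_down m t d) (widen_ord kV)
  (v 0%N isT) (v 1%N isT) (v 2%N isT)
  winj _ _ _ _ _ _ _ _ _ f cf) => //; try by rewrite -val_eqE /= eqn_add2l.
by move=> x y; rewrite !inE => /fg[_ gx] /fg[_ gy] exy; rewrite -gx -gy exy.
Qed.
End Low.

Theorem theorem5p5 (R : realType) (K : fieldType) (m : nat)
    (U : set (mpoly.mpoly m K)) (t : nat)
    (hm : 2 <= m) (hU : maximal_order_ideal U) (hd : 2 <= dmax U) :
  [/\ is_simplicial_ball R (squeezed_complex U t) <-> pseudomanifold (squeezed_complex U t),
      pseudomanifold (squeezed_complex U t) <-> dmax U <= t
    & t < dmax U ->
      (exists A, ridge (squeezed_complex U t) A /\
                 ridge_degree (squeezed_complex U t) A = m.+1) /\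
      (forall A, ridge (squeezed_complex U t) A ->
                 ridge_degree (squeezed_complex U t) A <= m.+1)].
Proof.
rewrite (squeezed_complexE (ltnW hm) hU).
have pseudo : pseudomanifold (shift_complex m t (dmax U)) <-> dmax U <= t.
  split; last exact: shift_complex_pseudomanifold.
  by move=> ps; rewrite leqNgt; apply/negP => td; case: (shift_complex_not_pseudomanifold td hm).
have ball : is_simplicial_ball R (shift_complex m t (dmax U)) <-> dmax U <= t.
  split=> [bl|dt].
    by rewrite leqNgt; apply/negP => td; case: (shift_complex_not_ball td hm hd bl).
  have [k kE] : exists k, dmax U + t = k.+2 by exists (dmax U + t - 2); lia.
  exact: (@shift_complex_ball R m t (dmax U) k dt (ltnW hd) kE).
split; [by rewrite ball pseudo|exact: pseudo|].
move=> td; split; last by move=> A; apply: shift_complex_degree_le.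
exists (initial_ridge m t (dmax U)); split; last exact: initial_ridge_degree.
exact: initial_ridge_ridge td (ltnW hm).
Qed.
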